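(* Let $d\ge 1$ be an integer, $1<p<\infty$, and let $\mu\in M_+(\overline{B}_d)$ be a finite positive Borel measure on the closed unit ball $\overline{B}_d$ of $\mathbb{C}^d$. Then the following properties are equivalent. (i) There exists a constant $C>0$ such that $$\int_{\overline{B}_d}|f|^p\,d\mu\ \ge\ C\,\|f\|_{H^p}^p\quad\text{for all } f\in C(\overline{B}_d)\cap H^p(B_d).$$ (ii) There exists a constant $C>0$ such that $$\int_{\overline{B}_d}|K_w|^p\,d\mu\ \ge\ C\quad\text{for all } w\in B_d.$$ (iii) There exists a constant $C>0$ such that $$\mu(Q)\ \ge\ C\,\sigma(Q)\quad\text{for all nonisotropic balls } Q\subset\partial B_d.$$
   Context: $B_d$ is the open unit ball of $\mathbb{C}^d$, $\overline{B}_d$ its closure, $\partial B_d$ the unit sphere, and $\sigma=\sigma_d$ the normalized Lebesgue measure on $\partial B_d$. $\langle\cdot,\cdot\rangle$ is the standard Hermitian inner product on $\mathbb{C}^d$, linear in the first variable. $M_+(\overline{B}_d)$ is the set of all finite positive Borel measures on $\overline{B}_d$. For $0<p<\infty$, the Hardy space $H^p=H^p(B_d)$ consists of the holomorphic functions $f$ on $B_d$ with $\|f\|_{H^p}^p=\sup_{0<r<1}\int_{\partial B_d}|f(r\zeta)|^p\,d\sigma(\zeta)<\infty$. The set $C(\overline{B}_d)\cap H^p(B_d)$ consists of the functions continuous on $\overline{B}_d$ whose restriction to $B_d$ belongs to $H^p(B_d)$. For $w\in B_d$, put $k_w(z)=(1-\langle z,w\rangle)^{-d}$ (defined and continuous for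 $z\in\overline{B}_d$) and $K_w=k_w/\|k_w\|_{H^p}$. A nonisotropic ball is a set of the form $Q=Q(\zeta,\delta)=\{\xi\in\partial B_d:\ |1-\langle\zeta,\xi\rangle|\le\delta\}$ with $\zeta\in\partial B_d$ and $\delta>0$. *)

(* Defs.v *)
From HB Require Import structures.
From mathcomp Require Import all_boot all_order all_algebra.
From mathcomp Require Import all_classical all_reals all_analysis.
From mathcomp Require Import measurable_realfun complex.
Import Order.TTheory GRing.Theory Num.Theory.
Import numFieldNormedType.Exports.

Set Implicit Arguments.
Unset Strict Implicit.
Unset Printing Implicit Defensive.

Local Open Scope classical_set_scope.
Local Open Scope ring_scope.
Local Open Scope complex_scope.

(* The usual topology of C and its structure of normed space over itself,
   through which 'rV[R[i]]_d is a complex normed space. *)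
#[warnings="-redundant-canonical-projection"]
HB.instance Definition _ (R : realType) :=
  PseudoPointedMetric.copy R[i] (R[i] : numClosedFieldType)^o.
#[warnings="-redundant-canonical-projection"]
HB.instance Definition _ (R : realType) :=
  NormedModule.copy R[i] (R[i] : numClosedFieldType)^o.

Notation Cvec R d := 'rV[R[i]]_d.

(* C^d with its Borel sigma-algebra. *)
Notation borelC R d := (g_sigma_algebraType (@open (Cvec R d))).

Section hermitian.
Variables (R : realType) (d : nat).
Implicit Types (z w : Cvec R d).

Definition inner z w : R[i] := \sum_(j < d) z ord0 j * (w ord0 j)^*.

(* The Euclidean norm; the library norm `|z| of a row vector is the sup norm. *)
Definition enorm z : R := Num.sqrt (complex.Re (inner z z)).

Definition unit_ball : set (Cvec R d) := [set z | enorm z < 1].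
Definition closed_unit_ball : set (Cvec R d) := [set z | enorm z <= 1].
Definition unit_sphere : set (Cvec R d) := [set z | enorm z = 1].

Definition nonisotropic_ball (zeta : Cvec R d) (delta : R) : set (Cvec R d) :=
  [set xi | unit_sphere xi /\ Normc.normc (1 - inner zeta xi) <= delta].

End hermitian.
Arguments unit_ball {R d}.
Arguments closed_unit_ball {R d}.
Arguments unit_sphere {R d}.

Section lebesgue_tuple.
Variable R : realType.

Lemma measurable_fun_cons_swap n :
  measurable_fun [set: n.-tuple R * R] (fun p => [tuple of p.2 :: p.1]).
Proof. exact: (measurable_cons (f := snd) (g := fst)). Qed.

Definition mcons n (m : {measure set (n.-tuple R) -> \bar R}) :
    set (n.+1.-tuple R) -> \bar R :=
  pushforward (m \x (@lebesgue_measure R))%E (fun p => [tuple of p.2 :: p.1]).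

HB.instance Definition _ n m := Measure.copy (@mcons n m)
  (measure_function_pushforward__canonical__measure_function_Measure
     (m \x (@lebesgue_measure R))%E (@measurable_fun_cons_swap n)).

(* Lebesgue measure on R^n, as an iterated product. *)
Fixpoint lebesgue_tuple n : {measure set (n.-tuple R) -> \bar R} :=
  if n is n'.+1 then mcons (lebesgue_tuple n') else dirac [tuple].

End lebesgue_tuple.

Section volume.
Variables (R : realType) (d : nat).

(* R^(2d) = C^d, (x, y) |-> x + iy. *)
Definition tuple_to_C (t : (d + d).-tuple R) : Cvec R d :=
  \row_(j < d) (tnth t (lshift d j) +i* tnth t (rshift d j)).

Let box (q : (d + d).-tuple rat) (k : nat) : set ((d + d).-tuple R) :=
  [set t | forall i, `|tnth t i - ratr (tnth q i)| < k.+1%:R^-1].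

Let measurable_box q k : measurable (box q k).
Proof.
rewrite (_ : box q k = \bigcap_(i in [set: 'I_(d + d)])
    ((fun t : (d + d).-tuple R => `|tnth t i - ratr (tnth q i)|) @^-1`
     `]-oo, k.+1%:R^-1[%classic)).
  apply: fin_bigcap_measurable => // i _.
  rewrite -[X in measurable X]setTI.
  suff: measurable_fun [set: (d + d).-tuple R]
      (fun t => `|tnth t i - ratr (tnth q i)|) by exact.
  apply: measurableT_comp => //; apply: measurable_funB => //.
  exact: measurable_tnth.
by apply/seteqP; split=> t /= h i => [_|]; have := h i; rewrite ?in_itv /=;
  [|apply].
Qed.

Lemma measurable_tuple_to_C :
  measurable_fun [set: (d + d).-tuple R]
    (tuple_to_C : (d + d).-tuple R -> borelC R d).
Proof.
apply: (@measurability _ _ _ (borelC R d) _ _ (@open (Cvec R d))) => //.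
move=> _ [U oU <-]; rewrite setTI.
pose I := [set qk : (d + d).-tuple rat * nat |
  box qk.1 qk.2 `<=` tuple_to_C @^-1` U].
rewrite (_ : _ @^-1` U = \bigcup_(qk in I) box qk.1 qk.2).
  rewrite bigcup_mkcond; apply: countable_bigcupT_measurable => // qk.
  by case: ifP => _ //; exact: measurable_box.
apply/seteqP; split=> [t Ut|t [qk Iqk] /Iqk//].
have : nbhs (tuple_to_C t : Cvec R d) U by apply: open_nbhs_nbhs; split.
rewrite -nbhs_ballE => -[e /= e0 eU].
have [r r0 er] : exists2 r : R, 0 < r & e = r%:C.
  case: e e0 {eU} => a b; rewrite ltcE /= => /andP[/eqP -> a0].
  by exists a.
have [k hk] : exists k : nat, k.+1%:R^-1 * 4 < r.
  have r4 : 0 < r / 4 by rewrite divr_gt0.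
  have [k kr] := ltr_add_invr r4.
  by exists k; move: kr; rewrite add0r ltr_pdivlMr.
have [q hq] : exists q : (d + d).-tuple rat,
    forall i, `|tnth t i - ratr (tnth q i)| < k.+1%:R^-1.
  have hi i : exists q : rat, `|tnth t i - ratr q| < k.+1%:R^-1.
    have /rat_in_itvoo[q] : tnth t i - k.+1%:R^-1 < tnth t i + k.+1%:R^-1.
      by rewrite ltrBlDr -addrA ltrDl addr_gt0.
    rewrite in_itv /= => /andP[h1 h2]; exists q.
    by rewrite distrC ltr_distl h1.
  have [f fP] := choice hi.
  by exists [tuple f i | i < d + d] => i; rewrite tnth_mktuple.
exists (q, k) => // s hs /=.
apply: eU; split => // i j; rewrite -ball_normE /= !mxE er.
have D l : `|tnth t l - tnth s l| < k.+1%:R^-1 * 2.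
  rewrite (le_lt_trans (ler_distD (ratr (tnth q l)) _ _))// mulr_natr mulr2n.
  by rewrite ltrD ?hq// distrC hs.
set x := tnth t _ ; set y := tnth t _.
set x' := tnth s _ ; set y' := tnth s _.
rewrite (_ : _ - _ = (x - x')%:C + 'i * (y - y')%:C); last by simpc.
rewrite (le_lt_trans (ler_normD _ _))// normrM !normc_def /= expr0n expr1n.
rewrite /= add0r !addr0 sqrtr1 mul1r !sqrtr_sqr -rmorphD ltcR.
rewrite (lt_trans _ hk)// [ltRHS](_ : _ = k.+1%:R^-1 * 2 + k.+1%:R^-1 * 2).
  by rewrite ltrD// D.
by rewrite -mulrDr -natrD.
Qed.

(* Lebesgue measure on C^d. *)
Definition volume : set (borelC R d) -> \bar R :=
  pushforward (lebesgue_tuple R (d + d))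
    (tuple_to_C : (d + d).-tuple R -> borelC R d).

HB.instance Definition _ := Measure.copy volume
  (measure_function_pushforward__canonical__measure_function_Measure
     (lebesgue_tuple R (d + d)) measurable_tuple_to_C).

Definition sector (A : set (Cvec R d)) : set (Cvec R d) :=
  [set z | 0 < enorm z < 1 /\ A ((enorm z)^-1%:C *: z)].

(* The normalized Lebesgue measure of the unit sphere, in polar coordinates:
   sigma(A) is the proportion of the unit ball occupied by the z with z / |z|
   in A. It is a Borel measure on C^d carried by the sphere. *)
Definition sigma (A : set (borelC R d)) : \bar R :=
  (((fine (volume unit_ball))^-1)%:E * volume (sector A))%E.

Let N (t : (d + d).-tuple R) : R := enorm (tuple_to_C t).

Let measurable_N : measurable_fun [set: (d + d).-tuple R] N.
Proof.
rewrite (_ : N = fun t => Num.sqrt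
    (\sum_(j < d) (tnth t (lshift d j) ^+ 2 + tnth t (rshift d j) ^+ 2))).
  apply: (measurableT_comp (f := Num.sqrt : R -> R)).
    by apply: continuous_measurable_fun; exact: sqrt_continuous.
  apply: measurable_sum => j; apply: measurable_funD;
    by apply: measurable_funX; exact: measurable_tnth.
apply/funext => t; rewrite /N /enorm /inner raddf_sum; congr Num.sqrt.
by apply: eq_bigr => j _; rewrite !mxE /= mulrN opprK.
Qed.

Let unit_tuple t : (d + d).-tuple R := [tuple (N t)^-1 * tnth t i | i < d + d].

Let measurable_unit :
  measurable_fun [set: (d + d).-tuple R]
    ((tuple_to_C : _ -> borelC R d) \o unit_tuple).
Proof.
apply: measurableT_comp; first exact: measurable_tuple_to_C.
apply/measurable_fun_tnthP => i.
rewrite (_ : _ \o _ = fun t => (N t `^ (-1)) * tnth t i); last first.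
  by apply/funext => t /=; rewrite tnth_mktuple powR_inv1 ?sqrtr_ge0.
apply: measurable_funM; last exact: measurable_tnth.
exact: (measurableT_comp (measurable_powR _)).
Qed.

Let punctured_ball : set ((d + d).-tuple R) := [set t | 0 < N t < 1].

Let measurable_punctured : measurable punctured_ball.
Proof.
rewrite (_ : punctured_ball = N @^-1` `]0, 1[%classic).
  by rewrite -[X in measurable X]setTI; exact: measurable_N.
by apply/seteqP; split=> t; rewrite /punctured_ball /= in_itv.
Qed.

Let mu0 :=
  measure_function_pushforward__canonical__measure_function_Measure
    (mrestr (lebesgue_tuple R (d + d)) measurable_punctured) measurable_unit.

Let sigmaE A : sigma A = (((fine (volume unit_ball))^-1)%:E * mu0 A)%E.
Proof.
rewrite /sigma; congr (_ * _)%E.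
rewrite /volume /mu0 /= /pushforward /mrestr; congr (lebesgue_tuple _ _ _).
have E t : tuple_to_C (unit_tuple t) = (N t)^-1%:C *: tuple_to_C t.
  apply/rowP => j; rewrite !mxE !tnth_mktuple.
  by rewrite /GRing.scale /= /GRing.mul /= !mul0r subr0 addr0.
by apply/seteqP; split=> t; rewrite /sector /= E => -[].
Qed.

Let c_ge0 : 0 <= (fine (volume unit_ball))^-1.
Proof. by rewrite invr_ge0 fine_ge0. Qed.

Let sigma0 : sigma set0 = 0%E.
Proof. by rewrite sigmaE measure0 mule0. Qed.

Let sigma_ge0 A : (0 <= sigma A)%E.
Proof. by rewrite sigmaE mule_ge0. Qed.

Let sigma_additive : semi_sigma_additive sigma.
Proof.
rewrite (_ : sigma = mscale (NngNum c_ge0) mu0).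
  exact: measure_semi_sigma_additive.
by apply/funext => A; rewrite sigmaE.
Qed.

HB.instance Definition _ := isMeasure.Build _ _ _ sigma
  sigma0 sigma_ge0 sigma_additive.

End volume.
Arguments sigma {R d}.

Section hardy.
Variables (R : realType) (d : nat).
Implicit Types (f : Cvec R d -> R[i]) (p : R).

(* Differentiability is over the field R[i], i.e., complex. *)
Definition holomorphic_on_ball f :=
  forall z, unit_ball z -> differentiable f z.

Definition hardy_norm p f : \bar R :=
  (ereal_sup [set \int[@sigma R d]_(zeta in unit_sphere)
                    (Normc.normc (f (r%:C *: (zeta : Cvec R d))) `^ p)%:E
             | r in `]0%R, 1%R[%classic] `^ p^-1)%E.

Definition hardy_space p : set (Cvec R d -> R[i]) :=
  [set f | holomorphic_on_ball f /\ (hardy_norm p f < +oo)%E].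

Definition cauchy_kernel (w z : Cvec R d) : R[i] := (1 - inner z w) ^- d.

Definition normalized_kernel p (w z : Cvec R d) : R[i] :=
  cauchy_kernel w z / (fine (hardy_norm p (cauchy_kernel w)))%:C.

End hardy.

(* Main.v *)
Require Import Defs.
From HB Require Import structures.
From mathcomp Require Import all_boot all_order all_algebra.
From mathcomp Require Import all_classical all_reals all_analysis.
From mathcomp Require Import measurable_realfun complex.
From mathcomp Require Import ring lra zify.
Import Order.TTheory GRing.Theory Num.Theory.
Import numFieldNormedType.Exports.
Local Open Scope classical_set_scope.
Local Open Scope ring_scope.
Set Implicit Arguments.
Unset Strict Implicit.
Unset Printing Implicit Defensive.

(** The implication from the reverse Carleson inequality to the kernel test is
    immediate: the Cauchy kernels are holomorphic near the closed ball, and their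
    Hardy norms are finite and positive.

    From the kernel test to the domination of [sigma] on a nonisotropic ball [Q]
    centred at [z0]: integrate the test for [w = r *: zeta] over [zeta] in [Q]
    against [sigma] and exchange the integrals. This bounds [C * sigma Q] by the
    integral against [mu] of the functions
      [F_r z = \int_Q |K_(r *: zeta) z| ^ p dsigma(zeta)].
    The Hardy norm of the kernel with pole [r *: zeta] does not depend on [zeta],
    since the unitary group preserves [sigma] ([sigma_unitary]) and acts
    transitively on the sphere. As [|1 - <z, w>|] is symmetric, integrating the
    kernel in its pole or in its variable is the same thing up to constants, so
    that [F_r] is bounded on the closed ball by a constant depending on [d] and
    [p] only ([kernel_pole_mean_le]). Off [Q] the kernels stay bounded while their
    norms tend to infinity as [r] tends to [1] ([kernel_norm_lower], from
    the size of nonisotropic balls), so that [F_r] tends to zero there. Dominated convergence leaves [C * sigma Q <= C' * mu Q]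
    ([kernel_test_ball]).

    From the domination of [sigma] to the reverse Carleson inequality: for [f]
    holomorphic in the ball and continuous up to the sphere, the [p]-th power of
    the Hardy norm is at most the integral of [|f| ^ p] over the sphere
    ([sphere_mean_le]). Indeed on every disc through the origin [|f| ^ p]
    satisfies the submean inequality, and the rotations that appear in it are
    absorbed by averaging over the sphere. It remains to pass from balls to
    continuous functions [h] on the sphere ([domination_integral]). As all
    balls of a given radius have the same [sigma]-measure, averaging over them moves [h], up to its oscillation at that scale, from
    [sigma] to [mu] by Tonelli's theorem and the symmetry of the quasi-distance.

    Two tools are developed on the way. The submean inequality comes from
    Goursat's argument for closed differential forms ([green_goursat]), which asks
    for differentiability only. The unitary invariance of the volume comes from
    its invariance under translations, by the uniqueness argument for Haar measure
    ([volume_haar]); the volume of the ball, preserved by the unitary group, fixes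
    the proportionality constant. *)

Local Notation normc := Normc.normc.
Local Notation Re := complex.Re.
Local Notation Im := complex.Im.

(** * The modulus of a complex number *)

Section ComplexModulus.
Variable R : realType.
Implicit Types a b c : R[i].

Lemma normcE c : normc c = Num.sqrt (Re c ^+ 2 + Im c ^+ 2).
Proof. by case: c. Qed.

Lemma normc_ge0 c : 0 <= normc c.
Proof. by rewrite normcE sqrtr_ge0. Qed.

Lemma sqr_normc c : normc c ^+ 2 = Re c ^+ 2 + Im c ^+ 2.
Proof. by rewrite normcE sqr_sqrtr// addr_ge0// sqr_ge0. Qed.

Lemma normc_norm c : `|c| = (normc c)%:C%C.
Proof. by rewrite normc_def normcE. Qed.

Lemma normc_real (x : R) : normc x%:C%C = `|x|.
Proof. by rewrite normcE /= expr0n addr0 sqrtr_sqr. Qed.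

Lemma normc_conj c : normc (c^*)%C = normc c.
Proof. by rewrite !normcE; case: c => x y /=; rewrite sqrrN. Qed.

Lemma normc_Re c : `|Re c| <= normc c.
Proof.
rewrite -(@ler_pXn2r _ 2)// ?nnegrE ?normc_ge0//.
by rewrite sqr_normc real_normK ?num_real// lerDl sqr_ge0.
Qed.

Lemma normc_Im c : `|Im c| <= normc c.
Proof.
rewrite -(@ler_pXn2r _ 2)// ?nnegrE ?normc_ge0//.
by rewrite sqr_normc real_normK ?num_real// lerDr sqr_ge0.
Qed.

Lemma normcB a b : normc (a - b) = normc (b - a).
Proof. by rewrite -opprB normcN. Qed.

Lemma ler_normcB a b : `|normc a - normc b| <= normc (a - b).
Proof.
have H (x y : R[i]) : normc x - normc y <= normc (x - y).
  by rewrite lerBlDr (le_trans _ (le_normcD _ _))// subrK.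
rewrite ler_norml H andbT lerNl opprB normcB; exact: H.
Qed.

Lemma normc_le_ReIm c : normc c <= `|Re c| + `|Im c|.
Proof.
rewrite -(@ler_pXn2r _ 2)// ?nnegrE ?normc_ge0 ?addr_ge0//.
rewrite sqr_normc sqrrD !real_normK ?num_real// lerD2r lerDl.
by rewrite mulrn_wge0// mulr_ge0.
Qed.

Lemma normcX c n : normc (c ^+ n) = normc c ^+ n.
Proof.
elim: n => [|n IH]; first by rewrite !expr0 Normc.normc1.
by rewrite !exprS Normc.normcM IH.
Qed.

Lemma ReM a b : Re (a * b) = Re a * Re b - Im a * Im b.
Proof. by case: a; case: b. Qed.

Lemma ImM a b : Im (a * b) = Re a * Im b + Im a * Re b.
Proof. by case: a; case: b => x y z t /=. Qed.

Lemma mul_conj c : c * (c^*)%C = (normc c ^+ 2)%:C%C.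
Proof.
rewrite sqr_normc; case: c => x y; apply/eqP; rewrite eq_complex /=.
by apply/andP; split; apply/eqP; ring.
Qed.

Lemma exists_phase c : exists2 u : R[i], normc u = 1 & u * c = (normc c)%:C%C.
Proof.
have [->|c0] := eqVneq c 0.
  by exists 1; rewrite ?mulr0 ?Normc.normc1 ?Normc.normc0.
have nc0 : normc c != 0.
  by apply: contra_neq c0; exact: Normc.eq0_normc.
exists ((c^*)%C / (normc c)%:C%C).
  by rewrite Normc.normcM Normc.normcV normc_real ger0_norm ?normc_ge0//
    normc_conj divff.
rewrite mulrAC [_ * c]mulrC mul_conj expr2 rmorphM /= mulfK//.
by rewrite eq_complex /= (negbTE nc0).
Qed.

End ComplexModulus.

(** * The Hermitian space C^d *)

Section HermitianSpace.
Variables (R : realType) (d : nat).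
Implicit Types (z w a b : Cvec R d) (c : R[i]).

Lemma innerDl z w a : inner (z + w) a = inner z a + inner w a.
Proof.
rewrite /inner -big_split; apply: eq_bigr => j _.
by rewrite mxE mulrDl.
Qed.

Lemma innerZl c z a : inner (c *: z) a = c * inner z a.
Proof.
rewrite /inner mulr_sumr; apply: eq_bigr => j _.
by rewrite mxE mulrA.
Qed.

Lemma innerC z w : inner w z = ((inner z w)^*)%C.
Proof.
rewrite /inner rmorph_sum; apply: eq_bigr => j _ /=.
by rewrite rmorphM /= conjcK mulrC.
Qed.

Lemma innerDr z w a : inner a (z + w) = inner a z + inner a w.
Proof. by rewrite innerC innerDl rmorphD /= -!innerC. Qed.

Lemma innerZr c z a : inner a (c *: z) = (c^*)%C * inner a z.
Proof. by rewrite innerC innerZl rmorphM /= -!innerC. Qed.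

Lemma innerNl z a : inner (- z) a = - inner z a.
Proof. by rewrite -scaleN1r innerZl mulN1r. Qed.

Lemma innerNr z a : inner a (- z) = - inner a z.
Proof. by rewrite innerC innerNl rmorphN /= -innerC. Qed.

Lemma innerBl z w a : inner (z - w) a = inner z a - inner w a.
Proof. by rewrite innerDl innerNl. Qed.

Lemma innerBr z w a : inner a (z - w) = inner a z - inner a w.
Proof. by rewrite innerDr innerNr. Qed.

Lemma enorm_ge0 z : 0 <= enorm z. Proof. exact: sqrtr_ge0. Qed.

Lemma innerzzE z : inner z z = (\sum_j normc (z ord0 j) ^+ 2)%:C%C.
Proof.
by rewrite /inner rmorph_sum; apply: eq_bigr => j _; rewrite mul_conj.
Qed.

Lemma sqr_enormE z : enorm z ^+ 2 = \sum_j normc (z ord0 j) ^+ 2.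
Proof.
rewrite /enorm innerzzE /= sqr_sqrtr// sumr_ge0// => j _; exact: sqr_ge0.
Qed.

Lemma innerzz z : inner z z = (enorm z ^+ 2)%:C%C.
Proof. by rewrite innerzzE sqr_enormE. Qed.

Lemma Re_innerC z w : Re (inner w z) = Re (inner z w).
Proof. by rewrite innerC; case: (inner z w). Qed.

Lemma sqr_enormD z w :
  enorm (z + w) ^+ 2 = enorm z ^+ 2 + enorm w ^+ 2 + 2 * Re (inner z w).
Proof.
have E (v : Cvec R d) : enorm v ^+ 2 = Re (inner v v) by rewrite innerzz.
rewrite !E !innerDl !innerDr !raddfD /= (Re_innerC z w); ring.
Qed.

Lemma sqr_enormZ c z : enorm (c *: z) ^+ 2 = normc c ^+ 2 * enorm z ^+ 2.
Proof.
rewrite !sqr_enormE mulr_sumr; apply: eq_bigr => j _.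
by rewrite mxE Normc.normcM exprMn.
Qed.

Lemma enormZ c z : enorm (c *: z) = normc c * enorm z.
Proof.
apply/eqP; rewrite -(@eqrXn2 _ 2)// ?mulr_ge0 ?enorm_ge0 ?normc_ge0//.
by rewrite sqr_enormZ exprMn.
Qed.

Lemma enormN z : enorm (- z) = enorm z.
Proof. by rewrite -scaleN1r enormZ normcN Normc.normc1 mul1r. Qed.

Lemma enormB z w : enorm (z - w) = enorm (w - z).
Proof. by rewrite -enormN opprB. Qed.

Lemma sqr_enormB z w :
  enorm (z - w) ^+ 2 = enorm z ^+ 2 + enorm w ^+ 2 - 2 * Re (inner z w).
Proof. by rewrite sqr_enormD enormN innerNr raddfN /= mulrN. Qed.

Lemma enorm0 : enorm (0 : Cvec R d) = 0.
Proof. by rewrite -(scale0r 0) enormZ Normc.normc0 mul0r. Qed.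

Lemma normc_coord z j : normc (z ord0 j) <= enorm z.
Proof.
rewrite -(@ler_pXn2r _ 2)// ?nnegrE ?normc_ge0 ?enorm_ge0//.
by rewrite sqr_enormE (bigD1 j)//= lerDl sumr_ge0// => i _; exact: sqr_ge0.
Qed.

Lemma enorm_eq0 z : enorm z = 0 -> z = 0.
Proof.
move=> z0; apply/rowP => j; rewrite mxE; apply: Normc.eq0_normc.
by apply/eqP; rewrite eq_le normc_ge0 andbT -z0 normc_coord.
Qed.

Lemma enorm_le_sum z : enorm z <= \sum_j normc (z ord0 j).
Proof.
rewrite -(@ler_pXn2r _ 2)// ?nnegrE ?enorm_ge0 ?sumr_ge0//; last first.
  by move=> j _; exact: normc_ge0.
rewrite sqr_enormE.
suff : \sum_(j <- index_enum 'I_d) normc (z ord0 j) ^+ 2 <=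
    (\sum_(j <- index_enum 'I_d) normc (z ord0 j)) ^+ 2 by [].
elim: (index_enum _) => [|i s IH]; first by rewrite !big_nil expr0n.
rewrite !big_cons sqrrD -addrA lerD2l (le_trans IH)// lerDr mulrn_wge0//.
by rewrite mulr_ge0 ?normc_ge0 ?sumr_ge0// => j _; exact: normc_ge0.
Qed.

Lemma cauchy_schwarz z w : normc (inner z w) <= enorm z * enorm w.
Proof.
have [w0|w0] := eqVneq (enorm w) 0.
  rewrite (enorm_eq0 w0) -(scale0r 0) innerZr conjc0 mul0r Normc.normc0.
  by rewrite mulr_ge0 ?enorm_ge0.
rewrite -(@ler_pXn2r _ 2)// ?nnegrE ?normc_ge0 ?mulr_ge0 ?enorm_ge0//.
set b := inner z w; set A := enorm w ^+ 2.
have A0 : 0 < A by rewrite exprn_gt0// lt_def w0 enorm_ge0.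
(* [A *: z - b *: w] is [A] times the component of [z] orthogonal to [w] *)
have : 0 <= enorm (A%:C%C *: z - b *: w) ^+ 2 by exact: sqr_ge0.
rewrite sqr_enormB !sqr_enormZ normc_real ger0_norm ?(ltW A0)//.
rewrite innerZr innerZl -/b.
have -> : (b^*)%C * (A%:C%C * b) = (A * normc b ^+ 2)%:C%C.
  by rewrite (rmorphM _ A) /= -mul_conj; ring.
rewrite [Re _]/= [(enorm z * _) ^+ 2]exprMn -/A => H.
have : 0 <= A * (enorm z ^+ 2 * A - normc b ^+ 2) by move: H; lra.
by rewrite pmulr_rge0// subr_ge0.
Qed.

Lemma enormD z w : enorm (z + w) <= enorm z + enorm w.
Proof.
rewrite -(@ler_pXn2r _ 2)// ?nnegrE ?addr_ge0 ?enorm_ge0//.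
have : Re (inner z w) <= enorm z * enorm w.
  rewrite (le_trans _ (cauchy_schwarz z w))//.
  exact: le_trans (ler_norm _) (normc_Re _).
rewrite sqr_enormD sqrrD; lra.
Qed.

Lemma ler_enormB z w : enorm z - enorm w <= enorm (z - w).
Proof. by rewrite lerBlDr (le_trans _ (enormD _ _))// subrK. Qed.

(** For unit vectors the left-hand side is [2 * Re (1 - <z, w>)]. *)
Lemma sphere_dist_le z w : unit_sphere z -> unit_sphere w ->
  enorm (z - w) ^+ 2 <= 2 * normc (1 - inner z w).
Proof.
rewrite /unit_sphere /= => z1 w1.
rewrite sqr_enormB z1 w1 expr1n.
have := le_trans (ler_norm _) (normc_Re (1 - inner z w)).
rewrite raddfB /=; lra.
Qed.

Lemma normc_1Binner z w : normc (1 - inner z w) = normc (1 - inner w z).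
Proof. by rewrite [inner w z]innerC -normc_conj rmorphB rmorph1. Qed.

(** Surjectivity is expressed by a right inverse [V], whose values are the
    vectors to translate by in [volume_haar]. *)
Definition unitary (U : Cvec R d -> Cvec R d) :=
  [/\ forall c z w, U (c *: z + w) = c *: U z + U w,
      forall z w, inner (U z) (U w) = inner z w
    & exists V, cancel V U].

Lemma unitary_enorm U z : unitary U -> enorm (U z) = enorm z.
Proof. by move=> [_ h _]; rewrite /enorm h. Qed.

Lemma unitaryD U z w : unitary U -> U (z + w) = U z + U w.
Proof. by move=> [h _ _]; rewrite -[z]scale1r h !scale1r. Qed.

Lemma unitaryZ U c z : unitary U -> U (c *: z) = c *: U z.
Proof.
move=> uU; have U0 : U 0 = 0.
  by apply: enorm_eq0; rewrite (unitary_enorm _ uU) enorm0.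
by case: uU => h _ _; rewrite -[c *: z]addr0 h U0 addr0.
Qed.

Lemma unitary_comp U V : unitary U -> unitary V -> unitary (U \o V).
Proof.
move=> uU uV; split=> [c z w|z w|] /=.
- by rewrite (unitaryD _ _ uV) (unitaryZ _ _ uV) (unitaryD _ _ uU)
    (unitaryZ _ _ uU).
- by case: uU => _ -> _; case: uV.
- case: uU => _ _ [U' hU]; case: uV => _ _ [V' hV].
  by exists (V' \o U') => z /=; rewrite hV hU.
Qed.

Lemma unitary_phase u : normc u = 1 -> unitary (fun z => u *: z).
Proof.
move=> u1; have uu : u * (u^*)%C = 1 by rewrite mul_conj u1 expr1n.
split=> [c z w|z w|]; first by rewrite scalerDr !scalerA mulrC.
  by rewrite innerZl innerZr mulrA uu mul1r.
by exists (fun z => (u^*)%C *: z) => z; rewrite scalerA uu scale1r.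
Qed.

(** The reflection negating [a - b] and fixing its orthogonal complement. It
    exchanges [a] and [b] exactly when [a - b] and [a + b] are orthogonal, which
    for [a] and [b] of equal norms means that their inner product is real. *)
Lemma unitary_reflection a b : enorm a = enorm b -> Im (inner a b) = 0 ->
  exists2 U, unitary U & U a = b.
Proof.
move=> ab imab; pose v := a - b.
have [v0|v0] := eqVneq (enorm v) 0.
  exists id; last by apply/eqP; rewrite -subr_eq0; apply/eqP/enorm_eq0.
  by split=> //; exists id.
pose k : R[i] := (2 / enorm v ^+ 2)%:C%C.
pose U z := z - (k * inner z v) *: v.
have kvv : k * inner v v = 2.
  by rewrite innerzz /k -rmorphM /= divfK ?rmorph_nat// expf_neq0.
have kc x : ((k * x)^*)%C = k * (x^*)%C.
  by rewrite (rmorphM _ k); congr (_ * _); exact: conjc_real.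
have UU z : U (U z) = z.
  rewrite /U (innerBl z) (innerZl _ v) mulrBr mulrCA kvv scalerBl opprB.
  by rewrite mulr_natr mulr2n scalerDl addrK subrK.
exists U.
  split=> [c z w|z w|]; last by exists U.
    rewrite /U innerDl innerZl (scalerBr c) (scalerA c).
    rewrite (_ : k * _ = c * (k * inner z v) + k * inner w v); last by ring.
    by rewrite scalerDl opprD addrACA.
  rewrite /U (innerBl z) !(innerBr w) !(innerZl _ v) !(innerZr _ v) !kc.
  rewrite -(innerC w v).
  move: kvv; set X := inner z v; set Y := inner v w; set Z := inner v v.
  set W := inner z w => kvv.
  transitivity (W - k * Y * X *+ 2 + k * X * Y * (k * Z)); first by ring.
  rewrite kvv; ring.
have rab : inner b a = inner a b.
  by rewrite innerC; move: imab; case: (inner a b) => x y /= ->; rewrite oppr0.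
have kav : k * inner a v = 1.
  have : 2 * inner a v = inner v v.
    rewrite /v !innerBr !innerBl rab.
    rewrite [inner b b]innerzz -ab -innerzz; ring.
  by move=> H; apply: (@mulfI _ 2) => //; rewrite mulrCA H kvv mulr1.
by rewrite /U kav scale1r /v opprB addrC subrK.
Qed.

(** The unitary group acts transitively on spheres: rotate by a phase making
    the inner product real, then reflect. *)
Lemma unitary_transitive a b : enorm a = enorm b ->
  exists2 U, unitary U & U a = b.
Proof.
move=> ab; have [u u1 uab] := exists_phase (inner a b).
have [||U uU Ub] := @unitary_reflection (u *: a) b.
- by rewrite enormZ u1 mul1r.
- by rewrite innerZl uab.
exists (U \o (fun z => u *: z)) => //.
exact: unitary_comp (unitary_phase u1).
Qed.

End HermitianSpace.

(** * Topology and Borel sets of C^d *)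

Section Topology.
Variable R : realType.

(** The norms of R[i] and of its row vectors are complex-valued, and the latter
    is a sup norm; this lemma and the next give neighbourhoods by real radii and
    Euclidean balls. *)
Lemma nbhs_normcP (c : R[i]) (U : set R[i]) : nbhs c U <->
  exists2 e : R, 0 < e & forall b, normc (b - c) < e -> U b.
Proof.
rewrite -nbhs_ballE; split=> [[e /= e0 eU]|[e e0 eU]].
  case: e e0 eU => a b; rewrite ltcE /= => /andP[/eqP -> a0] eU.
  exists a => // w wc; apply: eU; rewrite -ball_normE /= normc_norm normcB.
  by rewrite ltcR.
exists e%:C%C => /=; first by rewrite ltcR.
by move=> w; rewrite -ball_normE /= normc_norm normcB ltcR => /eU.
Qed.

Variable d : nat.
Implicit Types (z w : Cvec R d).

Lemma nbhs_enormP z (U : set (Cvec R d)) : nbhs z U <->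
  exists2 e : R, 0 < e & forall w, enorm (w - z) < e -> U w.
Proof.
rewrite -nbhs_ballE; split=> [[e /= e0 eU]|[e e0 eU]].
  case: e e0 eU => a b; rewrite ltcE /= => /andP[/eqP -> a0] eU.
  exists a => // w wc; apply: eU; split => [|i j]; first by rewrite ltcR.
  rewrite -ball_normE /= normc_norm normcB ltcR (ord1 i).
  apply: le_lt_trans wc; have := normc_coord (w - z) j.
  by rewrite !mxE.
exists (e / d.+1%:R)%:C%C => /=; first by rewrite ltcR divr_gt0.
move=> w [_ H]; apply: eU.
have {}H j : normc ((w - z) ord0 j) <= e / d.+1%:R.
  have := H ord0 j; rewrite -ball_normE /= normc_norm normcB ltcR !mxE.
  exact: ltW.
rewrite (le_lt_trans (enorm_le_sum _))//.
apply: (@le_lt_trans _ _ (\sum_(j < d) e / d.+1%:R)).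
  by apply: ler_sum => j _.
rewrite sumr_const card_ord -[_ *+ d]mulr_natr -mulrA -[ltRHS]mulr1 ltr_pM2l//.
by rewrite mulrC ltr_pdivrMr// mul1r ltr_nat.
Qed.

Lemma open_enorm (U : set (Cvec R d)) :
  (forall z, U z -> exists2 e : R, 0 < e & forall w, enorm (w - z) < e -> U w) ->
  open U.
Proof. by move=> H; rewrite openE => z /H; rewrite /interior nbhs_enormP. Qed.

Lemma within_continuousP (f : Cvec R d -> R[i]) :
  {within closed_unit_ball, continuous f} <->
  forall z, closed_unit_ball z -> forall e : R, 0 < e ->
    exists2 r : R, 0 < r & forall w, closed_unit_ball w -> enorm (w - z) < r ->
      normc (f w - f z) < e.
Proof.
rewrite subspace_continuousP; split=> [cf z zB e e0|cf z zB U].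
  have /(cf z zB) : nbhs (f z) [set b | normc (b - f z) < e].
    by apply/nbhs_normcP; exists e.
  rewrite nbhs_simpl /= /within /= => /nbhs_enormP[r r0 rP].
  by exists r => // w wB wz; exact: rP.
rewrite nbhs_simpl /= => /nbhs_normcP[e e0 eU].
have [r r0 rP] := cf z zB e e0.
rewrite /within /=; apply/nbhs_enormP; exists r => // w wz wB.
by apply: eU; exact: rP.
Qed.

Lemma compact_square :
  compact [set c : R[i] | `|Re c| <= 1 /\ `|Im c| <= 1].
Proof.
have -> : [set c : R[i] | `|Re c| <= 1 /\ `|Im c| <= 1] =
    (fun q : R * R => (q.1 +i* q.2)%C) @` (`[-1, 1] `*` `[-1, 1]).
  apply/seteqP; split=> [[x y] /= [hx hy]|_ [[x y] [/= hx hy] <-] /=].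
    by exists (x, y) => //=; split; rewrite in_itv /= -ler_norml.
  by move: hx hy; rewrite !in_itv /= -!ler_norml.
apply: continuous_compact; last first.
  by apply: compact_setX; exact: segment_compact.
apply: continuous_subspaceT => -[x y] U /= /nbhs_normcP[e e0 eU].
have e2 : 0 < e / 2 by rewrite divr_gt0.
exists (ball x (e / 2), ball y (e / 2)) => /=.
  by split; exact: nbhsx_ballx.
move=> [x' y'] /= [+ +]; rewrite -!ball_normE /= => hx hy; apply: eU.
rewrite (le_lt_trans (normc_le_ReIm _))//= (splitr e).
by rewrite ltrD// distrC.
Qed.

(** A closed subset of a product of compact squares. *)
Lemma compact_closed_unit_ball : compact (@closed_unit_ball R d).
Proof.
apply: (@subclosed_compact _ _
   [set v : Cvec R d | forall j, [set c : R[i] | `|Re c| <= 1 /\ `|Im c| <= 1]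
      (v ord0 j)]).
- rewrite -[X in closed X]setCK; apply: open_closedC; apply: open_enorm => z /=.
  rewrite /closed_unit_ball /= => /negP; rewrite -ltNge => z1.
  exists (enorm z - 1); first by rewrite subr_gt0.
  move=> w wz /=; apply/negP; rewrite -ltNge.
  by have := ler_enormB z w; rewrite enormB; lra.
- exact: (@rV_compact R[i] d (fun=> _) (fun=> compact_square)).
- move=> z zB j /=; split; apply: le_trans zB.
    exact: le_trans (normc_Re _) (normc_coord _ _).
  exact: le_trans (normc_Im _) (normc_coord _ _).
Qed.

Lemma unif_continuous_closed_unit_ball (f : Cvec R d -> R[i]) :
  {within closed_unit_ball, continuous f} -> forall e : R, 0 < e ->
  exists2 r : R, 0 < r & forall z w, closed_unit_ball z -> closed_unit_ball w ->
    enorm (w - z) < r -> normc (f w - f z) < e.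
Proof.
move=> /within_continuousP cf e e0.
have /compact_near_coveringP cB := compact_closed_unit_ball.
pose P (r : R) (z : Cvec R d) := closed_unit_ball z -> forall w,
  closed_unit_ball w -> enorm (w - z) < r -> normc (f w - f z) < e.
have : \forall r \near (0 : R)^'+, closed_unit_ball `<=` P r.
  apply: cB => z zB.
  have e2 : 0 < e / 2 by rewrite divr_gt0.
  have [r r0 rP] := cf z zB _ e2.
  have r2 : 0 < r / 2 by rewrite divr_gt0.
  exists ([set z' | enorm (z' - z) < r / 2], [set s : R | s < r / 2]) => /=.
    split; first by apply/nbhs_enormP; exists (r / 2).
    exact: nbhs_right_lt.
  move=> [z' s] /= [hz' hs] z'B w wB wz'.
  have -> : f w - f z' = (f w - f z) - (f z' - f z) by rewrite opprB addrA subrK.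
  rewrite (le_lt_trans (le_normcD _ _))// normcN (splitr e) ltrD//.
    apply: rP => //; rewrite -(subrK z' w) -addrA.
    by rewrite (le_lt_trans (enormD _ _))// (splitr r) ltrD// (lt_trans wz').
  by apply: rP => //; rewrite (lt_trans hz')// ltr_pdivrMr// ltr_pMr// ltr1n.
move=> [r /= r0 H]; exists (r / 2); first by rewrite divr_gt0.
move=> z w zB wB wz; apply: (H (r / 2)) => //=.
- by rewrite sub0r normrN ger0_norm ?ltr_pdivrMr ?ltr_pMr ?ltr1n ?divr_ge0 ?ltW.
- by rewrite divr_gt0.
Qed.

End Topology.

Section Borel.
Variables (R : realType) (d : nat).

Definition econtinuous (g : Cvec R d -> R) := forall z (e : R), 0 < e ->
  exists2 r : R, 0 < r & forall w, enorm (w - z) < r -> `|g w - g z| < e.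

Lemma econtinuous_measurable (g : Cvec R d -> R) :
  econtinuous g -> measurable_fun [set: borelC R d] g.
Proof.
move=> cg; apply: (measurability _ (RGenOInfty.measurableE R)).
move=> _ [_ [x ->] <-]; rewrite setTI; apply: sub_sigma_algebra.
apply: open_enorm => z /=; rewrite in_itv /= andbT => xz.
have [r r0 rP] := cg z (g z - x) ltac:(by rewrite subr_gt0).
exists r => // w /rP; rewrite in_itv /= andbT ltr_norml => /andP[]; lra.
Qed.

Lemma measurable_Re_coord (j : 'I_d) :
  measurable_fun [set: borelC R d] (fun z : borelC R d => Re ((z : Cvec R d) ord0 j)).
Proof.
apply: econtinuous_measurable => z e e0; exists e => // w wz.
apply: le_lt_trans wz; rewrite -raddfB /=.
apply: le_trans (normc_Re _) _; have := normc_coord (w - z) j.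
by rewrite !mxE.
Qed.

Lemma measurable_Im_coord (j : 'I_d) :
  measurable_fun [set: borelC R d] (fun z : borelC R d => Im ((z : Cvec R d) ord0 j)).
Proof.
apply: econtinuous_measurable => z e e0; exists e => // w wz.
apply: le_lt_trans wz; rewrite -raddfB /=.
apply: le_trans (normc_Im _) _; have := normc_coord (w - z) j.
by rewrite !mxE.
Qed.

(** The Borel sets of C^d are generated by the coordinates, through the
    identification of C^d with R^(2d). *)
Lemma measurable_to_borelC (d' : measure_display) (T : measurableType d')
    (F : T -> Cvec R d) :
  (forall j, measurable_fun [set: T] (fun t => Re (F t ord0 j))) ->
  (forall j, measurable_fun [set: T] (fun t => Im (F t ord0 j))) ->
  measurable_fun [set: T] (F : T -> borelC R d).
Proof.
move=> hRe hIm.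
pose G (t : T) : (d + d).-tuple R :=
  [tuple match fintype.split i with inl j => Re (F t ord0 j) | inr j => Im (F t ord0 j) end
  | i < d + d].
have -> : (F : T -> borelC R d) = (@tuple_to_C R d : _ -> borelC R d) \o G.
  apply/funext => t; apply/rowP => j; rewrite !mxE !tnth_mktuple.
  rewrite (unsplitK (inl j : 'I_d + 'I_d)%type) (unsplitK (inr j : 'I_d + 'I_d)%type).
  by case: (F t ord0 j).
apply: measurableT_comp; first exact: measurable_tuple_to_C.
apply/measurable_fun_tnthP => i /=.
rewrite (_ : _ \o _ = fun t =>
  match fintype.split i with inl j => Re (F t ord0 j) | inr j => Im (F t ord0 j) end).
  by case: (fintype.split i).
by apply/funext => t /=; rewrite tnth_mktuple.
Qed.

(** Measurability with respect to the product of the Borel sigma-algebras,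
    which is what the theorem of Tonelli asks for. *)
Section Inner.
Variables (d' : measure_display) (T : measurableType d').
Variables F G : T -> Cvec R d.
Hypothesis mF : measurable_fun [set: T] (F : T -> borelC R d).
Hypothesis mG : measurable_fun [set: T] (G : T -> borelC R d).

Lemma measurable_inner_ReIm :
  measurable_fun [set: T] (fun t => Re (inner (F t) (G t))) /\
  measurable_fun [set: T] (fun t => Im (inner (F t) (G t))).
Proof.
have mR (H : T -> Cvec R d) j : measurable_fun [set: T] (H : T -> borelC R d) ->
    measurable_fun [set: T] (fun t => Re (H t ord0 j)).
  by move=> mH; exact: (measurableT_comp (measurable_Re_coord j) mH).
have mI (H : T -> Cvec R d) j : measurable_fun [set: T] (H : T -> borelC R d) ->
    measurable_fun [set: T] (fun t => Im (H t ord0 j)).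
  by move=> mH; exact: (measurableT_comp (measurable_Im_coord j) mH).
split.
  rewrite (_ : (fun t => _) = fun t => \sum_(j < d)
     (Re (F t ord0 j) * Re (G t ord0 j) + Im (F t ord0 j) * Im (G t ord0 j))).
    apply: measurable_sum => j; apply: measurable_funD; apply: measurable_funM;
      by [exact: mR|exact: mI].
  apply/funext => t; rewrite /inner raddf_sum; apply: eq_bigr => j _ /=.
  by rewrite ReM; case: (G t ord0 j) => x y /=; rewrite mulrN opprK.
rewrite (_ : (fun t => _) = fun t => \sum_(j < d)
   (Im (F t ord0 j) * Re (G t ord0 j) - Re (F t ord0 j) * Im (G t ord0 j))).
  apply: measurable_sum => j; apply: measurable_funB; apply: measurable_funM;
    by [exact: mR|exact: mI].
apply/funext => t; rewrite /inner raddf_sum; apply: eq_bigr => j _ /=.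
by rewrite ImM; case: (G t ord0 j) => x y /=; rewrite mulrN addrC.
Qed.

Lemma measurable_normc_1Binner (r : R) :
  measurable_fun [set: T] (fun t => normc (1 - r%:C%C * inner (F t) (G t))).
Proof.
have [mR mI] := measurable_inner_ReIm.
rewrite (_ : (fun t => _) = fun t => Num.sqrt
  ((1 - r * Re (inner (F t) (G t))) ^+ 2 + (r * Im (inner (F t) (G t))) ^+ 2)).
  apply: (measurableT_comp (f := Num.sqrt : R -> R)).
    by apply: continuous_measurable_fun; exact: sqrt_continuous.
  apply: measurable_funD; apply: measurable_funX.
    by apply: measurable_funB => //; apply: measurable_funM.
  by apply: measurable_funM.
apply/funext => t; rewrite normcE; case: (inner _ _) => x y /=.
by congr Num.sqrt; ring.
Qed.

End Inner.

Lemma measurable_enorm : measurable_fun [set: borelC R d] (@enorm R d).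
Proof.
apply: econtinuous_measurable => z e e0; exists e => // w; apply: le_lt_trans.
rewrite ler_norml ler_enormB andbT lerNl opprB enormB; exact: ler_enormB.
Qed.

Lemma measurable_unit_sphere : measurable (unit_sphere : set (borelC R d)).
Proof.
rewrite (_ : unit_sphere = (@enorm R d : borelC R d -> R) @^-1` [set 1]).
  by rewrite -[X in measurable X]setTI; exact: measurable_enorm.
by apply/seteqP; split.
Qed.

Lemma measurable_closed_unit_ball : measurable (closed_unit_ball : set (borelC R d)).
Proof.
rewrite (_ : closed_unit_ball = (@enorm R d : borelC R d -> R) @^-1` `]-oo, 1]).
  by rewrite -[X in measurable X]setTI; exact: measurable_enorm.
by apply/seteqP; split => z; rewrite /= in_itv.
Qed.

Lemma measurable_unit_ball : measurable (unit_ball : set (borelC R d)).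
Proof.
rewrite (_ : unit_ball = (@enorm R d : borelC R d -> R) @^-1` `]-oo, 1[).
  by rewrite -[X in measurable X]setTI; exact: measurable_enorm.
by apply/seteqP; split => z; rewrite /= in_itv.
Qed.

Lemma measurable_nonisotropic_ball (zeta : Cvec R d) (delta : R) :
  measurable (nonisotropic_ball zeta delta : set (borelC R d)).
Proof.
rewrite (_ : nonisotropic_ball zeta delta = unit_sphere `&`
   (fun w : borelC R d => normc (1 - 1%:C%C * inner zeta w)) @^-1` `]-oo, delta]).
  apply: measurableI; first exact: measurable_unit_sphere.
  rewrite -[X in measurable X]setTI; apply: measurable_normc_1Binner => //.
by apply/seteqP; split => z; rewrite /nonisotropic_ball /= in_itv /= mul1r.
Qed.

End Borel.

(** * Green's theorem without continuous derivatives *)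

Section SegmentIntegral.
Variable R : realType.
Implicit Types (a b c x y e r M : R) (f g : R -> R).

Definition sint a b f : R := Rintegral (@lebesgue_measure R) `[a, b] f.

(** The points [y] are not confined to the segment: the functions at hand are
    continuous in a neighbourhood of it. *)
Definition cont_on a b f := forall x, a <= x <= b -> forall e, 0 < e ->
  exists2 r, 0 < r & forall y, `|y - x| < r -> `|f y - f x| < e.

Lemma cont_on_integrable a b f : cont_on a b f ->
  (@lebesgue_measure R).-integrable `[a, b] (EFin \o f).
Proof.
move=> cf; apply: continuous_compact_integrable; first exact: segment_compact.
apply: continuous_in_subspaceT => x; rewrite inE /= in_itv /= => xab.
apply/cvgrPdist_lt => e e0; have [r r0 rP] := cf x xab e e0.
apply/nbhs_ballP; exists r => //= y.
by rewrite /ball /= distrC => /rP; rewrite distrC.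
Qed.

Lemma cont_onW a b a' b' f : a <= a' -> b' <= b -> cont_on a b f -> cont_on a' b' f.
Proof.
move=> aa bb cf x /andP[ax xb]; apply: cf.
by rewrite (le_trans aa ax) (le_trans xb bb).
Qed.

Lemma cont_onB a b f g : cont_on a b f -> cont_on a b g ->
  cont_on a b (fun x => f x - g x).
Proof.
move=> cf cg x xab e e0; have e2 : 0 < e / 2 by rewrite divr_gt0.
have [r r0 rP] := cf x xab _ e2; have [s s0 sP] := cg x xab _ e2.
exists (Num.min r s); first by rewrite lt_min r0.
move=> y; rewrite lt_min => /andP[/rP + /sP].
rewrite !ltr_norml => /andP[? ?] /andP[? ?]; apply/andP; split; lra.
Qed.

Lemma sintB a b f g : cont_on a b f -> cont_on a b g ->
  sint a b (fun x => f x - g x) = sint a b f - sint a b g.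
Proof. by move=> cf cg; apply: RintegralB => //; exact: cont_on_integrable. Qed.

Lemma cont_onZ a b k f : cont_on a b f -> cont_on a b (fun x => k * f x).
Proof.
move=> cf x xab e e0; have K0 : 0 < `|k| + 1 by rewrite ltr_wpDl.
have [r r0 rP] := cf x xab (e / (`|k| + 1)) (divr_gt0 e0 K0).
exists r => // y /rP; rewrite ltr_pdivlMr// -mulrBr normrM; apply: le_lt_trans.
by rewrite mulrC ler_wpM2l// lerDl.
Qed.

Lemma sintZ a b k f : cont_on a b f ->
  sint a b (fun x => k * f x) = k * sint a b f.
Proof. by move=> cf; apply: RintegralZl => //; exact: cont_on_integrable. Qed.

Lemma sint_split a b m f : a <= m -> m <= b -> cont_on a b f ->
  sint a b f = sint a m f + sint m b f.
Proof.
move=> am mb cf; have := @Rintegral_itvB _ f (BLeft a) (BRight b) m.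
rewrite !bnd_simp => /(_ _ am mb) H.
apply/eqP; rewrite addrC -subr_eq H; last exact: cont_on_integrable.
rewrite Rintegral_itv_obnd_cbnd//.
apply: integrableS (cont_on_integrable (cont_onW am (lexx b) cf)) => //.
by apply: subset_itvr; rewrite bnd_simp.
Qed.

Lemma sint_cst a b c : a <= b -> sint a b (fun=> c) = c * (b - a).
Proof.
move=> ab; rewrite /sint Rintegral_cst//.
suff <- : fine (lebesgue_measure ([set` `[a, b]] : set R)) = b - a by [].
rewrite lebesgue_measure_itv /= lte_fin.
by case: ltP => //= ba; lra.
Qed.

Lemma le_sint a b f g : cont_on a b f -> cont_on a b g ->
  (forall x, a <= x <= b -> f x <= g x) -> sint a b f <= sint a b g.
Proof.
move=> cf cg fg; apply: le_Rintegral => //; exact: cont_on_integrable.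
Qed.

Lemma cont_on_cst a b c : cont_on a b (fun=> c).
Proof. by move=> x _ e e0; exists 1 => // y _; rewrite subrr normr0. Qed.

Lemma sint_near_cst a b c f M : a <= b -> cont_on a b f ->
  (forall x, a <= x <= b -> `|f x - c| <= M) ->
  `|sint a b f - c * (b - a)| <= M * (b - a).
Proof.
move=> ab cf fM; rewrite ler_norml.
have H1 : sint a b f <= sint a b (fun=> c + M).
  apply: le_sint => //; first exact: cont_on_cst.
  by move=> x /fM; rewrite ler_norml => /andP[]; lra.
have H2 : sint a b (fun=> c - M) <= sint a b f.
  apply: le_sint => //; first exact: cont_on_cst.
  by move=> x /fM; rewrite ler_norml => /andP[]; lra.
move: H1 H2; rewrite !sint_cst// => H1 H2; apply/andP; split; lra.
Qed.

End SegmentIntegral.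

Section Green.
Variable R : realType.
Variables P Q : R -> R -> R.

(** The form [P dx + Q dy] is differentiable at the point and closed there:
    the coefficient [k] is at once the [y]-derivative of [P] and the
    [x]-derivative of [Q]. *)
Definition closed_at x0 y0 := exists p k q : R, forall e, 0 < e ->
  exists2 r, 0 < r & forall x y, `|x - x0| < r -> `|y - y0| < r ->
    `|P x y - (P x0 y0 + p * (x - x0) + k * (y - y0))|
      <= e * (`|x - x0| + `|y - y0|) /\
    `|Q x y - (Q x0 y0 + k * (x - x0) + q * (y - y0))|
      <= e * (`|x - x0| + `|y - y0|).

(** A function with a first-order expansion at a point is continuous there. *)
Lemma affine_bound_cont (e r p t : R) : 0 < e -> 0 < r ->
  exists2 s, 0 < s & forall u : R, `|u| < s -> `|u| < r /\
    forall v : R, `|v - (t + p * u)| <= `|u| -> `|v - t| < e.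
Proof.
move=> e0 r0; have M0 : 0 < `|p| + 1 by rewrite ltr_wpDl.
exists (Num.min r (e / (`|p| + 1))); first by rewrite lt_min r0 divr_gt0.
move=> u; rewrite lt_min => /andP[ur]; rewrite ltr_pdivlMr// => ue.
split=> // v vt; have -> : v - t = (v - (t + p * u)) + p * u by ring.
rewrite (le_lt_trans (ler_normD _ _))// normrM; apply: le_lt_trans ue.
by rewrite mulrDr mulr1 addrC mulrC lerD2l.
Qed.

Lemma closed_at_contx x0 y0 : closed_at x0 y0 -> forall e, 0 < e ->
  exists2 r, 0 < r & forall x, `|x - x0| < r -> `|P x y0 - P x0 y0| < e.
Proof.
move=> [p [k [q /(_ 1 ltr01)[r r0 rP]]]] e e0.
have [s s0 sP] := @affine_bound_cont e r p (P x0 y0) e0 r0.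
exists s => // x /sP[xr]; apply.
have [|] := rP x y0 xr _; first by rewrite subrr normr0.
by rewrite subrr normr0 mulr0 !addr0 mul1r.
Qed.

Lemma closed_at_conty x0 y0 : closed_at x0 y0 -> forall e, 0 < e ->
  exists2 r, 0 < r & forall y, `|y - y0| < r -> `|Q x0 y - Q x0 y0| < e.
Proof.
move=> [p [k [q /(_ 1 ltr01)[r r0 rP]]]] e e0.
have [s s0 sP] := @affine_bound_cont e r q (Q x0 y0) e0 r0.
exists s => // y /sP[yr]; apply.
have [|_] := rP x0 y _ yr; first by rewrite subrr normr0.
by rewrite subrr normr0 mulr0 addr0 add0r mul1r.
Qed.

(** The integral of [P dx + Q dy] along the boundary of a rectangle. *)
Definition circulation a b c d : R :=
  sint a b (fun x => P x c - P x d) + sint c d (fun y => Q b y - Q a y).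

Variables A B C D : R.
Hypothesis AB : A < B.
Hypothesis CD : C < D.
Hypothesis closedPQ : forall x y, A <= x <= B -> C <= y <= D -> closed_at x y.

Let contP y : C <= y <= D -> cont_on A B (fun x => P x y).
Proof. by move=> yCD x xAB; apply: closed_at_contx; exact: closedPQ. Qed.

Let contQ x : A <= x <= B -> cont_on C D (fun y => Q x y).
Proof. by move=> xAB y yCD; apply: closed_at_conty; exact: closedPQ. Qed.

Lemma circulation_splitx a b m c d : A <= a -> b <= B -> C <= c -> d <= D ->
  a <= m -> m <= b -> c <= d ->
  circulation a b c d = circulation a m c d + circulation m b c d.
Proof.
move=> Aa bB Cc dD am mb cd; rewrite /circulation.
have cP y : c <= y <= d -> cont_on a b (fun x => P x y).
  move=> /andP[cy yd]; apply: cont_onW (contP _) => //.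
  by rewrite (le_trans Cc cy) (le_trans yd dD).
have cQ x : a <= x <= b -> cont_on c d (fun y => Q x y).
  move=> /andP[ax xb]; apply: cont_onW (contQ _) => //.
  by rewrite (le_trans Aa ax) (le_trans xb bB).
rewrite (sint_split am mb); last first.
  by apply: cont_onB; apply: cP; rewrite lexx cd.
have ab := le_trans am mb.
have E x1 x2 : a <= x1 <= b -> a <= x2 <= b -> sint c d (fun y => Q x2 y - Q x1 y) =
    sint c d (fun y => Q x2 y) - sint c d (fun y => Q x1 y).
  by move=> h1 h2; apply: sintB; exact: cQ.
by rewrite !E ?lexx ?am ?mb ?ab//; ring.
Qed.

Lemma circulation_splity a b m c d : A <= a -> b <= B -> C <= c -> d <= D ->
  c <= m -> m <= d -> a <= b ->
  circulation a b c d = circulation a b c m + circulation a b m d.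
Proof.
move=> Aa bB Cc dD cm md ab; rewrite /circulation.
have cP y : c <= y <= d -> cont_on a b (fun x => P x y).
  move=> /andP[cy yd]; apply: cont_onW (contP _) => //.
  by rewrite (le_trans Cc cy) (le_trans yd dD).
have cQ x : a <= x <= b -> cont_on c d (fun y => Q x y).
  move=> /andP[ax xb]; apply: cont_onW (contQ _) => //.
  by rewrite (le_trans Aa ax) (le_trans xb bB).
rewrite (sint_split cm md); last first.
  by apply: cont_onB; apply: cQ; rewrite lexx ab.
have cd := le_trans cm md.
have E y1 y2 : c <= y1 <= d -> c <= y2 <= d -> sint a b (fun x => P x y1 - P x y2) =
    sint a b (fun x => P x y1) - sint a b (fun x => P x y2).
  by move=> h1 h2; apply: sintB; exact: cP.
by rewrite !E ?lexx ?cm ?md ?cd//; ring.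
Qed.

(** To first order [P] changes by [- k * h] from the top to the bottom side and
    [Q] by [k * w] from the left to the right side. The two contributions,
    [- k * h * w] and [k * w * h], cancel, and only the error terms remain. *)
Lemma circulation_small x0 y0 e : 0 < e -> A <= x0 <= B -> C <= y0 <= D ->
  exists2 r, 0 < r & forall a c w h, 0 < w -> 0 < h -> w < r -> h < r ->
    A <= a -> a + w <= B -> C <= c -> c + h <= D ->
    a <= x0 <= a + w -> c <= y0 <= c + h ->
    `|circulation a (a + w) c (c + h)| <= e * (w + h) ^+ 2.
Proof.
move=> e0 x0AB y0CD; have e2 : 0 < e / 2 by rewrite divr_gt0.
have [p [k [q /(_ _ e2)[r r0 rP]]]] := closedPQ x0AB y0CD.
exists r => // a c w h w0 h0 wr hr Aa awB Cc chD /andP[ax xa] /andP[cy yc].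
have dx x : a <= x <= a + w -> `|x - x0| <= w.
  by move=> /andP[? ?]; rewrite ler_norml; apply/andP; split; lra.
have dy y : c <= y <= c + h -> `|y - y0| <= h.
  by move=> /andP[? ?]; rewrite ler_norml; apply/andP; split; lra.
have near x y : a <= x <= a + w -> c <= y <= c + h ->
    `|P x y - (P x0 y0 + p * (x - x0) + k * (y - y0))| <= e / 2 * (w + h) /\
    `|Q x y - (Q x0 y0 + k * (x - x0) + q * (y - y0))| <= e / 2 * (w + h).
  move=> hx hy; have [H1 H2] := rP x y (le_lt_trans (dx _ hx) wr)
    (le_lt_trans (dy _ hy) hr).
  split; [apply: le_trans H1 _|apply: le_trans H2 _];
    by rewrite ler_pM2l// lerD ?dx ?dy.
have aw : a <= a + w by lra.
have ch : c <= c + h by lra.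
have I1 : `|sint a (a + w) (fun x => P x c - P x (c + h)) - (- k * h) * w| <=
    e * (w + h) * w.
  have := @sint_near_cst _ a (a + w) (- k * h) (fun x => P x c - P x (c + h))
    (e * (w + h)).
  rewrite addrAC subrr add0r; apply => //.
    apply: (cont_onW Aa awB).
    by apply: cont_onB; apply: contP; apply/andP; split; lra.
  move=> x hx; have [+ _] := near x c hx ltac:(by rewrite lexx ch).
  have [+ _] := near x (c + h) hx ltac:(by rewrite lexx ch).
  rewrite !ler_norml => /andP[? ?] /andP[? ?]; apply/andP; split; lra.
have I2 : `|sint c (c + h) (fun y => Q (a + w) y - Q a y) - (k * w) * h| <=
    e * (w + h) * h.
  have := @sint_near_cst _ c (c + h) (k * w) (fun y => Q (a + w) y - Q a y)
    (e * (w + h)).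
  rewrite addrAC subrr add0r; apply => //.
    apply: (cont_onW Cc chD).
    by apply: cont_onB; apply: contQ; apply/andP; split; lra.
  move=> y hy; have [_ +] := near a y ltac:(by rewrite lexx aw) hy.
  have [_ +] := near (a + w) y ltac:(by rewrite lexx aw) hy.
  rewrite !ler_norml => /andP[? ?] /andP[? ?]; apply/andP; split; lra.
move: I1 I2; rewrite /circulation !ler_norml.
move=> /andP[? ?] /andP[? ?]; apply/andP; split; lra.
Qed.

(** Goursat's bisection: if the circulation is a nonzero multiple of the area
    then the same holds for one of the four quarters; the quarters shrink to a
    point where differentiability makes the circulation too small. *)
Lemma green_goursat : circulation A B C D = 0.
Proof.
apply/eqP; apply: contrapT => /negP J0.
pose W := B - A; pose H := D - C.
have W0 : 0 < W by rewrite subr_gt0.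
have H0 : 0 < H by rewrite subr_gt0.
pose eta := `|circulation A B C D| / (W * H).
have eta0 : 0 < eta by rewrite divr_gt0 ?normr_gt0 ?mulr_gt0.
pose w n := W / 2 ^+ n; pose h n := H / 2 ^+ n.
have w0 n : 0 < w n by rewrite divr_gt0 ?exprn_gt0.
have h0 n : 0 < h n by rewrite divr_gt0 ?exprn_gt0.
have wS n : w n = w n.+1 + w n.+1.
  by rewrite /w exprS; field; rewrite expf_neq0.
have hS n : h n = h n.+1 + h n.+1.
  by rewrite /h exprS; field; rewrite expf_neq0.
pose good n (s : R * R) := [/\ A <= s.1, s.1 + w n <= B, C <= s.2,
  s.2 + h n <= D &
  eta * (w n * h n) <= `|circulation s.1 (s.1 + w n) s.2 (s.2 + h n)|].
have step ns : exists s', good ns.1 ns.2 -> [/\ good ns.1.+1 s',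
    ns.2.1 <= s'.1, s'.1 + w ns.1.+1 <= ns.2.1 + w ns.1,
    ns.2.2 <= s'.2 & s'.2 + h ns.1.+1 <= ns.2.2 + h ns.1].
  case: ns => n [a c] /=.
  have [g|ng] := pselect (good n (a, c)); last by exists (a, c) => /ng.
  case: (g) => /=; rewrite (wS n) (hS n).
  have := w0 n.+1; have := h0 n.+1; rewrite /good /=.
  move: (w n.+1) (h n.+1) => u v v0 u0 Aa aB Cc cD big.
  suff [x' [y' [hx hy bg]]] : exists x' y', [/\ x' = a \/ x' = a + u,
      y' = c \/ y' = c + v &
      eta * (u * v) <= `|circulation x' (x' + u) y' (y' + v)|].
    exists (x', y') => _ /=.
    by case: hx hy bg => -> [] -> bg; split=> //; try split=> //; lra.
  rewrite !addrA in big.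
  rewrite (@circulation_splitx a (a + u + u) (a + u)) in big; try lra.
  rewrite [circulation a (a + u) _ _](@circulation_splity _ _ (c + v)) in big; try lra.
  rewrite [circulation (a + u) _ _ _](@circulation_splity _ _ (c + v)) in big; try lra.
  apply: contrapT => Hn.
  have lt x' y' : x' = a \/ x' = a + u -> y' = c \/ y' = c + v ->
      `|circulation x' (x' + u) y' (y' + v)| < eta * (u * v).
    move=> hx hy; rewrite ltNge; apply/negP => ?; apply: Hn.
    by exists x', y'.
  have := lt a c (or_introl erefl) (or_introl erefl).
  have := lt (a + u) c (or_intror erefl) (or_introl erefl).
  have := lt a (c + v) (or_introl erefl) (or_intror erefl).
  have := lt (a + u) (c + v) (or_intror erefl) (or_intror erefl).
  move: big.
  set J1 := circulation _ _ _ _; set J2 := circulation _ _ _ _.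
  set J3 := circulation _ _ _ _; set J4 := circulation _ _ _ _.
  move=> big l4 l3 l2 l1.
  have := ler_normD (J1 + J2) (J3 + J4); have := ler_normD J1 J2.
  have := ler_normD J3 J4.
  have E : eta * ((u + u) * (v + v)) = 4 * (eta * (u * v)) by ring.
  rewrite E in big; lra.
have [f fP] := choice step.
pose s := fix s n := if n is m.+1 then f (m, s m) else (A, C).
have s_good n : good n (s n).
  elim: n => [|n IH]; last by have [] := fP (n, s n) IH.
  split=> //=; rewrite /w /h expr0 !divr1 /W /H ?[_ + (_ - _)]addrC ?subrK//.
  by rewrite /eta divfK// mulf_neq0// gt_eqF.
have s1 n m : (s n).1 <= (s (n + m)%N).1 /\
    (s (n + m)%N).1 + w (n + m)%N <= (s n).1 + w n.
  elim: m => [|m [IH1 IH2]]; first by rewrite addn0.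
  have [_ ? ? _ _] := fP (_, _) (s_good (n + m)%N).
  by rewrite addnS /=; split; [exact: le_trans IH1 _|exact: le_trans IH2].
have s2 n m : (s n).2 <= (s (n + m)%N).2 /\
    (s (n + m)%N).2 + h (n + m)%N <= (s n).2 + h n.
  elim: m => [|m [IH1 IH2]]; first by rewrite addn0.
  have [_ _ _ ? ?] := fP (_, _) (s_good (n + m)%N).
  by rewrite addnS /=; split; [exact: le_trans IH1 _|exact: le_trans IH2].
(* a nested family of segments of positive length has a common point *)
have nested (t v : nat -> R) : (forall n, 0 < v n) ->
    (forall n m, t n <= t (n + m)%N /\ t (n + m)%N + v (n + m)%N <= t n + v n) ->
    exists x, forall n, t n <= x <= t n + v n.
  move=> v0 tv; have ub n : ubound (range t) (t n + v n).
    move=> _ [m _ <-].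
    have [H1 _] := tv m n; have [_ H2] := tv n m.
    by rewrite addnC in H2; have := v0 (m + n)%N; lra.
  exists (sup (range t)) => n; apply/andP; split.
    apply: ub_le_sup; last by exists n.
    by exists (t 0%N + v 0%N); exact: ub.
  by apply: ge_sup; [exists (t 0%N); exists 0%N|exact: ub].
have [x0 x0P] := nested (fun n => (s n).1) w w0 s1.
have [y0 y0P] := nested (fun n => (s n).2) h h0 s2.
(* chosen so that [e * (w n + h n) ^+ 2] is half of [eta * (w n * h n)] for
   every [n], the rectangles being similar *)
pose e := eta * (W * H) / (2 * (W + H) ^+ 2).
have WH0 : 0 < W + H by exact: addr_gt0.
have WHm : 0 < W * H by exact: mulr_gt0.
have e0 : 0 < e.
  apply: divr_gt0; apply: mulr_gt0 => //; exact: exprn_gt0.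
have [g1 g2 g3 g4 _] := s_good 0%N.
have [||r r0 rP] := @circulation_small x0 y0 e e0.
- have /andP[? ?] := x0P 0%N; apply/andP; split; lra.
- have /andP[? ?] := y0P 0%N; apply/andP; split; lra.
have [n nr] : exists n, (W + H) / 2 ^+ n < r.
  have [n hn] := ltr_add_invr (divr_gt0 r0 WH0).
  exists n.+1; rewrite add0r ltr_pdivlMr// mulrC in hn.
  apply: le_lt_trans hn; rewrite ler_pM2l// lef_pV2 ?posrE ?exprn_gt0//.
  by rewrite -natrX ler_nat ltnW// ltn_expl.
have wn : w n < r.
  apply: le_lt_trans nr; rewrite ler_pM2r ?invr_gt0 ?exprn_gt0//; lra.
have hn : h n < r.
  apply: le_lt_trans nr; rewrite ler_pM2r ?invr_gt0 ?exprn_gt0//; lra.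
have [? ? ? ? lo] := s_good n.
have up := rP _ _ _ _ (w0 n) (h0 n) wn hn ltac:(eassumption) ltac:(eassumption)
  ltac:(eassumption) ltac:(eassumption) (x0P n) (y0P n).
have := le_trans lo up; apply/negP; rewrite -ltNge.
have -> : e * (w n + h n) ^+ 2 = eta * (w n * h n) / 2.
  rewrite /e /w /h; field.
  by rewrite ?expf_neq0//= gt_eqF// addr_gt0.
have : 0 < eta * (w n * h n) by apply: mulr_gt0 => //; exact: mulr_gt0.
lra.
Qed.

End Green.

(** * The submean inequality on the disc *)

Section ComplexExponential.
Variable R : realType.
Implicit Types (a b c : R[i]).

Lemma differentiable_near (K : numFieldType) (V W : normedModType K)
    (f : V -> W) (x : V) : differentiable f x -> forall e : K, 0 < e ->
  \forall h \near (0 : V), `|f (h + x) - (f x + 'd f x h)| <= e * `|h|.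
Proof. by move=> /diff_locally /eqaddoP. Qed.

Lemma is_derive_near0 (f : R -> R) (k e : R) : is_derive (0 : R) 1 f k -> 0 < e ->
  exists2 r, 0 < r & forall x, `|x| < r -> `|f x - (f 0 + k * x)| <= e * `|x|.
Proof.
move=> fk e0; have /derivable1_diffP df : derivable f 0 1 by [].
have /nbhs_ballP[r /= r0 rP] := differentiable_near df e0.
exists r => // x xr.
have := rP x; rewrite -ball_normE /= sub0r normrN addr0 => /(_ xr).
congr (`|_ - (_ + _)| <= _).
by rewrite -{1}[x]mulr1 linearZ /= -deriveE// derive_val mulrC.
Qed.

(** Complex differentiability on the line: the differential is the
    multiplication by a complex number. *)
Lemma complex_differentiable_near (f : R[i] -> R[i]) a : differentiable f a ->
  exists c, forall e : R, 0 < e -> exists2 r : R, 0 < r &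
    forall b, normc (b - a) < r ->
      normc (f b - (f a + c * (b - a))) <= e * normc (b - a).
Proof.
move=> df; exists ('d f a 1) => e e0.
have e0c : 0 < e%:C%C :> R[i] by rewrite ltcR.
have := differentiable_near df e0c => /nbhs_normcP[r r0 rP].
exists r => // b; rewrite -[b - a]subr0 => /rP; rewrite subr0 subrK.
rewrite !normc_norm -rmorphM /= lecR; congr (normc (_ - (_ + _)) <= _).
by rewrite -{1}[b - a]mulr1 linearZ /= mulrC.
Qed.

Definition cexp b : R[i] := (expR (Re b) * cos (Im b) +i* (expR (Re b) * sin (Im b)))%C.

Lemma cexpD a b : cexp (a + b) = cexp a * cexp b.
Proof.
case: a b => x y [x' y']; rewrite /cexp /= expRD cosD sinD.
by apply/eqP; rewrite eq_complex /=; apply/andP; split; apply/eqP; ring.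
Qed.

Lemma normc_cexp b : normc (cexp b) = expR (Re b).
Proof.
rewrite normcE /= !exprMn -mulrDr cos2Dsin2 mulr1 sqrtr_sqr.
by rewrite ger0_norm ?expR_ge0.
Qed.

Lemma cexp_2pi (s : R) : cexp (s +i* (pi *+ 2))%C = cexp (s +i* 0)%C.
Proof. by rewrite /cexp /= cos2pi sin2pi cos0 sin0. Qed.

Lemma cexp_near0 (e : R) : 0 < e -> exists2 r : R, 0 < r &
  forall b, normc b < r -> normc (cexp b - (1 + b)) <= e * normc b.
Proof.
move=> e0; have [d [d0 d1 de]] : exists d : R, [/\ 0 < d, d <= 1 & d <= e / 8].
  exists (Num.min 1 (e / 8)).
  by rewrite lt_min ltr01 divr_gt0// !ge_min !lexx orbT.
have [r1 r10 h1] := @is_derive_near0 expR _ _ (is_derive_expR 0) d0.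
have [r2 r20 h2] := @is_derive_near0 cos _ _ (is_derive_cos 0) d0.
have [r3 r30 h3] := @is_derive_near0 sin _ _ (is_derive_sin 0) d0.
exists (Num.min d (Num.min r1 (Num.min r2 r3))).
  by rewrite !lt_min d0 r10 r20.
move=> [x y]; rewrite !lt_min => /and4P[bd b1 b2 b3].
have xb : `|x| <= normc (x +i* y)%C by exact: (normc_Re (x +i* y)%C).
have yb : `|y| <= normc (x +i* y)%C by exact: (normc_Im (x +i* y)%C).
move: bd b1 b2 b3 xb yb; set N := normc _ => bd b1 b2 b3 xb yb.
have {h1} := h1 x (le_lt_trans xb b1).
have {h2} := h2 y (le_lt_trans yb b2).
have {h3} := h3 y (le_lt_trans yb b3).
rewrite expR0 cos0 sin0 oppr0 mul0r add0r addr0 !mul1r => hs hc he.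
have N0 : 0 <= N by exact: normc_ge0.
rewrite (le_trans (normc_le_ReIm _))//=.
have -> : expR x * cos y - (1 + x) =
  (expR x - (1 + x)) * cos y + (1 + x) * (cos y - 1) by ring.
have -> : expR x * sin y - (0 + y) =
  (expR x - (1 + x)) * sin y + x * sin y + (sin y - y) by ring.
have dN : d * N <= e / 8 * N by rewrite ler_wpM2r.
have he' : `|expR x - (1 + x)| <= e / 8 * N.
  by rewrite (le_trans he)// (le_trans _ dN)// ler_wpM2l// ltW.
have hc' : `|cos y - 1| <= e / 8 * N.
  by rewrite (le_trans hc)// (le_trans _ dN)// ler_wpM2l// ltW.
have hs' : `|sin y - y| <= e / 8 * N.
  by rewrite (le_trans hs)// (le_trans _ dN)// ler_wpM2l// ltW.
have siny : `|sin y| <= 2 * N.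
  rewrite -(subrK y (sin y)) (le_trans (ler_normD _ _))//.
  have : d * `|y| <= 1 * N by apply: ler_pM => //; exact: ltW.
  by move: hs yb; lra.
have A1 : `|(expR x - (1 + x)) * cos y| <= e / 8 * N.
  by rewrite normrM (le_trans _ he')// ler_piMr// cos_max.
have A2 : `|(1 + x) * (cos y - 1)| <= 2 * (e / 8 * N).
  rewrite normrM; apply: ler_pM => //.
  by rewrite (le_trans (ler_normD _ _))// normr1; lra.
have A3 : `|(expR x - (1 + x)) * sin y| <= e / 8 * N.
  by rewrite normrM (le_trans _ he')// ler_piMr// sin_max.
have A4 : `|x * sin y| <= e / 8 * (2 * N).
  by rewrite normrM; apply: ler_pM => //; lra.
have eN : 0 <= e * N by rewrite mulr_ge0// ltW.
have := ler_normD ((expR x - (1 + x)) * cos y) ((1 + x) * (cos y - 1)).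
have := ler_normD ((expR x - (1 + x)) * sin y + x * sin y) (sin y - y).
have := ler_normD ((expR x - (1 + x)) * sin y) (x * sin y).
lra.
Qed.

(** By the addition formula it is enough to expand the exponential at the
    origin. *)
Lemma differentiable_cexp a : differentiable cexp a.
Proof.
apply/derivable1_diffP; apply/cvg_ex; exists (cexp a).
move=> U /nbhs_normcP[e e0 eU] /=.
have E0 : 0 < normc (cexp a) by rewrite normc_cexp expR_gt0.
have [r r0 rP] := @cexp_near0 (e / (2 * normc (cexp a))) ltac:(by rewrite divr_gt0 ?mulr_gt0).
rewrite /nbhs /=; apply/nbhs_normcP; exists r => // h; rewrite subr0 => hr h0 /=.
apply: eU; rewrite /GRing.scale /= mulr1 cexpD.
have nh : normc h != 0 by apply: contra_neq h0; exact: Normc.eq0_normc.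
have -> : h^-1 * (cexp h * cexp a - cexp a) - cexp a =
    h^-1 * (cexp h - (1 + h)) * cexp a by field.
have N0 : 0 < normc h by rewrite lt_def nh normc_ge0.
rewrite !Normc.normcM Normc.normcV -mulrA mulrC ltr_pdivrMr//.
apply: (@le_lt_trans _ _ (e / 2 * normc h)); last first.
  by rewrite ltr_pM2r//; lra.
have -> : e / 2 * normc h = e / (2 * normc (cexp a)) * normc h * normc (cexp a).
  by field; rewrite gt_eqF.
by rewrite ler_pM2r//; exact: rP.
Qed.

End ComplexExponential.

Section Submean.
Variable R : realType.
Implicit Types (a b c : R[i]).

(** The automorphism of the disc sending the origin to [r]; composing with it
    turns the mean value property at the origin into Poisson's formula at [r]. *)
Definition mobius (r : R) b : R[i] := (b + r%:C%C) / (1 + r%:C%C * b).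

Section Mobius.
Variable r : R.
Hypothesis r01 : 0 <= r < 1.

Lemma mobius_den b : normc b <= 1 -> 1 - r <= normc (1 + r%:C%C * b).
Proof.
case/andP: r01 => r0 r1 b1; have := ler_normcB 1 (- (r%:C%C * b)).
rewrite opprK normcN Normc.normcM normc_real (ger0_norm r0) Normc.normc1.
rewrite ler_norml => /andP[_ H]; apply: le_trans H.
by rewrite lerB// ler_piMr.
Qed.

Lemma mobius_den_gt0 b : normc b <= 1 -> 0 < normc (1 + r%:C%C * b).
Proof.
by move=> /mobius_den; apply: lt_le_trans; case/andP: r01; rewrite subr_gt0.
Qed.

Lemma mobius_den_neq0 b : normc b <= 1 -> 1 + r%:C%C * b != 0.
Proof.
move=> /mobius_den_gt0 h; apply/eqP => h0.
by move: h; rewrite h0 Normc.normc0 ltxx.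
Qed.

(** The identity behind the invariance of the disc and of the circle. *)
Lemma sqr_mobius b : normc (1 + r%:C%C * b) ^+ 2 =
  normc (b + r%:C%C) ^+ 2 + (1 - r ^+ 2) * (1 - normc b ^+ 2).
Proof. rewrite !sqr_normc; case: b => x y /=; ring. Qed.

Lemma normc_mobius_le1 b : normc b <= 1 -> normc (mobius r b) <= 1.
Proof.
move=> b1; rewrite Normc.normcM Normc.normcV ler_pdivrMr ?mobius_den_gt0// mul1r.
rewrite -(@ler_pXn2r _ 2)// ?nnegrE ?normc_ge0// sqr_mobius lerDl.
case/andP: r01 => r0 r1.
by rewrite mulr_ge0// subr_ge0 expr_le1 ?normc_ge0// ltW.
Qed.

Lemma normc_mobius_lt1 b : normc b < 1 -> normc (mobius r b) < 1.
Proof.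
move=> b1; rewrite Normc.normcM Normc.normcV ltr_pdivrMr ?mobius_den_gt0// ?ltW// mul1r.
rewrite -(@ltr_pXn2r _ 2)// ?nnegrE ?normc_ge0// sqr_mobius ltrDl.
case/andP: r01 => r0 r1.
by rewrite mulr_gt0// subr_gt0 expr_lt1 ?normc_ge0.
Qed.

Lemma normc_mobius_eq1 b : normc b = 1 -> normc (mobius r b) = 1.
Proof.
move=> b1; have b1' : normc b <= 1 by rewrite b1.
have d0 := mobius_den_gt0 b1'.
have E : normc (b + r%:C%C) = normc (1 + r%:C%C * b).
  apply/eqP; rewrite -(@eqrXn2 _ 2)// ?normc_ge0//.
  by rewrite sqr_mobius b1 expr1n subrr mulr0 addr0.
by rewrite Normc.normcM Normc.normcV E divff// gt_eqF.
Qed.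

Lemma mobius_lipschitz a b : normc a <= 1 -> normc b <= 1 ->
  normc (mobius r a - mobius r b) <= (1 - r) ^- 2 * normc (a - b).
Proof.
move=> a1 b1; have da := mobius_den_neq0 a1; have db := mobius_den_neq0 b1.
have -> : mobius r a - mobius r b = (1 - r ^+ 2)%:C%C * (a - b) /
    ((1 + r%:C%C * a) * (1 + r%:C%C * b)).
  by rewrite /mobius rmorphB rmorph1 rmorphXn /=; field; rewrite da db.
case/andP: r01 => r0 r1.
rewrite !Normc.normcM Normc.normcV mulrC.
apply: ler_pM => //; rewrite ?invr_ge0 ?mulr_ge0 ?normc_ge0//.
  rewrite Normc.normcM lef_pV2 ?posrE ?mulr_gt0 ?mobius_den_gt0 ?exprn_gt0 ?subr_gt0//.
  have r1' : 0 <= 1 - r by rewrite subr_ge0 ltW.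
  by rewrite expr2; apply: ler_pM => //; exact: mobius_den.
rewrite ler_piMl ?normc_ge0// normc_real ger0_norm ?subr_ge0 ?expr_le1 ?(ltW r1)//.
by rewrite lerBlDr lerDl exprn_ge0.
Qed.

Lemma mobius0 : mobius r 0 = r%:C%C.
Proof. by rewrite /mobius mulr0 add0r addr0 divr1. Qed.

Lemma differentiable_mobius b : normc b <= 1 -> differentiable (mobius r) b.
Proof.
move=> b1.
apply: (@differentiableM _ _ (fun b => b + r%:C%C) (fun b => (1 + r%:C%C * b)^-1)).
  apply: (@differentiableD _ _ _ id (fun=> r%:C%C)); first exact: ex_diff.
  exact: differentiable_cst.
apply: (@differentiableV _ _ (fun b => 1 + r%:C%C * b)); last exact: mobius_den_neq0.
apply: (@differentiableD _ _ _ (fun=> 1 : R[i]) (fun b : R[i] => r%:C%C * b)).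
  exact: differentiable_cst.
apply: (@differentiableM _ _ (fun=> r%:C%C) id); first exact: differentiable_cst.
exact: ex_diff.
Qed.

End Mobius.

Definition disc_unif_continuous (F : R[i] -> R[i]) := forall e : R, 0 < e ->
  exists2 d : R, 0 < d & forall a b, normc a <= 1 -> normc b <= 1 ->
    normc (a - b) < d -> normc (F a - F b) < e.

(** In Green's theorem for the rectangle with vertical sides at [s1] and [s2] and
    the height of a period, the horizontal sides cancel. *)
Lemma periodic_closed_sint (P Q : R -> R -> R) :
  (forall s t, s < 0 -> closed_at P Q s t) ->
  (forall s, P s (pi *+ 2) = P s 0) ->
  forall s1 s2, s1 < s2 -> s2 < 0 ->
  [/\ cont_on 0 (pi *+ 2) (Q s1), cont_on 0 (pi *+ 2) (Q s2) &
      sint 0 (pi *+ 2) (Q s1) = sint 0 (pi *+ 2) (Q s2)].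
Proof.
move=> PQ P_per s1 s2 s12 s20; have s10 := lt_trans s12 s20.
have c s : s < 0 -> cont_on 0 (pi *+ 2) (Q s).
  by move=> s0 t _; exact: (closed_at_conty (PQ s t s0)).
split; [exact: c|exact: c|].
have pi2 : 0 < pi *+ 2 :> R by rewrite pmulrn_lgt0// pi_gt0.
have := @green_goursat _ P Q s1 s2 0 (pi *+ 2) s12 pi2.
move=> /(_ (fun s t h _ => PQ s t (le_lt_trans (proj2 (andP h)) s20))).
rewrite /circulation (@sintB _ 0); [|exact: c|exact: c].
rewrite [X in sint s1 _ X](_ : _ = fun=> 0); last first.
  by apply/funext => s; rewrite P_per subrr.
rewrite sint_cst ?ltW// mul0r add0r => /eqP.
by rewrite subr_eq0 => /eqP.
Qed.

Section MeanValue.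
Variables (F : R[i] -> R[i]) (r : R) (u : R[i]).
Hypothesis F_diff : forall b, normc b < 1 -> differentiable F b.
Hypothesis r01 : 0 <= r < 1.

(* circles about the origin are images of the vertical segments [s = ln radius]
   of length [2 * pi] under the exponential *)
Let G (s t : R) : R[i] := u * F (mobius r (cexp (s +i* t)%C)).

(* for a holomorphic [G] the form [Im G ds + Re G dt] is closed, by the
   equations of Cauchy and Riemann *)
Let G_closed s t : s < 0 ->
  closed_at (fun s t => Im (G s t)) (fun s t => Re (G s t)) s t.
Proof.
move=> s0; pose H b := u * F (mobius r (cexp b)).
have nE : normc (cexp (s +i* t)%C) < 1 by rewrite normc_cexp expR_lt1.
have : differentiable H (s +i* t)%C.
  apply: (@differentiableM _ _ (fun=> u)); first exact: differentiable_cst.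
  apply: (@differentiable_comp _ _ _ _ (mobius r \o @cexp R) F).
    apply: differentiable_comp; first exact: differentiable_cexp.
    by apply: differentiable_mobius => //; exact: ltW.
  by apply: F_diff; exact: normc_mobius_lt1.
move=> /complex_differentiable_near[[ka kb] kP].
exists kb, ka, (- kb) => e e0; have [d d0 dP] := kP _ e0.
exists (d / 2); first by rewrite divr_gt0.
move=> x y xs yt.
have ldist : normc ((x +i* y)%C - (s +i* t)%C) <= `|x - s| + `|y - t|.
  exact: (normc_le_ReIm ((x +i* y)%C - (s +i* t)%C)).
have : normc ((x +i* y)%C - (s +i* t)%C) < d.
  by apply: (le_lt_trans ldist); rewrite (splitr d) ltrD.
move=> /dP; rewrite -/(G x y) -/(G s t) => hd.
have {}hd := le_trans hd (ler_wpM2l (ltW e0) ldist).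
have := le_trans (normc_Im _) hd; have := le_trans (normc_Re _) hd.
rewrite /H -/(G x y) -/(G s t); case: (G x y) => p1 q1; case: (G s t) => p2 q2 /=.
move=> h1 h2; split; [apply: le_trans h2|apply: le_trans h1];
  by rewrite le_eqVlt; apply/orP; left; apply/eqP; congr `|_|; ring.
Qed.

(** The mean over a circle does not depend on its radius; the origin and the
    unit circle, at the ends of the range of radii, are left to [normc_submean]. *)
Lemma mean_value s1 s2 : s1 < s2 -> s2 < 0 ->
  [/\ cont_on 0 (pi *+ 2) (fun t => Re (G s1 t)),
      cont_on 0 (pi *+ 2) (fun t => Re (G s2 t)) &
      sint 0 (pi *+ 2) (fun t => Re (G s1 t)) =
      sint 0 (pi *+ 2) (fun t => Re (G s2 t))].
Proof.
apply: (@periodic_closed_sint (fun s t => Im (G s t)) (fun s t => Re (G s t))).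
  by move=> s t s0; exact: G_closed.
by move=> s; rewrite /G cexp_2pi.
Qed.

End MeanValue.

Lemma cexp_imaginary_cont (t e : R) : 0 < e -> exists2 d : R, 0 < d &
  forall t', `|t' - t| < d -> normc (cexp (0 +i* t')%C - cexp (0 +i* t)%C) < e.
Proof.
move=> e0; have := differentiable_continuous (@differentiable_cexp R (0 +i* t)%C).
have : nbhs (cexp (0 +i* t)%C) [set b | normc (b - cexp (0 +i* t)%C) < e].
  by apply/nbhs_normcP; exists e.
move=> h1 /(_ _ h1) /nbhs_normcP[d d0 dP].
exists d; first exact: d0.
move=> t' td; apply: (dP (0 +i* t')%C).
apply: le_lt_trans td; apply: (le_trans (normc_le_ReIm _)).
by rewrite /= subrr normr0 add0r.
Qed.

(** The convex function [x `^ p] lies above its tangent at [y]. *)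
Lemma young_powR (p x y : R) : 1 < p -> 0 <= x -> 0 <= y ->
  p * (x * y `^ (p - 1)) <= x `^ p + (p - 1) * y `^ p.
Proof.
move=> p1 x0 y0; have p0 : 0 < p by exact: lt_trans p1.
have q0 : 0 < p - 1 by rewrite subr_gt0.
have := @conjugate_powR _ x (y `^ (p - 1)) p (p / (p - 1)) x0 (powR_ge0 _ _) p0.
rewrite divr_gt0// => /(_ isT) H.
have {}H := H ltac:(by field; rewrite !gt_eqF).
rewrite -powRrM mulrCA divff ?gt_eqF// mulr1 in H.
have -> : x `^ p + (p - 1) * y `^ p = p * (x `^ p / p + y `^ p / (p / (p - 1))).
  by field; rewrite !gt_eqF.
by rewrite ler_pM2l.
Qed.

Lemma powR_lipschitz (p M x y : R) : 1 < p -> 0 <= x <= M -> 0 <= y <= M ->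
  `|x `^ p - y `^ p| <= p * M `^ (p - 1) * `|x - y|.
Proof.
move=> p1; have q0 : 0 <= p - 1 by rewrite subr_ge0 ltW.
have p0 : 0 <= p by rewrite (le_trans ler01)// ltW.
wlog xy : x y / y <= x.
  move=> H hx hy; have [yx|/ltW yx] := leP y x; first exact: H.
  by rewrite distrC [`|x - y|]distrC; exact: H.
move=> /andP[x0 xM] /andP[y0 yM].
have M0 := le_trans x0 xM.
rewrite !ger0_norm ?subr_ge0//; last exact: ge0_ler_powR.
have H := young_powR p1 y0 x0.
apply: (@le_trans _ _ (p * x `^ (p - 1) * (x - y))).
  have -> : p * x `^ (p - 1) * (x - y) =
    p * (x * x `^ (p - 1)) - p * (y * x `^ (p - 1)) by ring.
  rewrite mulr_powRB1 ?(lt_trans ltr01 p1)//; move: H; lra.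
rewrite ler_wpM2r ?subr_ge0// ler_wpM2l// ge0_ler_powR//.
Qed.

Section SubmeanInequality.
Variables (F : R[i] -> R[i]) (r : R).
Hypothesis F_diff : forall b, normc b < 1 -> differentiable F b.
Hypothesis F_cont : disc_unif_continuous F.
Hypothesis r01 : 0 <= r < 1.

Definition circle_modulus (t : R) := normc (F (mobius r (cexp (0 +i* t)%C))).

Let ncexp (s t : R) : normc (cexp (s +i* t)%C) = expR s.
Proof. by rewrite normc_cexp. Qed.

Lemma circle_modulus_cont (a b : R) : cont_on a b circle_modulus.
Proof.
move=> t _ e e0; have [d d0 dP] := F_cont e0.
have K0 : 0 < (1 - r) ^+ 2 by case/andP: r01 => ? ?; rewrite exprn_gt0 ?subr_gt0.
have [q q0 qP] := @cexp_imaginary_cont t (d * (1 - r) ^+ 2) ltac:(by rewrite mulr_gt0).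
exists q => // t' /qP h; apply: le_lt_trans (ler_normcB _ _) _.
have n1 (x : R) : normc (cexp (0 +i* x)%C) <= 1 by rewrite ncexp expR0.
apply: dP; rewrite ?normc_mobius_le1//.
apply: le_lt_trans (mobius_lipschitz r01 (n1 _) (n1 _)) _.
by rewrite mulrC ltr_pdivrMr.
Qed.

(** A phase [u] makes [u * F r] real and nonnegative. The mean over the circle of
    radius [q] of the real part of [u * F], composed with the Moebius
    transformation, is close to [u * F r]; the mean over the circle of radius
    [1 - q] is nearly at most the mean of the modulus on the unit circle; and
    both means agree. *)
Lemma normc_submean : normc (F r%:C%C) * (pi *+ 2) <= sint 0 (pi *+ 2) circle_modulus.
Proof.
have [u u1 uF] := exists_phase (F r%:C%C).
set A := normc (F r%:C%C) in uF *.
have pi2 : 0 < pi *+ 2 :> R by rewrite pmulrn_lgt0// pi_gt0.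
apply/ler_addgt0Pr => e' e'0.
pose e := e' / (2 * (pi *+ 2)).
have e0 : 0 < e by rewrite divr_gt0// mulr_gt0.
have [d d0 dP] := F_cont e0.
have K0 : 0 < (1 - r) ^+ 2 by case/andP: r01 => ? ?; rewrite exprn_gt0 ?subr_gt0.
have [q [q0 q1 qd]] : exists q : R, [/\ 0 < q, q <= 4^-1 & q <= d * (1 - r) ^+ 2 / 2].
  exists (Num.min (4^-1) (d * (1 - r) ^+ 2 / 2)).
  rewrite lt_min !ge_min !lexx orbT; split=> //.
  by rewrite invr_gt0 ltr0n/= divr_gt0// mulr_gt0.
have q1' : q < 1 - q by move: q1; lra.
have q2 : 0 < 1 - q by lra.
have mob a b : normc a <= 1 -> normc b <= 1 -> normc (a - b) <= q ->
    normc (F (mobius r a) - F (mobius r b)) < e.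
  move=> a1 b1 ab; apply: dP; rewrite ?normc_mobius_le1//.
  apply: le_lt_trans (mobius_lipschitz r01 a1 b1) _.
  rewrite mulrC ltr_pdivrMr//; have : 0 < d * (1 - r) ^+ 2 by rewrite mulr_gt0.
  move: qd ab; lra.
have s12 : ln q < ln (1 - q) by rewrite ltr_ln ?posrE.
have s20 : ln (1 - q) < 0 by rewrite ln_lt0// q2; move: q0; lra.
have lo t : A - e <= Re (u * F (mobius r (cexp (ln q +i* t)%C))).
  have n1 : normc (cexp (ln q +i* t)%C) = q by rewrite ncexp lnK// posrE.
  have : normc (F (mobius r (cexp (ln q +i* t)%C)) - F (mobius r 0)) < e.
    apply: mob; rewrite ?subr0 ?Normc.normc0 ?n1 ?ler01//.
    by move: q1; lra.
  rewrite mobius0 normcB => H.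
  have -> : A = Re (u * F r%:C%C) by rewrite uF.
  rewrite lerBlDr -lerBlDl -raddfB -mulrBr.
  apply: le_trans (ler_norm _) _; apply: le_trans (normc_Re _) _.
  by rewrite Normc.normcM u1 mul1r ltW.
have up t : Re (u * F (mobius r (cexp (ln (1 - q) +i* t)%C))) <=
    circle_modulus t - (- e).
  have n1 : normc (cexp (ln (1 - q) +i* t)%C) = 1 - q by rewrite ncexp lnK// posrE.
  have H : normc (F (mobius r (cexp (ln (1 - q) +i* t)%C)) -
      F (mobius r (cexp (0 +i* t)%C))) < e.
    apply: mob; first by rewrite n1 gerBl ltW.
      by rewrite ncexp expR0.
    rewrite (_ : (ln (1 - q) +i* t)%C = ((ln (1 - q))%:C + (0 +i* t))%C); last first.
      by apply/eqP; rewrite eq_complex /= addr0 add0r !eqxx.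
    rewrite cexpD -[X in _ - X]mul1r -mulrBl Normc.normcM ncexp expR0 mulr1.
    have -> : cexp (ln (1 - q))%:C%C = (1 - q)%:C%C.
      by rewrite /cexp /= lnK ?posrE// cos0 sin0 mulr1 mulr0.
    rewrite [X in normc X](_ : _ = (- q)%:C%C); last first.
      by rewrite rmorphB rmorph1 rmorphN addrAC subrr add0r.
    by rewrite normc_real normrN ger0_norm// ltW.
  apply: le_trans (ler_norm _) _; apply: le_trans (normc_Re _) _.
  rewrite Normc.normcM u1 mul1r opprK /circle_modulus -lerBlDl.
  apply: le_trans (ltW H); exact: le_trans (ler_norm _) (ler_normcB _ _).
have cc : cont_on 0 (pi *+ 2) (fun t => circle_modulus t - (- e)).
  by apply: cont_onB; [exact: circle_modulus_cont|exact: cont_on_cst].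
have : sint 0 (pi *+ 2) (fun=> A - e) <=
    sint 0 (pi *+ 2) (fun t => circle_modulus t - (- e)).
  have [c1 c2 E] := @mean_value F r u F_diff r01 _ _ s12 s20.
  apply: (@le_trans _ _ _ _ _ (le_sint (@cont_on_cst _ _ _ _) c1 (fun t _ => lo t))).
  rewrite E; exact: (le_sint c2 cc (fun t _ => up t)).
rewrite (sintB (@circle_modulus_cont 0 (pi *+ 2)) (@cont_on_cst _ _ _ (- e))).
rewrite !sint_cst ?(ltW pi2)// subr0 mulNr opprK.
have -> : e' = 2 * e * (pi *+ 2) by rewrite /e mulrAC mulrC divfK// gt_eqF// mulr_gt0.
lra.
Qed.

(** Jensen's inequality for the circular mean, from Young's inequality. *)
Lemma powR_submean (p : R) : 1 < p ->
  cont_on 0 (pi *+ 2) (fun t => circle_modulus t `^ p) /\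
  normc (F r%:C%C) `^ p * (pi *+ 2) <=
    sint 0 (pi *+ 2) (fun t => circle_modulus t `^ p).
Proof.
move=> p1; set c := circle_modulus; set B := normc _.
have p0 : 0 < p := lt_trans ltr01 p1.
have pi2 : 0 < pi *+ 2 :> R by rewrite pmulrn_lgt0// pi_gt0.
have c0 t : 0 <= c t by exact: normc_ge0.
have B0 : 0 <= B by exact: normc_ge0.
have cc : cont_on 0 (pi *+ 2) c by exact: circle_modulus_cont.
have ccp : cont_on 0 (pi *+ 2) (fun t => c t `^ p).
  move=> t tpi e e0.
  have K0 : 0 < p * (c t + 1) `^ (p - 1).
    by rewrite mulr_gt0// powR_gt0// ltr_wpDl.
  have [d d0 dP] := cc t tpi (Num.min 1 (e / (p * (c t + 1) `^ (p - 1))))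
    ltac:(by rewrite lt_min ltr01 divr_gt0).
  exists d => // t' /dP; rewrite lt_min => /andP[h1 h2].
  apply: le_lt_trans (@powR_lipschitz p (c t + 1) _ _ p1 _ _) _.
  - by rewrite c0/=; move: h1; rewrite ltr_norml => /andP[]; lra.
  - by rewrite c0 /= lerDl.
  - by rewrite mulrC -ltr_pdivlMr.
split=> //.
have lo : sint 0 (pi *+ 2) (fun t => p * B `^ (p - 1) * c t - (p - 1) * B `^ p) <=
    sint 0 (pi *+ 2) (fun t => c t `^ p).
  apply: le_sint => // [|t _].
    by apply: cont_onB; [exact: cont_onZ|exact: cont_on_cst].
  by rewrite lerBlDr -mulrA [_ * c t]mulrC; exact: young_powR.
apply: le_trans lo; rewrite sintB; [|exact: cont_onZ|exact: cont_on_cst].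
rewrite sintZ// sint_cst ?subr0; last exact: ltW.
have : p * B `^ (p - 1) * (B * (pi *+ 2)) <= p * B `^ (p - 1) * sint 0 (pi *+ 2) c.
  by rewrite ler_wpM2l ?mulr_ge0 ?powR_ge0 ?(ltW p0)//; exact: normc_submean.
have -> : p * B `^ (p - 1) * (B * (pi *+ 2)) = p * (B * B `^ (p - 1)) * (pi *+ 2).
  by ring.
rewrite mulr_powRB1//; lra.
Qed.

End SubmeanInequality.

End Submean.

(** * Lebesgue measure on C^d: translations, boxes and unitary maps *)

Section LebesgueTuple.
Variable R : realType.

Lemma lebesgue_measure_translate (a : R) (A : set (measurableTypeR R)) :
  measurable A -> lebesgue_measure ((fun x : R => x + a) @^-1` A) = lebesgue_measure A.
Proof.
have mT : measurable_fun [set: measurableTypeR R]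
    ((fun x : R => x + a) : measurableTypeR R -> measurableTypeR R).
  by apply: measurable_funD.
move=> mA; apply/esym.
apply: (@lebesgue_measure_unique R
  (measure_function_pushforward__canonical__measure_function_Measure
     (@lebesgue_measure R) mT) _ A mA) => _ [[x y] _ <-].
rewrite /= /pushforward.
have -> : (fun x : R => x + a) @^-1` `]x, y]%classic = `]x - a, y - a]%classic.
  by apply/seteqP; split=> z /=; rewrite !in_itv /= ltrBlDr lerBrDr.
rewrite !lebesgue_measure_itv /= !lte_fin ltrD2r; case: ifP => // _.
by rewrite -!EFinB; congr EFin; ring.
Qed.

Definition tuple_add n (a t : n.-tuple R) : n.-tuple R :=
  [tuple tnth t i + tnth a i | i < n].

Lemma measurable_tuple_add n (a : n.-tuple R) :
  measurable_fun [set: n.-tuple R] (tuple_add a).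
Proof.
apply/measurable_fun_tnthP => i.
rewrite (_ : _ \o _ = fun t : n.-tuple R => tnth t i + tnth a i).
  by apply: measurable_funD => //; exact: measurable_tnth.
by apply/funext => t /=; rewrite tnth_mktuple.
Qed.

Lemma tuple_add_cons n (a : n.+1.-tuple R) (x : R) (t : n.-tuple R) :
  tuple_add a [tuple of x :: t] =
  [tuple of x + thead a :: tuple_add [tuple of behead a] t].
Proof.
apply: eq_from_tnth => i; rewrite tnth_mktuple.
case: (unliftP ord0 i) => [j|] ->; last by rewrite !tnth0.
rewrite !tnthS tnth_mktuple; congr (_ + _).
by rewrite [in LHS](tuple_eta a) tnthS.
Qed.

Lemma lebesgue_tupleS n (A : set (n.+1.-tuple R)) : measurable A ->
  lebesgue_tuple R n.+1 A = (\int[lebesgue_tuple R n]_t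
    lebesgue_measure [set x : R | A [tuple of x :: t]])%E.
Proof.
move=> mA; rewrite /= /mcons /= /pushforward /= /product_measure1.
apply: eq_integral => t _ /=; congr (lebesgue_measure _).
by apply/seteqP; split=> x; rewrite /xsection /= inE.
Qed.

Lemma measurable_cons_section n (A : set (n.+1.-tuple R)) (t : n.-tuple R) :
  measurable A -> measurable ([set x : R | A [tuple of x :: t]] : set (measurableTypeR R)).
Proof.
move=> mA; have := @measurable_fun_cons_swap R n measurableT _ mA.
rewrite setTI => mB; have := measurable_xsection t mB.
by congr measurable; apply/seteqP; split=> x; rewrite /xsection /= inE.
Qed.

(** By induction on the dimension: translate the sections in the first variable,
    then the section measure as a function of the others. *)
Lemma lebesgue_tuple_translate n (a : n.-tuple R) (A : set (n.-tuple R)) :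
  measurable A -> lebesgue_tuple R n (tuple_add a @^-1` A) = lebesgue_tuple R n A.
Proof.
elim: n a A => [|n IH] a A mA.
  by congr (lebesgue_tuple R 0 _); apply/seteqP; split=> t /=;
    rewrite [tuple_add a t]tuple0 [t]tuple0.
have mA' : measurable (tuple_add a @^-1` A).
  by rewrite -[X in measurable X]setTI; exact: measurable_tuple_add.
pose g (t : n.-tuple R) := lebesgue_measure [set x : R | A [tuple of x :: t]].
have mg : measurable_fun [set: n.-tuple R] g.
  have := @measurable_fun_cons_swap R n measurableT _ mA; rewrite setTI => mB.
  have := @measurable_fun_xsection _ _ _ _ _ (@lebesgue_measure R) _ mB.
  congr measurable_fun; apply/funext => t; congr (lebesgue_measure _).
  by apply/seteqP; split=> x; rewrite /xsection /= in_setE.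
rewrite !lebesgue_tupleS// -/g.
transitivity (\int[lebesgue_tuple R n]_t g (tuple_add [tuple of behead a] t))%E.
  apply: eq_integral => t _.
  rewrite /g -[RHS](@lebesgue_measure_translate (thead a)); last exact: measurable_cons_section.
  congr (lebesgue_measure _).
  by apply/seteqP; split=> x; rewrite /preimage /mkset tuple_add_cons.
rewrite -[LHS](@ge0_integral_pushforward _ _ _ _ R _
   (measurable_tuple_add [tuple of behead a]) (lebesgue_tuple R n) setT g)//.
apply: eq_measure_integral => [|mT B mB _]; first exact: measurable_tuple_add.
exact: (IH [tuple of behead a] B mB).
Qed.

Lemma lebesgue_tuple_box n (a b : 'I_n -> R) : (forall i, a i <= b i) ->
  measurable [set t : n.-tuple R | forall i, a i <= tnth t i <= b i] /\
  lebesgue_tuple R n [set t | forall i, a i <= tnth t i <= b i] =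
    (\prod_i (b i - a i))%:E.
Proof.
move=> ab.
have mbox m (a' b' : 'I_m -> R) :
    measurable [set t : m.-tuple R | forall i, a' i <= tnth t i <= b' i].
  rewrite (_ : mkset _ = \bigcap_(i in [set: 'I_m])
      ((fun t : m.-tuple R => tnth t i) @^-1` `[a' i, b' i]%classic)).
    apply: fin_bigcap_measurable => // i _.
    by rewrite -[X in measurable X]setTI; exact: measurable_tnth.
  by apply/seteqP; split=> t /= h i => [_|]; have := h i; rewrite /= ?in_itv /=;
    [|apply].
split; first exact: mbox.
elim: n a b ab => [|n IH] a b ab.
  by rewrite big_ord0 /= diracE mem_set//= => -[].
rewrite big_ord_recl EFinM muleC -(IH _ _ (fun i => ab (lift ord0 i))).
rewrite /= /mcons /= /pushforward /=.
have E : lebesgue_measure (`[a ord0, b ord0]%classic : set R) = (b ord0 - a ord0)%:E.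
  rewrite lebesgue_measure_itv /= lte_fin; case: ltgtP (ab ord0) => // -> _.
  by rewrite subrr.
rewrite -E -product_measure1E//; last exact: mbox.
apply: (congr1 (product_measure1 (lebesgue_tuple R n) (@lebesgue_measure R))).
apply/seteqP; split=> [[t x]|[t x]] /=.
  move=> h; split=> [i|]; last by have := h ord0; rewrite tnth0 in_itv.
  by have := h (lift ord0 i); rewrite tnthS.
move=> [h h0] i; case: (unliftP ord0 i) => [j|] ->; first by rewrite tnthS.
by rewrite tnth0; move: h0; rewrite in_itv.
Qed.

End LebesgueTuple.

Section Volume.
Variables (R : realType) (d : nat).
Implicit Types (A B : set (borelC R d)).
Local Notation vol := (@volume R d).

Definition C_to_tuple (a : Cvec R d) : (d + d).-tuple R :=
  [tuple match fintype.split i with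
         | inl j => Re (a ord0 j) | inr j => Im (a ord0 j) end | i < d + d].

Lemma tuple_to_C_add (a : Cvec R d) t :
  tuple_to_C (tuple_add (C_to_tuple a) t) = tuple_to_C t + a.
Proof.
apply/rowP => j; rewrite !mxE !tnth_mktuple.
rewrite (unsplitK (inl j : 'I_d + 'I_d)%type) (unsplitK (inr j : 'I_d + 'I_d)%type).
by case: (a ord0 j).
Qed.

Lemma volumeE A : vol A = lebesgue_tuple R (d + d) (@tuple_to_C R d @^-1` A).
Proof. by []. Qed.

Lemma measurable_tuple_to_C_preimage A : measurable A ->
  measurable (@tuple_to_C R d @^-1` A).
Proof.
by move=> mA; rewrite -[X in measurable X]setTI; exact: measurable_tuple_to_C.
Qed.

Lemma volume_translate (a : Cvec R d) A : measurable A ->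
  vol ((fun z : Cvec R d => z + a) @^-1` A) = vol A.
Proof.
move=> mA; rewrite !volumeE -[RHS](@lebesgue_tuple_translate R _ (C_to_tuple a)).
  by congr (lebesgue_tuple R _ _); apply/seteqP; split=> t;
    rewrite /preimage /mkset tuple_to_C_add.
exact: measurable_tuple_to_C_preimage.
Qed.

Lemma measurable_enorm_lt (r : R) : measurable ([set z | enorm z < r] : set (borelC R d)).
Proof.
rewrite (_ : mkset _ = (@enorm R d : borelC R d -> R) @^-1` `]-oo, r[).
  by rewrite -[X in measurable X]setTI; exact: measurable_enorm.
by apply/seteqP; split => z; rewrite /= in_itv.
Qed.

Lemma volume_ball_fin (r : R) : 0 <= r -> (vol [set z | (enorm z < r)%R] < +oo)%E.
Proof.
move=> r0; have [|mB volB] := @lebesgue_tuple_box R (d + d) (fun=> - r) (fun=> r).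
  by move=> _; lra.
apply: (@le_lt_trans _ _ (\prod_(i < d + d) (r - - r))%:E); last exact: ltry.
rewrite -volB volumeE; apply: le_measure; rewrite ?inE //.
  exact: measurable_tuple_to_C_preimage (measurable_enorm_lt r).
move=> t /= tr i; rewrite -ler_norml; apply: le_trans (ltW tr).
rewrite -(splitK i); case: (fintype.split i) => j.
  have := le_trans (normc_Re _) (normc_coord (tuple_to_C t) j).
  by rewrite mxE.
have := le_trans (normc_Im _) (normc_coord (tuple_to_C t) j).
by rewrite mxE.
Qed.

Lemma volume_sigma_finite : sigma_finite setT vol.
Proof.
exists (fun n : nat => [set z | enorm z < n%:R]).
  apply/esym/seteqP; split=> // z _; exists (Num.truncn (enorm z)).+1 => //=.
  by have /andP[] := truncn_itv (enorm_ge0 z).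
by move=> n; split; [exact: measurable_enorm_lt|exact: volume_ball_fin].
Qed.

HB.instance Definition _ :=
  Measure_isSigmaFinite.Build _ _ _ vol volume_sigma_finite.

(** Tonelli's theorem for the indicator of a set. *)
Lemma volume_swap (P : set (borelC R d * borelC R d)) : measurable P ->
  (\int[vol]_x vol [set y | P (x, y)] = \int[vol]_y vol [set x | P (x, y)])%E.
Proof.
move=> mP.
have := @fubini_tonelli _ _ _ _ R vol vol (fun z => (\1_P z)%:E) _ _.
have mf : measurable_fun setT (fun z : borelC R d * borelC R d => (\1_P z)%:E : \bar R).
  by apply/measurable_EFinP; exact: measurable_indic.
move=> /(_ mf) H; rewrite (_ : (fun x => _) = (fun x => \int[vol]_y (\1_P (x, y))%:E)%E).
  rewrite H; last by move=> z; rewrite lee_fin.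
  apply: eq_integral => y _; have mY := measurable_ysection y mP.
  rewrite [LHS](_ : _ = \int[vol]_x (\1_(ysection P y) x)%:E)%E.
    rewrite integral_indic// setIT; congr (vol _).
    by apply/seteqP; split=> x; rewrite /ysection /= inE.
  by apply: eq_integral => x _; rewrite /indic !mem_ysection.
apply/funext => x; have mX := measurable_xsection x mP.
rewrite [RHS](_ : _ = \int[vol]_y (\1_(xsection P x) y)%:E)%E.
  rewrite integral_indic// setIT; congr (vol _).
  by apply/seteqP; split=> y; rewrite /xsection /= inE.
by apply: eq_integral => y _; rewrite /indic mem_xsection.
Qed.

Lemma unitary_measurable U : unitary U ->
  measurable_fun [set: borelC R d] (U : borelC R d -> borelC R d).
Proof.
move=> uU; apply: (@measurability _ _ _ (borelC R d) _ _ (@open (Cvec R d))) => //.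
move=> _ [W oW <-]; rewrite setTI; apply: sub_sigma_algebra.
apply: open_enorm => z Wz.
have /nbhs_enormP[e e0 eW] : nbhs (U z) W by apply: open_nbhs_nbhs; split.
exists e => // w wz; apply: eW.
by rewrite -scaleN1r -(unitaryZ _ _ uU) -(unitaryD _ _ uU) scaleN1r (unitary_enorm _ uU).
Qed.

Lemma measurable_unitary_preimage U A : unitary U -> measurable A ->
  measurable (U @^-1` A : set (borelC R d)).
Proof.
by move=> uU mA; rewrite -[X in measurable X]setTI; exact: (unitary_measurable uU).
Qed.

Lemma measurable_fun_addC (d' : measure_display) (T : measurableType d')
    (F G : T -> Cvec R d) (k : R) :
  measurable_fun [set: T] (F : T -> borelC R d) ->
  measurable_fun [set: T] (G : T -> borelC R d) ->
  measurable_fun [set: T] ((fun t => F t + k%:C%C *: G t) : T -> borelC R d).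
Proof.
move=> mF mG; apply: measurable_to_borelC => j.
  rewrite (_ : (fun t => _) = fun t => Re (F t ord0 j) + k * Re (G t ord0 j)).
    apply: measurable_funD; first exact: (measurableT_comp (measurable_Re_coord j) mF).
    by apply: measurable_funM => //; exact: (measurableT_comp (measurable_Re_coord j) mG).
  by apply/funext => t; rewrite !mxE raddfD /= ReM /= mul0r subr0.
rewrite (_ : (fun t => _) = fun t => Im (F t ord0 j) + k * Im (G t ord0 j)).
  apply: measurable_funD; first exact: (measurableT_comp (measurable_Im_coord j) mF).
  by apply: measurable_funM => //; exact: (measurableT_comp (measurable_Im_coord j) mG).
by apply/funext => t; rewrite !mxE raddfD /= ImM /= mul0r addr0.
Qed.

Lemma measurable_set_comp (d' : measure_display) (T : measurableType d')
    (F : T -> Cvec R d) A :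
  measurable_fun [set: T] (F : T -> borelC R d) -> measurable A ->
  measurable [set t | A (F t)].
Proof. by move=> mF mA; rewrite -[X in measurable X]setTI; exact: mF. Qed.

Lemma integral_volume_rectangle A B : measurable A ->
  (\int[vol]_x vol [set y | A x /\ B y] = vol A * vol B)%E.
Proof.
move=> mA.
transitivity (\int[vol]_x ((\1_A x)%:E * vol B))%E.
  apply: eq_integral => x _; rewrite indicE; case: (boolP (x \in A)) => xA.
    rewrite mul1e; congr (vol _); apply/seteqP; split=> y /= => [[]//|By].
    by split=> //; rewrite inE in xA.
  rewrite mul0e [X in vol X](_ : _ = set0) ?measure0//.
  apply/seteqP; split=> y //= [Ax _].
  by move: xA; rewrite notin_setE.
rewrite ge0_integralZr//; last exact/measurable_EFinP/measurable_indic.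
by rewrite integral_indic// setIT.
Qed.

(** The uniqueness argument for Haar measure: three changes of variables, each
    a translation in one variable, namely by [U x] in [y], by [- V y] in [x] and
    by [U x] in [y] again. *)
Lemma volume_haar U A B : unitary U -> measurable A -> measurable B ->
  (vol (U @^-1` A) * vol B = vol (U @^-1` B) * vol (-%R @^-1` A))%E.
Proof.
move=> uU mA mB; have [_ _ [V UV]] := uU.
have UB z w : U (z - w) = U z - U w.
  by rewrite (unitaryD _ _ uU) -scaleN1r (unitaryZ _ _ uU) scaleN1r.
have mUx : measurable_fun [set: borelC R d * borelC R d]
    ((fun p => U p.1) : _ -> borelC R d).
  exact: (measurableT_comp (unitary_measurable uU) measurable_fst).
have my : measurable_fun [set: borelC R d * borelC R d]
    ((fun p => p.2) : _ -> borelC R d) by exact: measurable_snd.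
have mP1 : measurable [set p : borelC R d * borelC R d |
    A (U p.1) /\ B ((p.2 : Cvec R d) + U p.1)].
  apply: measurableI; apply: measurable_set_comp => //.
  rewrite (_ : (fun t => _) =
    fun p : borelC R d * borelC R d => (p.2 : Cvec R d) + 1%:C%C *: U p.1).
    exact: measurable_fun_addC.
  by apply/funext => p; rewrite scale1r.
have mP2 : measurable [set p : borelC R d * borelC R d |
    A (U p.1 - (p.2 : Cvec R d)) /\ B (U p.1)].
  apply: measurableI; apply: measurable_set_comp => //.
  rewrite (_ : (fun t => _) =
    fun p : borelC R d * borelC R d => U p.1 + (-1)%:C%C *: (p.2 : Cvec R d)).
    exact: measurable_fun_addC.
  by apply/funext => p; rewrite rmorphN1 scaleN1r.
have mUA := measurable_unitary_preimage uU mA.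
have mUB := measurable_unitary_preimage uU mB.
have mN : measurable (-%R @^-1` A : set (borelC R d)).
  apply: measurable_set_comp => //.
  rewrite (_ : -%R = fun z : Cvec R d => 0 + (-1)%:C%C *: z).
    by apply: (@measurable_fun_addC _ (borelC R d) (fun=> 0) id).
  by apply/funext => z; rewrite rmorphN1 scaleN1r add0r.
rewrite -(integral_volume_rectangle B mUA).
transitivity (\int[vol]_x vol [set y | A (U x) /\ B ((y : Cvec R d) + U x)%R])%E.
  apply: eq_integral => x _.
  rewrite -[LHS](volume_translate (U x))//.
  apply: measurableI => //.
  by case: (pselect (A (U x))) => h;
    [rewrite (_ : (fun=> _) = setT)//; apply/seteqP; split
    |rewrite (_ : (fun=> _) = set0)//; apply/seteqP; split].
rewrite (volume_swap mP1).
transitivity (\int[vol]_y vol [set x | A (U x - (y : Cvec R d))%R /\ B (U x)])%E.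
  apply: eq_integral => y _.
  have mS : measurable ([set x | A (U x) /\ B ((y : Cvec R d) + U x)] : set (borelC R d)).
    by have := measurable_ysection y mP1;
      congr measurable; apply/seteqP; split=> x; rewrite /ysection /= inE.
  rewrite -[LHS](volume_translate (- V y) mS); congr (vol _).
  by apply/seteqP; split=> x /=; rewrite UB UV [_ + (_ - _)]addrC subrK.
rewrite -(volume_swap mP2) -(integral_volume_rectangle _ mUB).
apply: eq_integral => x _.
have mS : measurable ([set y | B (U x) /\ A (- (y : Cvec R d))] : set (borelC R d)).
  apply: measurableI => //.
  by case: (pselect (B (U x))) => h;
    [rewrite (_ : (fun=> _) = setT)//; apply/seteqP; split
    |rewrite (_ : (fun=> _) = set0)//; apply/seteqP; split].
rewrite -[RHS](volume_translate (- U x) mS); congr (vol _).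
by apply/seteqP; split=> y /=; rewrite opprB => -[].
Qed.

End Volume.

(** * The surface measure *)

Section Sector.
Variables (R : realType) (d : nat).
Implicit Types (A B : set (borelC R d)).
Local Notation vol := (@volume R d).

Lemma measurable_scale_fun (d' : measure_display) (T : measurableType d')
    (k : T -> R) (F : T -> Cvec R d) :
  measurable_fun [set: T] k -> measurable_fun [set: T] (F : T -> borelC R d) ->
  measurable_fun [set: T] ((fun t => (k t)%:C%C *: F t) : T -> borelC R d).
Proof.
move=> mk mF; apply: measurable_to_borelC => j.
  rewrite (_ : (fun t => _) = fun t => k t * Re (F t ord0 j)).
    by apply: measurable_funM => //; exact: (measurableT_comp (measurable_Re_coord j) mF).
  by apply/funext => t; rewrite !mxE ReM /= mul0r subr0.
rewrite (_ : (fun t => _) = fun t => k t * Im (F t ord0 j)).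
  by apply: measurable_funM => //; exact: (measurableT_comp (measurable_Im_coord j) mF).
by apply/funext => t; rewrite !mxE ImM /= mul0r addr0.
Qed.

Lemma measurable_sector A : measurable A -> measurable (sector A : set (borelC R d)).
Proof.
move=> mA; apply: measurableI.
  rewrite (_ : (fun z => _) = (@enorm R d : borelC R d -> R) @^-1` `]0, 1[).
    by rewrite -[X in measurable X]setTI; exact: measurable_enorm.
  by apply/seteqP; split => z; rewrite /= in_itv.
apply: (@measurable_set_comp _ _ _ (borelC R d) (fun z => (enorm z)^-1%:C%C *: z)) => //.
apply: measurable_scale_fun => //.
rewrite (_ : (fun z => _) = fun z : borelC R d => enorm z `^ (-1)).
  apply: (measurableT_comp (measurable_powR _)); exact: measurable_enorm.
by apply/funext => z; rewrite powR_inv1// enorm_ge0.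
Qed.

Lemma sector_sub_ball A : sector A `<=` @unit_ball R d.
Proof. by move=> z [/andP[_ z1] _]. Qed.

End Sector.

Section SectorBox.
Variables (R : realType) (n : nat).
Let d := n.+1.
Let e1 : Cvec R d := delta_mx ord0 ord0.

Lemma inner_e1 (w : Cvec R d) : inner e1 w = ((w ord0 ord0)^*)%C.
Proof.
rewrite /inner (bigD1 ord0)//= big1 ?addr0 => [|j j0].
  by rewrite mxE !eqxx mul1r.
by rewrite mxE (negbTE j0) andbF mul0r.
Qed.

Lemma enorm_e1 : enorm e1 = 1.
Proof.
apply/eqP; rewrite -(@eqrXn2 _ 2)// ?enorm_ge0// expr1n; apply/eqP.
by have := innerzz e1; rewrite inner_e1 mxE !eqxx conjc1 => /complexI <-.
Qed.

(* makes the squared distance from the box to the real line of [e1] at most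
   [k * s ^+ 2 / 8], and hence the norm of a point close to its first coordinate *)
Let k : R := (8 * (2 * d%:R + 1))^-1.

Let k_gt0 : 0 < k.
Proof. by rewrite invr_gt0 mulr_gt0// ltr_wpDl// mulr_ge0. Qed.

Let k_le : k <= 24^-1.
Proof.
have d1 : 1 <= d%:R :> R by rewrite ler1n.
rewrite lef_pV2 ?posrE//; lra.
Qed.

Let lo (delta s : R) (i : 'I_(d + d)) : R := match fintype.split i with
  | inl j => if j == ord0 then 4^-1 else - (k * s)
  | inr j => if j == ord0 then - (k * delta) else - (k * s) end.

Let hi (delta s : R) (i : 'I_(d + d)) : R := match fintype.split i with
  | inl j => if j == ord0 then 2^-1 else k * s
  | inr j => if j == ord0 then k * delta else k * s end.

(** The radial projection of this box stays in the nonisotropic ball: it has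
    size [delta] in the imaginary direction of [e1] and the square root of
    [delta] in the complex tangential directions. *)
Lemma box_sub_sector (s : R) (t : (d + d).-tuple R) : 0 < s <= 1 ->
  (forall i, lo (s ^+ 2) s i <= tnth t i <= hi (s ^+ 2) s i) ->
  sector (nonisotropic_ball e1 (s ^+ 2)) (tuple_to_C t).
Proof.
move=> /andP[s0 s1] ht.
set z := tuple_to_C t; set N := enorm z.
have sq_le (a b : R) : - b <= a <= b -> a ^+ 2 <= b ^+ 2.
  by move=> /andP[? ?]; rewrite -subr_ge0 subr_sqr mulr_ge0//; lra.
pose x := Re (z ord0 ord0); pose y := Im (z ord0 ord0).
have hL j : lo (s ^+ 2) s (lshift d j) <= Re (z ord0 j) <= hi (s ^+ 2) s (lshift d j).
  by rewrite /z mxE; exact: ht.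
have hR j : lo (s ^+ 2) s (rshift d j) <= Im (z ord0 j) <= hi (s ^+ 2) s (rshift d j).
  by rewrite /z mxE; exact: ht.
have sL (j : 'I_d) : fintype.split (lshift d j) = inl j by exact: (unsplitK (inl j)).
have sR (j : 'I_d) : fintype.split (rshift d j) = inr j by exact: (unsplitK (inr j)).
have hx : 4^-1 <= x <= 2^-1 by have := hL ord0; rewrite /lo /hi sL eqxx.
have hy : - (k * s ^+ 2) <= y <= k * s ^+ 2.
  by have := hR ord0; rewrite /lo /hi sR eqxx.
have hz j : j != ord0 -> normc (z ord0 j) ^+ 2 <= 2 * (k * s) ^+ 2.
  move=> j0; have := hL j; have := hR j.
  rewrite /lo /hi sL sR (negbTE j0) sqr_normc => h1 h2.
  have ks : 0 <= k * s by rewrite mulr_ge0 ?ltW.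
  have : Re (z ord0 j) ^+ 2 <= (k * s) ^+ 2.
    exact: sq_le.
  have : Im (z ord0 j) ^+ 2 <= (k * s) ^+ 2.
    exact: sq_le.
  lra.
have [T T0 [NT hT]] : exists2 T, 0 <= T & N ^+ 2 = x ^+ 2 + T /\ T <= k * s ^+ 2 / 8.
  exists (y ^+ 2 + \sum_(j < d | j != ord0) normc (z ord0 j) ^+ 2).
    by rewrite addr_ge0 ?sqr_ge0// sumr_ge0// => j _; exact: sqr_ge0.
  split; first by rewrite /N sqr_enormE (bigD1 ord0)//= sqr_normc addrA.
  have S : \sum_(j < d | j != ord0) normc (z ord0 j) ^+ 2 <= d%:R * (2 * (k * s) ^+ 2).
    apply: (@le_trans _ _ (\sum_(j < d) 2 * (k * s) ^+ 2)).
      rewrite [leRHS](bigID (fun j => j != ord0)) /= -[leLHS]addr0 lerD//.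
        by apply: ler_sum => j /hz.
      by apply: sumr_ge0 => j _; rewrite mulr_ge0// sqr_ge0.
    by rewrite sumr_const card_ord [leRHS]mulrC mulr_natr.
  have Y : y ^+ 2 <= (k * s) ^+ 2.
    apply: sq_le.
    have : k * s ^+ 2 <= k * s by rewrite ler_pM2l// expr2 ger_pMr.
    by move: hy => /andP[? ?] ?; apply/andP; split; lra.
  apply: le_trans (lerD Y S) _.
  rewrite -{1}[(k * s) ^+ 2]mul1r mulrA -mulrDl exprMn expr2.
  have -> : (1 + d%:R * 2) * (k * k * s ^+ 2) = ((2 * d%:R + 1) * k) * (k * s ^+ 2) by ring.
  have -> : (2 * d%:R + 1) * k = 8^-1.
    have := k_gt0; rewrite /k invr_gt0 => H.
    by field; move: H; rewrite pmulr_rgt0// => /lt0r_neq0.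
  by rewrite mulrC.
have s21 : s ^+ 2 <= 1 by rewrite expr_le1// ltW.
have s20 : 0 < s ^+ 2 by rewrite exprn_gt0.
have N0 : 0 <= N by exact: enorm_ge0.
have ks : k * s ^+ 2 <= 24^-1.
  by rewrite (le_trans _ k_le)// ler_piMr// ltW.
have xN : x <= N.
  by rewrite -(@ler_pXn2r _ 2)// ?nnegrE ?NT ?lerDl//; case/andP: hx; lra.
have [hx1 hx2] := andP hx.
have Ngt : 0 < N by lra.
have N1 : N < 1.
  rewrite -(@ltr_pXn2r _ 2)// ?nnegrE// expr1n NT.
  have : x ^+ 2 <= 2^-1 * 2^-1 by rewrite expr2; apply: ler_pM; lra.
  lra.
split; first by rewrite Ngt.
split.
  by rewrite /unit_sphere /= enormZ normc_real ger0_norm ?invr_ge0// mulVf// gt_eqF.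
rewrite inner_e1 mxE.
rewrite (_ : 1 - _ = ((1 - N^-1%:C%C * z ord0 ord0)^*)%C); last first.
  by rewrite rmorphB rmorph1.
rewrite normc_conj.
have -> : 1 - N^-1%:C%C * z ord0 ord0 = N^-1%:C%C * (N%:C%C - z ord0 ord0).
  by rewrite mulrBr -rmorphM /= mulVf ?rmorph1// gt_eqF.
rewrite Normc.normcM normc_real ger0_norm ?invr_ge0// ler_pdivrMl//.
apply: le_trans (normc_le_ReIm _) _; rewrite !raddfB /= -/x -/y sub0r normrN.
have h1 : `|N - x| <= k * s ^+ 2 / 4.
  rewrite ger0_norm ?subr_ge0//.
  have E : (N - x) * (N + x) = T by rewrite -subr_sqr NT addrAC subrr add0r.
  have : (N - x) * (2^-1) <= T by rewrite -E; apply: ler_wpM2l; lra.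
  lra.
have h2 : `|y| <= k * s ^+ 2 by rewrite ler_norml.
have h3 : 4^-1 * s ^+ 2 <= N * s ^+ 2 by apply: ler_wpM2r; [exact: ltW|lra].
have h4 : k * s ^+ 2 <= 24^-1 * s ^+ 2 by apply: ler_wpM2r; [exact: ltW|].
lra.
Qed.

(** The box of [box_sub_sector] has two sides of orders [1] and [delta], and
    [2 * n] sides of the order of the square root of [delta]. *)
Lemma volume_sector_lower : exists2 c : R, 0 < c & forall delta, 0 < delta <= 1 ->
  ((c * delta ^+ d)%:E <= volume (sector (nonisotropic_ball e1 delta)))%E.
Proof.
exists (4^-1 * (2 * k) ^+ (d + n)).
  by rewrite mulr_gt0// exprn_gt0// mulr_gt0.
move=> delta /andP[d0 d1]; pose s := Num.sqrt delta.
have s0 : 0 < s by rewrite sqrtr_gt0.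
have s2 : s ^+ 2 = delta by rewrite sqr_sqrtr// ltW.
have s1 : s <= 1 by rewrite /s -sqrtr1 ler_sqrt.
have lohi i : lo delta s i <= hi delta s i.
  have ks : 0 < k * s by rewrite mulr_gt0.
  have kd : 0 < k * delta by rewrite mulr_gt0.
  by rewrite /lo /hi; case: (fintype.split i) => j; case: ifP => _; lra.
have [mB volB] := lebesgue_tuple_box lohi.
have <- : \prod_i (hi delta s i - lo delta s i) = 4^-1 * (2 * k) ^+ (d + n) * delta ^+ d.
  rewrite big_split_ord /= !big_ord_recl /= /hi /lo.
  rewrite (unsplitK (inl ord0 : 'I_d + 'I_d)%type) (unsplitK (inr ord0 : 'I_d + 'I_d)%type).
  rewrite !eqxx (eq_bigr (fun=> 2 * (k * s))) => [|i _]; last first.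
    rewrite (unsplitK (inl (lift ord0 i) : 'I_d + 'I_d)%type) /=.
    by rewrite opprK mulr_natl.
  rewrite [X in _ * (_ * X)](eq_bigr (fun=> 2 * (k * s))) => [|i _]; last first.
    rewrite (unsplitK (inr (lift ord0 i) : 'I_d + 'I_d)%type) /=.
    by rewrite opprK mulr_natl.
  rewrite !prodr_const !card_ord.
  have -> : (2 * (k * s)) ^+ n = (2 * k) ^+ n * s ^+ n by rewrite mulrA exprMn.
  have -> : delta ^+ d = s ^+ n * s ^+ n * s ^+ 2.
    by rewrite -s2 -exprM -!exprD; congr (_ ^+ _); rewrite /d; lia.
  have -> : (2 * k) ^+ (d + n) = (2 * k) ^+ n * (2 * k) ^+ n * (2 * k).
    by rewrite /d addSn exprS exprD mulrC.
  by rewrite -s2; field.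
rewrite -volB volumeE; apply: le_measure; rewrite ?inE//.
  apply: measurable_tuple_to_C_preimage; apply: measurable_sector.
  exact: measurable_nonisotropic_ball.
move=> t /= ht; rewrite -s2; apply: box_sub_sector; first by rewrite s0.
by rewrite s2.
Qed.

End SectorBox.

Section SurfaceMeasure.
Variables (R : realType) (d : nat).
Implicit Types (A B : set (borelC R d)).
Local Notation vol := (@volume R d).

Lemma volume_unit_ball_fin : (vol unit_ball < +oo)%E.
Proof. exact: (@volume_ball_fin R d 1). Qed.

Lemma fine_volume_unit_ball : vol unit_ball = (fine (vol unit_ball))%:E.
Proof. by rewrite fineK// ge0_fin_numE// volume_unit_ball_fin. Qed.

Lemma volume_sector_le A : measurable A -> (vol (sector A) <= vol unit_ball)%E.
Proof.
move=> mA; apply: le_measure; rewrite ?inE; [exact: measurable_sector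
  |exact: measurable_unit_ball|exact: sector_sub_ball].
Qed.

Lemma sigma_fin A : measurable A -> (sigma A < +oo)%E.
Proof.
move=> mA; rewrite /sigma lte_mul_pinfty ?lee_fin ?invr_ge0 ?fine_ge0//.
exact: le_lt_trans (volume_sector_le mA) volume_unit_ball_fin.
Qed.

Lemma sigma_sigma_finite : sigma_finite setT (@sigma R d).
Proof.
exists (fun=> setT); first by rewrite bigcup_const.
by move=> _; split=> //; exact: sigma_fin.
Qed.

HB.instance Definition _ :=
  Measure_isSigmaFinite.Build _ _ _ (@sigma R d) sigma_sigma_finite.

Hypothesis d_gt0 : (0 < d)%N.

Lemma volume_unit_ball_gt0 : (0 < vol unit_ball)%E.
Proof.
case: d d_gt0 => // n _; have [c c0 cP] := @volume_sector_lower R n.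
have h := cP 1 ltac:(by rewrite ltr01 lexx).
apply: (lt_le_trans _ (le_trans h _)); first by rewrite lte_fin expr1n mulr1.
apply: le_measure; rewrite ?inE; [apply: measurable_sector
  |exact: measurable_unit_ball|exact: sector_sub_ball].
exact: measurable_nonisotropic_ball.
Qed.

(** [volume_haar] for [U] and for the identity, compared on the unit ball, which
    [U] preserves. *)
Lemma volume_unitary U A : unitary U -> measurable A ->
  vol (U @^-1` A) = vol A.
Proof.
move=> uU mA; have mB : measurable (unit_ball : set (borelC R d)).
  exact: measurable_unit_ball.
have uid : unitary (@id (Cvec R d)) by split=> //; exists id.
have := volume_haar uU mA mB; have := volume_haar uid mA mB.
have -> : U @^-1` unit_ball = @unit_ball R d.
  by apply/seteqP; split=> z; rewrite /unit_ball /= (unitary_enorm _ uU).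
have b0 := volume_unit_ball_gt0; rewrite fine_volume_unit_ball in b0 *.
set b := fine _ in b0 *; rewrite lte_fin in b0.
move=> <- H.
have := congr1 (fun x => x * b^-1%:E)%E H.
by rewrite -!muleA -EFinM divff ?gt_eqF// !mule1.
Qed.

Lemma sigma_unitary U A : unitary U -> measurable A -> sigma (U @^-1` A) = sigma A.
Proof.
move=> uU mA; rewrite /sigma -(volume_unitary uU (measurable_sector mA)).
congr (_ * vol _)%E; apply/seteqP.
by split=> z; rewrite /sector /= (unitary_enorm _ uU) (unitaryZ _ _ uU).
Qed.

Lemma integral_sigma_unitary U (g : borelC R d -> \bar R) : unitary U ->
  measurable_fun setT g -> (forall z, 0 <= g z)%E ->
  (\int[@sigma R d]_(z in unit_sphere) g (U z) =
   \int[@sigma R d]_(z in unit_sphere) g z)%E.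
Proof.
move=> uU mg g0; have mU := unitary_measurable uU.
have E : U @^-1` unit_sphere = @unit_sphere R d.
  by apply/seteqP; split=> z; rewrite /unit_sphere /= (unitary_enorm _ uU).
rewrite -{1}E -[LHS](@ge0_integral_pushforward _ _ _ _ R _ mU (@sigma R d) _ g)//.
- apply: eq_measure_integral => B mB _; exact: (sigma_unitary uU mB).
- exact: measurable_unit_sphere.
- exact: measurable_funTS.
Qed.

Lemma sphere_transitive (z w : Cvec R d) : unit_sphere z -> unit_sphere w ->
  exists2 U, unitary U & U z = w.
Proof. by move=> z1 w1; apply: unitary_transitive; rewrite z1 w1. Qed.

Lemma sigma_nonisotropic_ball_eq (z w : Cvec R d) delta :
  unit_sphere z -> unit_sphere w ->
  sigma (nonisotropic_ball z delta) = sigma (nonisotropic_ball w delta).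
Proof.
move=> z1 w1; have [U uU Uz] := sphere_transitive z1 w1.
rewrite -(@sigma_unitary U _ uU (measurable_nonisotropic_ball w delta)).
congr (sigma _); apply/seteqP; case: (uU) => _ ip _.
by split=> x; rewrite /nonisotropic_ball /unit_sphere /= (unitary_enorm _ uU)
  -Uz ip.
Qed.

(** By unitary invariance the centre may be taken to be [e1], where
    [volume_sector_lower] applies. *)
Lemma sigma_nonisotropic_ball_lower : exists2 c : R, 0 < c &
  forall (z : Cvec R d) delta, unit_sphere z -> 0 < delta <= 1 ->
  ((c * delta ^+ d)%:E <= sigma (nonisotropic_ball z delta))%E.
Proof.
have b0 := volume_unit_ball_gt0.
have {b0}b0 : 0 < fine (vol unit_ball).
  by rewrite fine_gt0// b0 volume_unit_ball_fin.
have [c c0 [e e1 cP]] : exists2 c : R, 0 < c & exists2 e : Cvec R d, unit_sphere e &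
    forall delta, 0 < delta <= 1 ->
    ((c * delta ^+ d)%:E <= vol (sector (nonisotropic_ball e delta)))%E.
  case: d d_gt0 => // n _; have [c c0 cP] := @volume_sector_lower R n.
  by exists c => //; eexists; [exact: enorm_e1|exact: cP].
exists ((fine (vol unit_ball))^-1 * c); first by rewrite mulr_gt0 ?invr_gt0.
move=> z delta z1 h; rewrite (sigma_nonisotropic_ball_eq delta z1 e1).
by rewrite /sigma -mulrA EFinM lee_pmul2l// ?cP// lte_fin invr_gt0.
Qed.

Lemma sigma_nonisotropic_ball_gt0 (z : Cvec R d) delta :
  unit_sphere z -> 0 < delta -> (0 < sigma (nonisotropic_ball z delta))%E.
Proof.
move=> z1 d0; have [c c0 cP] := sigma_nonisotropic_ball_lower.
pose e := Num.min 1 delta.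
have e01 : 0 < e <= 1 by rewrite /e lt_min ltr01 d0 ge_min lexx.
have /andP[e0 _] := e01.
apply: lt_le_trans (le_trans (cP z e z1 e01) _).
  by rewrite lte_fin mulr_gt0// exprn_gt0.
apply: le_measure; rewrite ?inE; try exact: measurable_nonisotropic_ball.
move=> x [x1 xe]; split=> //; apply: le_trans xe _.
by rewrite /e ge_min lexx orbT.
Qed.

End SurfaceMeasure.

(** * Hardy means of continuous functions *)

(** Tonelli's theorem on a rectangle, by extending the integrand by zero. *)
Section TonelliIn.
Local Open Scope ereal_scope.
Context d1 d2 (T1 : measurableType d1) (T2 : measurableType d2) (R : realType).
Variables (m1 : {sigma_finite_measure set T1 -> \bar R})
          (m2 : {sigma_finite_measure set T2 -> \bar R}).
Variables (D1 : set T1) (D2 : set T2) (f : T1 * T2 -> R).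
Hypotheses (mD1 : measurable D1) (mD2 : measurable D2).
Hypotheses (mf : measurable_fun setT f) (f0 : forall z, (0 <= f z)%R).

Let f' (z : T1 * T2) : \bar R := (f z * \1_D1 z.1 * \1_D2 z.2)%:E.

Let mf' : measurable_fun setT f'.
Proof.
apply/measurable_EFinP; apply: measurable_funM; first apply: measurable_funM => //.
  exact: (measurableT_comp (measurable_indic mD1) measurable_fst).
exact: (measurableT_comp (measurable_indic mD2) measurable_snd).
Qed.

Let f'0 z : 0 <= f' z.
Proof. by rewrite lee_fin !mulr_ge0// indicE. Qed.

Let F'E x : \int[m2]_y f' (x, y) =
  ((fun x => \int[m2]_(y in D2) (f (x, y))%:E) \_ D1) x.
Proof.
rewrite /patch; case: ifPn => xD.
  rewrite [RHS]integral_mkcond; apply: eq_integral => y _.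
  rewrite /f' /patch /= !indicE xD mulr1; case: ifPn => yD; first by rewrite mulr1.
  by rewrite mulr0.
by rewrite integral0_eq// => y _; rewrite /f' /= !indicE (negbTE xD) mulr0 mul0r.
Qed.

Let G'E y : \int[m1]_x f' (x, y) =
  ((fun y => \int[m1]_(x in D1) (f (x, y))%:E) \_ D2) y.
Proof.
rewrite /patch; case: ifPn => yD.
  rewrite [RHS]integral_mkcond; apply: eq_integral => x _.
  rewrite /f' /patch /= !indicE yD mulr1; case: ifPn => xD; first by rewrite mulr1.
  by rewrite mulr0.
by rewrite integral0_eq// => x _; rewrite /f' /= !indicE (negbTE yD) mulr0.
Qed.

Lemma tonelli_in : \int[m1]_(x in D1) \int[m2]_(y in D2) (f (x, y))%:E =
  \int[m2]_(y in D2) \int[m1]_(x in D1) (f (x, y))%:E.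
Proof.
rewrite integral_mkcond [RHS]integral_mkcond.
rewrite (eq_integral (fun x => \int[m2]_y f' (x, y))) => [|x _]; last by rewrite F'E.
rewrite fubini_tonelli//; apply: eq_integral => y _; exact: G'E.
Qed.

Lemma measurable_tonelli_in :
  measurable_fun D1 (fun x => \int[m2]_(y in D2) (f (x, y))%:E).
Proof.
apply/(measurable_restrictT _ mD1).
rewrite (_ : _ \_ _ = fubini_F m2 f'); first exact: measurable_fun_fubini_tonelli_F.
by apply/funext => x; rewrite /fubini_F F'E.
Qed.

End TonelliIn.

Section Extension.
Variables (R : realType) (d : nat).
Implicit Types (z w : Cvec R d).

Definition retraction z : Cvec R d := (Num.max 1 (enorm z))^-1%:C%C *: z.

Lemma retraction_ball z : closed_unit_ball (retraction z).
Proof.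
rewrite /closed_unit_ball /= /retraction enormZ normc_real.
have m0 : 0 < Num.max 1 (enorm z) by rewrite lt_max ltr01.
by rewrite ger0_norm ?invr_ge0 ?(ltW m0)// mulrC ler_pdivrMr// mul1r le_max lexx orbT.
Qed.

Lemma retraction_id z : closed_unit_ball z -> retraction z = z.
Proof.
rewrite /closed_unit_ball /= /retraction => z1.
by rewrite max_l// invr1 scale1r.
Qed.

Lemma retraction_lipschitz z w : enorm (retraction w - retraction z) <= 2 * enorm (w - z).
Proof.
rewrite /retraction; set m := Num.max 1 (enorm w); set n := Num.max 1 (enorm z).
have m1 : 1 <= m by rewrite le_max lexx.
have n1 : 1 <= n by rewrite le_max lexx.
have zn : enorm z <= n by rewrite le_max lexx orbT.
have m0 : 0 < m by lra.
have n0 : 0 < n by lra.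
have mn : `|n - m| <= enorm (w - z).
  have h1 := ler_enormB w z; have h2 := ler_enormB z w; rewrite enormB in h2.
  have h0 := enorm_ge0 (w - z).
  rewrite ler_norml /m /n; apply/andP; split.
    by case: (lerP 1 (enorm w)); case: (lerP 1 (enorm z)) => ? ?; lra.
  by case: (lerP 1 (enorm w)); case: (lerP 1 (enorm z)) => ? ?; lra.
have -> : m^-1%:C%C *: w - n^-1%:C%C *: z =
    m^-1%:C%C *: (w - z) + ((n - m) / (m * n))%:C%C *: z.
  rewrite scalerBr -addrA; congr (_ + _); rewrite -!scaleNr -scalerDl; congr (_ *: _).
  rewrite -!rmorphN /= -rmorphD /=; congr (_%:C)%C; field.
  by rewrite !gt_eqF.
apply: le_trans (enormD _ _) _; rewrite !enormZ !normc_real.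
rewrite [leRHS](_ : _ = enorm (w - z) + enorm (w - z)); last by ring.
have e0 := enorm_ge0 (w - z).
apply: lerD.
  by rewrite ler_piMl// ger0_norm ?invf_le1// invr_ge0 ltW.
rewrite normrM normfV [X in _ / X]ger0_norm ?mulr_ge0 ?(ltW m0) ?(ltW n0)//.
rewrite mulrAC ler_pdivrMr ?mulr_gt0//; apply: ler_pM => //; first exact: enorm_ge0.
by rewrite (le_trans zn)// ler_peMl// ltW.
Qed.

(** A function continuous on the closed ball is extended by composition with
    the radial retraction, so that the powers of its modulus become Borel on
    the whole space. *)
Definition ext_power (f : Cvec R d -> R[i]) (p : R) z := normc (f (retraction z)) `^ p.

Variables (f : Cvec R d -> R[i]) (p : R).
Hypothesis f_cont : {within closed_unit_ball, continuous f}.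
Hypothesis p_gt1 : 1 < p.

Lemma ext_power_ge0 z : 0 <= ext_power f p z.
Proof. exact: powR_ge0. Qed.

Lemma ext_powerE z : closed_unit_ball z -> ext_power f p z = normc (f z) `^ p.
Proof. by move=> z1; rewrite /ext_power retraction_id. Qed.

(** Join [z] to the origin by [n + 1] steps shorter than the radius of uniform
    continuity for [1]. *)
Lemma bounded_on_ball : exists2 M : R, 0 < M &
  forall z, closed_unit_ball z -> normc (f z) <= M.
Proof.
have [r r0 rP] := unif_continuous_closed_unit_ball f_cont ltr01.
have [n hn] := ltr_add_invr r0; rewrite add0r in hn.
exists (normc (f 0) + n.+2%:R); first by rewrite ltr_wpDl// normc_ge0.
move=> z z1.
have step k : (k <= n.+1)%N -> normc (f ((k%:R / n.+1%:R)%:C%C *: z)) <= normc (f 0) + k%:R.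
  elim: k => [|k IH] kn; first by rewrite mul0r scale0r addr0.
  apply: le_trans (_ : _ <= normc (f ((k%:R / n.+1%:R)%:C%C *: z)) + 1) _; last first.
    by rewrite -[k.+1%:R]natr1 addrA lerD2r IH// ltnW.
  have ball j : (j <= n.+1)%N -> closed_unit_ball ((j%:R / n.+1%:R)%:C%C *: z).
    move=> jn; rewrite /closed_unit_ball /= enormZ normc_real ger0_norm ?divr_ge0//.
    by rewrite -[leRHS]mul1r ler_pM ?enorm_ge0 ?divr_ge0// ler_pdivrMr// mul1r ler_nat.
  have := rP _ _ (ball k (ltnW kn)) (ball k.+1 kn).
  have -> : enorm ((k.+1%:R / n.+1%:R)%:C%C *: z - (k%:R / n.+1%:R)%:C%C *: z) =
      n.+1%:R^-1 * enorm z.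
    rewrite -scalerBl (_ : _ - _ = (n.+1%:R^-1)%:C%C).
      by rewrite enormZ normc_real ger0_norm.
    apply/eqP; rewrite eq_complex /= subrr eqxx andbT -mulrBl -[k.+1%:R]natr1.
    by rewrite addrAC subrr add0r mul1r.
  have zn : n.+1%:R^-1 * enorm z < r by rewrite (le_lt_trans _ hn)// ler_piMr.
  move=> /(_ zn)/ltW h.
  by rewrite -lerBlDl; apply: le_trans h; exact: le_trans (ler_norm _) (ler_normcB _ _).
have := step n.+1 (leqnn _); rewrite divff// scale1r => h.
by rewrite (le_trans h)// lerD2l ler_nat.
Qed.

Lemma ext_power_unif (e : R) : 0 < e -> exists2 r : R, 0 < r & forall z w,
  enorm (w - z) < r -> `|ext_power f p w - ext_power f p z| < e.
Proof.
move=> e0; have [M M0 fM] := bounded_on_ball.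
have K0 : 0 < p * M `^ (p - 1) by rewrite mulr_gt0 ?powR_gt0// (lt_trans ltr01).
have [r r0 rP] := unif_continuous_closed_unit_ball f_cont (divr_gt0 e0 K0).
exists (r / 2); first by rewrite divr_gt0.
move=> z w zw; have zr := retraction_ball z; have wr := retraction_ball w.
apply: (@le_lt_trans _ _ (p * M `^ (p - 1) *
    `|normc (f (retraction w)) - normc (f (retraction z))|)).
  by apply: powR_lipschitz; rewrite ?normc_ge0 ?fM.
rewrite mulrC -ltr_pdivlMr//; apply: le_lt_trans (ler_normcB _ _) _.
apply: rP => //; apply: le_lt_trans (retraction_lipschitz _ _) _.
by rewrite mulrC -ltr_pdivlMr.
Qed.

Lemma measurable_ext_power : measurable_fun [set: borelC R d] (ext_power f p).
Proof.
apply: econtinuous_measurable => z e e0.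
by have [r r0 rP] := ext_power_unif e0; exists r => // w; exact: rP.
Qed.

End Extension.

Section SphereMeans.
Variables (R : realType) (d : nat).
Implicit Types (z w : Cvec R d).
Variables (f : Cvec R d -> R[i]) (p : R).
Hypothesis f_cont : {within closed_unit_ball, continuous f}.
Hypothesis p_gt1 : 1 < p.
Hypothesis d_gt0 : (0 < d)%N.
Local Notation h := (ext_power f p).

Lemma slice_unif_continuous z : unit_sphere z ->
  disc_unif_continuous (fun b : R[i] => f (b *: z)).
Proof.
move=> z1 e e0; have [r r0 rP] := unif_continuous_closed_unit_ball f_cont e0.
exists r => // a b a1 b1 ab; apply: rP; rewrite /closed_unit_ball /= ?enormZ ?z1 ?mulr1//.
by rewrite -scalerBl enormZ z1 mulr1.
Qed.

Lemma slice_differentiable z (b : R[i]) : unit_sphere z -> holomorphic_on_ball f ->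
  normc b < 1 -> differentiable (fun a : R[i] => f (a *: z)) b.
Proof.
move=> z1 hf b1.
apply: (@differentiable_comp _ _ _ _ (fun b : R[i] => b *: z) f).
  by apply: (@differentiableZl _ R[i] _ id z b); exact: ex_diff.
by apply: hf; rewrite /unit_ball /= enormZ z1 mulr1.
Qed.

Lemma sint_EFin (a b : R) (g : R -> R) : cont_on a b g ->
  ((sint a b g)%:E = \int[@lebesgue_measure R]_(t in `[a, b]) (g t)%:E)%E.
Proof.
by move=> cg; rewrite /sint /Rintegral fineK// integrable_fin_num//;
  exact: cont_on_integrable.
Qed.

Lemma econt_measurable (g : R -> R) :
  (forall x e, 0 < e -> exists2 s, 0 < s & forall y, `|y - x| < s -> `|g y - g x| < e) ->
  measurable_fun [set: measurableTypeR R] g.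
Proof.
move=> cg; apply: continuous_measurable_fun => x.
apply/cvgrPdist_lt => e e0; have [s s0 sP] := cg x e e0.
apply/nbhs_ballP; exists s => //= y.
by rewrite /ball /= distrC => /sP; rewrite distrC.
Qed.

(** Averaging a pointwise circular submean inequality over the sphere: each
    rotation [z |-> mu t *: z] preserves the surface measure. *)
Lemma circle_average (mu : R -> R[i]) r :
  (forall t, normc (mu t) = 1) ->
  measurable_fun [set: measurableTypeR R] (fun t => Re (mu t)) ->
  measurable_fun [set: measurableTypeR R] (fun t => Im (mu t)) ->
  (forall z, unit_sphere z -> ((pi *+ 2)%:E * (h (r%:C%C *: z))%:E <=
    \int[@lebesgue_measure R]_(t in `[0%R, (pi *+ 2)%R]) (h (mu t *: z))%:E)%E) ->
  (\int[@sigma R d]_(z in unit_sphere) (h (r%:C%C *: (z : Cvec R d)))%:E <=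
   \int[@sigma R d]_(z in unit_sphere) (h z)%:E)%E.
Proof.
move=> mu1 mRe mIm pointwise.
pose q (zt : borelC R d * measurableTypeR R) := h (mu zt.2 *: (zt.1 : Cvec R d)).
have mh : measurable_fun [set: borelC R d] h by exact: measurable_ext_power.
have mS : measurable (unit_sphere : set (borelC R d)) by exact: measurable_unit_sphere.
have mq : measurable_fun setT q.
  apply: (measurableT_comp mh); apply: measurable_to_borelC => j.
    rewrite (_ : (fun t => _) = fun t : borelC R d * measurableTypeR R =>
      Re (mu t.2) * Re ((t.1 : Cvec R d) ord0 j) -
      Im (mu t.2) * Im ((t.1 : Cvec R d) ord0 j)).
      apply: measurable_funB; apply: measurable_funM.
      - exact: (measurableT_comp mRe measurable_snd).
      - exact: (measurableT_comp (measurable_Re_coord j) measurable_fst).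
      - exact: (measurableT_comp mIm measurable_snd).
      - exact: (measurableT_comp (measurable_Im_coord j) measurable_fst).
    by apply/funext => t; rewrite mxE ReM.
  rewrite (_ : (fun t => _) = fun t : borelC R d * measurableTypeR R =>
    Re (mu t.2) * Im ((t.1 : Cvec R d) ord0 j) +
    Im (mu t.2) * Re ((t.1 : Cvec R d) ord0 j)).
    apply: measurable_funD; apply: measurable_funM.
    - exact: (measurableT_comp mRe measurable_snd).
    - exact: (measurableT_comp (measurable_Im_coord j) measurable_fst).
    - exact: (measurableT_comp mIm measurable_snd).
    - exact: (measurableT_comp (measurable_Re_coord j) measurable_fst).
  by apply/funext => t; rewrite mxE ImM.
have q0 zt : 0 <= q zt by exact: ext_power_ge0.
have pi2 : 0 < pi *+ 2 :> R by rewrite pmulrn_lgt0// pi_gt0.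
have leI : lebesgue_measure ([set` `[0, pi *+ 2]] : set R) = (pi *+ 2)%:E.
  by rewrite lebesgue_measure_itv /= lte_fin pi2 oppr0 addr0.
have mI : measurable ([set` `[0, pi *+ 2]] : set (measurableTypeR R)).
  exact: measurable_itv.
have mean t : (\int[@sigma R d]_(z in unit_sphere) (q (z, t))%:E =
    \int[@sigma R d]_(z in unit_sphere) (h z)%:E)%E.
  apply: (integral_sigma_unitary d_gt0 (g := fun z => (h z)%:E) (unitary_phase d (mu1 t))).
    exact/measurable_EFinP.
  by move=> z; rewrite lee_fin ext_power_ge0.
have mhr : measurable_fun [set: borelC R d] (fun z : borelC R d => h (r%:C%C *: (z : Cvec R d))).
  by apply: (measurableT_comp mh); apply: (@measurable_scale_fun _ _ _ (borelC R d) (fun=> r) id).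
move: leI mI pointwise pi2; move: (pi *+ 2) => P leI mI pointwise P0.
have L : (\int[@sigma R d]_(z in unit_sphere) (P%:E * (h (r%:C%C *: (z : Cvec R d)))%:E) =
    P%:E * \int[@sigma R d]_(z in unit_sphere) (h (r%:C%C *: (z : Cvec R d)))%:E)%E.
  apply: ge0_integralZl_EFin; [exact: mS| | |exact: ltW].
    by move=> z _; rewrite lee_fin ext_power_ge0.
  apply/measurable_EFinP; exact: measurable_funTS.
suff : (\int[@sigma R d]_(z in unit_sphere) (P%:E * (h (r%:C%C *: (z : Cvec R d)))%:E) <=
    P%:E * \int[@sigma R d]_(z in unit_sphere) (h z)%:E)%E.
  rewrite L; move: (integral _ _ _) (integral _ _ _) => A B.
  by rewrite lee_pmul2l.
have step : (\int[@sigma R d]_(z in unit_sphere) (P%:E * (h (r%:C%C *: (z : Cvec R d)))%:E) <=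
    \int[@sigma R d]_(z in unit_sphere)
      \int[@lebesgue_measure R]_(t in [set` `[0%R, P]]) (q (z, t))%:E)%E.
  apply: ge0_le_integral.
  - exact: mS.
  - by move=> z _; rewrite mule_ge0 ?lee_fin ?ext_power_ge0 ?(ltW P0).
  - apply: measurable_funeM; apply/measurable_EFinP; exact: measurable_funTS.
  - exact: (@measurable_tonelli_in _ _ _ _ R (@lebesgue_measure R) _ _ q mS mI mq q0).
  - exact: pointwise.
apply: le_trans step _.
rewrite (@tonelli_in _ _ _ _ R (@sigma R d) (@lebesgue_measure R) _ _ q mS mI mq q0).
set B := (\int[@sigma R d]_(z in unit_sphere) (h z)%:E)%E.
suff -> : (\int[@lebesgue_measure R]_(t in [set` `[0%R, P]])
    \int[@sigma R d]_(z in unit_sphere) (q (z, t))%:E = P%:E * B)%E by exact: lexx.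
rewrite (eq_integral (fun=> B)) => [|t _]; last exact: mean.
rewrite muleC -leI; exact: integral_cst.
Qed.

(** On each slice [b |-> f (b *: z)] the submean inequality at [r] is an integral
    over the images [mu t] of the unit circle under the Moebius transformation.
    These are unimodular, so that the average over [z] forgets them. *)
Lemma sphere_mean_le r : 0 <= r < 1 -> holomorphic_on_ball f ->
  (\int[@sigma R d]_(z in unit_sphere) (h (r%:C%C *: (z : Cvec R d)))%:E <=
   \int[@sigma R d]_(z in unit_sphere) (h z)%:E)%E.
Proof.
move=> r01 hf; pose mu t := mobius r (cexp (0 +i* t)%C).
have mu1 t : normc (mu t) = 1.
  by apply: normc_mobius_eq1 => //; rewrite normc_cexp expR0.
have K0 : 0 < (1 - r) ^+ 2 by case/andP: r01 => ? ?; rewrite exprn_gt0 ?subr_gt0.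
have mu_cont t (e : R) : 0 < e -> exists2 s, 0 < s & forall y, `|y - t| < s ->
    normc (mu y - mu t) < e.
  move=> e0; have [s s0 sP] := cexp_imaginary_cont t (mulr_gt0 e0 K0).
  exists s => // y /sP sy.
  have n1 (x : R) : normc (cexp (0 +i* x)%C) <= 1 by rewrite normc_cexp expR0.
  apply: le_lt_trans (mobius_lipschitz r01 (n1 _) (n1 _)) _.
  by rewrite mulrC ltr_pdivrMr.
apply: (circle_average mu1).
- apply: econt_measurable => t e e0; have [s s0 sP] := mu_cont t e e0.
  exists s => // y /sP; apply: le_lt_trans; rewrite -raddfB; exact: normc_Re.
- apply: econt_measurable => t e e0; have [s s0 sP] := mu_cont t e e0.
  exists s => // y /sP; apply: le_lt_trans; rewrite -raddfB; exact: normc_Im.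
move=> z z1; have [cc le] := @powR_submean R (fun b : R[i] => f (b *: z)) r
   (fun b b1 => slice_differentiable z1 hf b1) (slice_unif_continuous z1) r01 p p_gt1.
have ball b : normc b <= 1 -> closed_unit_ball (b *: z).
  by move=> b1; rewrite /closed_unit_ball /= enormZ z1 mulr1.
have E : (fun t => circle_modulus (fun b : R[i] => f (b *: z)) r t `^ p) =
    (fun t => h (mu t *: z)).
  by apply/funext => t; rewrite ext_powerE; [by []|apply: ball; rewrite mu1].
rewrite E in cc le.
rewrite -(sint_EFin cc) ext_powerE; last first.
  by case/andP: r01 => r0 r1; apply: ball; rewrite normc_real ger0_norm// ltW.
by rewrite -EFinM mulrC lee_fin.
Qed.

End SphereMeans.

(** * Domination of the surface measure on nonisotropic balls *)

Section Domination.
Variables (R : realType) (d : nat).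
Hypothesis d_gt0 : (0 < d)%N.
Variable mu : {finite_measure set (borelC R d) -> \bar R}.
Variable h : Cvec R d -> R.
Hypothesis mh : measurable_fun [set: borelC R d] h.
Hypothesis h_ge0 : forall z, 0 <= h z.
Hypothesis h_unif : forall e, 0 < e -> exists2 r : R, 0 < r &
  forall z w : Cvec R d, enorm (w - z) < r -> `|h w - h z| < e.
Local Open Scope ereal_scope.

Lemma exists_sphere_point : exists z : Cvec R d, unit_sphere z.
Proof. by case: d d_gt0 => // n _; eexists; exact: enorm_e1. Qed.

Let P delta : set (borelC R d * borelC R d) :=
  [set q | (normc (1 - 1%:C%C * inner (q.1 : Cvec R d) (q.2 : Cvec R d)) <= delta)%R].

Let mP delta : measurable (P delta).
Proof.
rewrite (_ : P delta = (fun q : borelC R d * borelC R d =>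
    normc (1 - 1%:C%C * inner (q.1 : Cvec R d) (q.2 : Cvec R d))%R) @^-1` `]-oo, delta]).
  rewrite -[X in measurable X]setTI; apply: measurable_normc_1Binner => //.
by apply/seteqP; split => q; rewrite /P /= in_itv.
Qed.

Let P_l delta (z : borelC R d) : [set w : borelC R d | P delta (z, w)] `&` unit_sphere = nonisotropic_ball z delta.
Proof. by apply/seteqP; split=> w; rewrite /P /nonisotropic_ball /= mul1r => -[]. Qed.

Let P_r delta (w : borelC R d) : [set z : borelC R d | P delta (z, w)] `&` unit_sphere = nonisotropic_ball w delta.
Proof.
by apply/seteqP; split=> z; rewrite /P /nonisotropic_ball /= mul1r
  (normc_1Binner z) => -[].
Qed.

Let mS : measurable (unit_sphere : set (borelC R d)).
Proof. exact: measurable_unit_sphere. Qed.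

Let mPl delta (z : borelC R d) : measurable ([set w : borelC R d | P delta (z, w)] : set (borelC R d)).
Proof.
by have := measurable_xsection z (mP delta); congr measurable;
  apply/seteqP; split=> w; rewrite /xsection /= inE.
Qed.

Let mPr delta (w : borelC R d) : measurable ([set z : borelC R d | P delta (z, w)] : set (borelC R d)).
Proof.
by have := measurable_ysection w (mP delta); congr measurable;
  apply/seteqP; split=> z; rewrite /ysection /= inE.
Qed.

Let indicP_l delta (z w : borelC R d) : \1_(P delta) (z, w) = \1_[set w : borelC R d | P delta (z, w)] w :> R.
Proof. by rewrite !indicE; congr ((_ : bool)%:R); apply/idP/idP; rewrite !inE. Qed.

Let indicP_r delta (z w : borelC R d) : \1_(P delta) (z, w) = \1_[set z : borelC R d | P delta (z, w)] z :> R.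
Proof. by rewrite !indicE; congr ((_ : bool)%:R); apply/idP/idP; rewrite !inE. Qed.

(** Averaging [h] over balls of radius [delta] costs at most its oscillation
    [e]; by Tonelli and the symmetry of the quasi-distance the average may be
    moved from [sigma] to [mu]. *)
Lemma averaged_domination (C e delta : R) : (0 < C)%R -> (0 < e)%R -> (0 < delta)%R ->
  (forall z w : Cvec R d, unit_sphere z -> unit_sphere w ->
     (normc (1 - inner z w) <= delta)%R -> (h z <= h w + e)%R) ->
  (forall z : Cvec R d, unit_sphere z ->
     C%:E * sigma (nonisotropic_ball z delta) <= mu (nonisotropic_ball z delta)) ->
  C%:E * \int[@sigma R d]_(z in unit_sphere) (h z)%:E <=
    \int[mu]_(z in unit_sphere) (h z)%:E + (e%:E * mu unit_sphere).
Proof.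
move=> C0 e0 d0 osc dom.
have [z0 z01] := exists_sphere_point.
pose s := fine (sigma (nonisotropic_ball z0 delta)).
have sE (z : Cvec R d) : unit_sphere z -> sigma (nonisotropic_ball z delta) = s%:E.
  move=> z1; rewrite (sigma_nonisotropic_ball_eq d_gt0 delta z1 z01) /s fineK//.
  rewrite ge0_fin_numE//; apply: sigma_fin; exact: measurable_nonisotropic_ball.
have s0 : (0 < s)%R.
  by rewrite -lte_fin -(sE z0 z01); exact: sigma_nonisotropic_ball_gt0.
pose q (zw : borelC R d * borelC R d) : R := (h zw.1 * \1_(P delta) zw)%R.
have mq : measurable_fun setT q.
  apply: measurable_funM; first exact: (measurableT_comp mh measurable_fst).
  exact: measurable_indic.
have q0 zw : (0 <= q zw)%R by rewrite mulr_ge0// indicE.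
have left z : \int[mu]_(w in unit_sphere) (q (z, w))%:E =
    (h z)%:E * mu (nonisotropic_ball z delta).
  rewrite (eq_integral (fun w => (h z)%:E * (\1_[set w : borelC R d | P delta (z, w)] w)%:E)).
    rewrite ge0_integralZl_EFin; [|exact: mS| | |exact: h_ge0].
    - by rewrite integral_indic// P_l.
    - by move=> w _; rewrite lee_fin.
    - apply/measurable_EFinP; apply: measurable_funTS; exact: measurable_indic.
  by move=> w _; rewrite -EFinM -indicP_l.
have right w : \int[@sigma R d]_(z in unit_sphere) ((h w + e)%R * \1_(P delta) (z, w))%:E =
    (h w + e)%:E * sigma (nonisotropic_ball w delta).
  rewrite (eq_integral (fun z => (h w + e)%:E * (\1_[set z : borelC R d | P delta (z, w)] z)%:E)).
    rewrite ge0_integralZl_EFin; [|exact: mS| | |by rewrite addr_ge0// ltW].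
    - by rewrite integral_indic// P_r.
    - by move=> z _; rewrite lee_fin.
    - apply/measurable_EFinP; apply: measurable_funTS; exact: measurable_indic.
  by move=> z _; rewrite -EFinM -indicP_r.
have mhS :
    measurable_fun (unit_sphere : set (borelC R d)) (fun z => (h z)%:E).
  by apply/measurable_EFinP; exact: measurable_funTS.
have lo : (C * s)%:E * \int[@sigma R d]_(z in unit_sphere) (h z)%:E <=
    \int[@sigma R d]_(z in unit_sphere) \int[mu]_(w in unit_sphere) (q (z, w))%:E.
  rewrite -ge0_integralZl_EFin; [|exact: mS|by move=> z _; rewrite lee_fin|exact: mhS
    |by rewrite mulr_ge0// ltW].
  apply: ge0_le_integral.
  - exact: mS.
  - by move=> z _; rewrite mule_ge0 ?lee_fin ?mulr_ge0 ?(ltW C0) ?(ltW s0).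
  - by apply: measurable_funeM; exact: mhS.
  - exact: (@measurable_tonelli_in _ _ _ _ R mu _ _ q mS mS mq q0).
  - move=> z z1; rewrite left muleC lee_wpmul2l ?lee_fin//.
    by have := dom z z1; rewrite sE// EFinM.
have up : \int[mu]_(w in unit_sphere) \int[@sigma R d]_(z in unit_sphere) (q (z, w))%:E <=
    s%:E * (\int[mu]_(z in unit_sphere) (h z)%:E + e%:E * mu unit_sphere).
  apply: (@le_trans _ _ (\int[mu]_(w in unit_sphere) (s%:E * ((h w)%:E + e%:E)))).
    apply: ge0_le_integral.
    - exact: mS.
    - by move=> w _; apply: integral_ge0 => z _; rewrite lee_fin.
    - have mq' : measurable_fun setT (fun wz : borelC R d * borelC R d => q (wz.2, wz.1)).
        by apply: (measurableT_comp mq); exact: measurable_swap.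
      exact: (@measurable_tonelli_in _ _ _ _ R (@sigma R d) _ _ _ mS mS mq' (fun=> q0 _)).
    - by apply: measurable_funeM; apply: emeasurable_funD => //; exact: mhS.
    - move=> w w1; rewrite muleC -(sE w w1) -EFinD -right.
      apply: ge0_le_integral.
      + exact: mS.
      + by move=> z _; rewrite lee_fin.
      + apply/measurable_EFinP; apply: measurable_funTS.
        by apply: (measurableT_comp mq); exact: measurable_pair2.
      + apply/measurable_EFinP; apply: measurable_funTS; apply: measurable_funM => //.
        rewrite (_ : (fun z => _) = \1_[set z : borelC R d | P delta (z, w)]).
          by apply: measurable_indic; exact: mPr.
        by apply/funext => z; rewrite indicP_r.
      + move=> z z1; rewrite lee_fin /q /= indicE; case: (boolP (_ \in _)) => zP.
          by rewrite !mulr1; apply: osc => //; move: zP; rewrite inE /P /= mul1r.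
        by rewrite !mulr0.
  rewrite ge0_integralZl_EFin; [|exact: mS
    |by move=> w _; rewrite -EFinD lee_fin addr_ge0// ltW
    |by apply: emeasurable_funD => //; exact: mhS|exact: ltW].
  rewrite ge0_integralD; [|exact: mS|by move=> w _; rewrite lee_fin|exact: mhS
    |by move=> w _; rewrite lee_fin ltW|by []].
  by rewrite integral_cst.
have := le_trans lo (le_trans _ up).
rewrite (@tonelli_in _ _ _ _ R (@sigma R d) mu _ _ q mS mS mq q0) => /(_ (lexx _)).
by rewrite [(C * s)%R]mulrC EFinM -muleA lee_pmul2l// lte_fin.
Qed.

(** Uniform continuity makes the oscillation over small nonisotropic balls, hence
    the error of [averaged_domination], arbitrarily small. *)
Lemma domination_integral (C : R) : (0 < C)%R ->
  (forall (z : Cvec R d) delta, unit_sphere z -> (0 < delta)%R ->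
     C%:E * sigma (nonisotropic_ball z delta) <= mu (nonisotropic_ball z delta)) ->
  C%:E * \int[@sigma R d]_(z in unit_sphere) (h z)%:E <=
    \int[mu]_(z in unit_sphere) (h z)%:E.
Proof.
move=> C0 dom; apply/lee_addgt0Pr => e e0.
have mSfin : mu unit_sphere \is a fin_num by exact: fin_num_measure.
have m0 : (0 <= fine (mu unit_sphere))%R by exact: fine_ge0.
have M0 : (0 < fine (mu unit_sphere) + 1)%R by rewrite ltr_wpDl.
have e'0 := divr_gt0 e0 M0.
have [r r0 rP] := h_unif e'0.
pose delta := (r ^+ 2 / 4)%R.
have d0 : (0 < delta)%R by rewrite divr_gt0// exprn_gt0.
have := averaged_domination C0 e'0 d0 _ (fun z z1 => dom z delta z1 d0).
move=> H; apply: (le_trans (H _)).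
  move=> z w z1 w1 zw.
  have : (enorm (z - w) < r)%R.
    rewrite -(@ltr_pXn2r _ 2)// ?nnegrE ?enorm_ge0 ?(ltW r0)//.
    apply: le_lt_trans (sphere_dist_le z1 w1) _.
    have : (2 * normc (1 - inner z w) <= r ^+ 2 / 2)%R by move: zw; rewrite /delta; lra.
    by move=> /le_lt_trans; apply; rewrite ltr_pdivrMr// ltr_pMr ?exprn_gt0// ltr1n.
  by move=> /rP; rewrite ltr_norml => /andP[_]; rewrite ltrBlDl => /ltW.
apply: leeD => //; rewrite -(fineK mSfin) -EFinM lee_fin.
by rewrite mulrAC ler_pdivrMr// ler_pM2l// lerDl.
Qed.

End Domination.

(** * Hardy norms and the Cauchy kernel *)

Section HardyNorm.
Variables (R : realType) (d : nat) (p : R).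
Hypothesis p_gt0 : 0 < p.

Definition hardy_mean (f : Cvec R d -> R[i]) (r : R) : \bar R :=
  (\int[@sigma R d]_(z in unit_sphere)
     (normc (f (r%:C%C *: (z : Cvec R d))) `^ p)%:E)%E.

Lemma hardy_mean_ge0 f r : (0 <= hardy_mean f r)%E.
Proof. by apply: integral_ge0 => z _; rewrite lee_fin powR_ge0. Qed.

Lemma eq_hardy_norm f g : (forall r, hardy_mean f r = hardy_mean g r) ->
  hardy_norm p f = hardy_norm p g.
Proof.
move=> fg; have E : [set hardy_mean f r | r in `]0, 1[%classic] =
    [set hardy_mean g r | r in `]0, 1[%classic].
  by apply: eq_imagel => r _; exact: fg.
exact: (congr1 (fun A => (ereal_sup A `^ p^-1)%E) E).
Qed.

Lemma hardy_norm_powE f :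
  (hardy_norm p f `^ p)%E = ereal_sup [set hardy_mean f r | r in `]0, 1[%classic].
Proof.
rewrite /hardy_norm -poweRrM mulVf ?gt_eqF// poweRe1//.
apply: (le_trans (hardy_mean_ge0 f 2^-1)); apply: ereal_sup_ubound.
by exists 2^-1 => //=; rewrite in_itv /= invr_gt0 ltr0n invf_lt1 ?ltr1n.
Qed.

Lemma hardy_mean_le_norm f r : 0 < r < 1 -> (hardy_mean f r <= hardy_norm p f `^ p)%E.
Proof.
by move=> r01; rewrite hardy_norm_powE; apply: ereal_sup_ubound; exists r;
  rewrite //= in_itv.
Qed.

Lemma hardy_norm_le f (M : \bar R) :
  (forall r, 0 < r < 1 -> (hardy_mean f r <= M)%E) -> (hardy_norm p f `^ p <= M)%E.
Proof.
move=> H; rewrite hardy_norm_powE; apply: ge_ereal_sup => _ [r + <-].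
by rewrite /= in_itv => /H.
Qed.

End HardyNorm.

Section CauchyKernel.
Variables (R : realType) (d : nat) (p : R).
Hypothesis p_gt1 : 1 < p.
Hypothesis d_gt0 : (0 < d)%N.
Implicit Types (z w : Cvec R d).

Let p_gt0 : 0 < p. Proof. exact: lt_trans ltr01 p_gt1. Qed.

(** Every estimate of kernels is one of [|1 - <z, w>|] through this function,
    which is decreasing and multiplicative. *)
Definition kap (x : R) := (x ^+ d) `^ (- p).

Lemma kap_kernel w z : normc (cauchy_kernel w z) `^ p = kap (normc (1 - inner z w)).
Proof.
rewrite /cauchy_kernel /kap Normc.normcV normcX.
by rewrite -powR_inv1 ?exprn_ge0 ?normc_ge0// -powRrM mulN1r.
Qed.

Lemma kap_ge0 x : 0 <= kap x. Proof. exact: powR_ge0. Qed.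

Lemma kap_gt0 x : 0 < x -> 0 < kap x.
Proof. by move=> x0; rewrite powR_gt0// exprn_gt0. Qed.

Lemma kapM x y : 0 <= x -> 0 <= y -> kap (x * y) = kap x * kap y.
Proof. by move=> x0 y0; rewrite /kap exprMn powRM// exprn_ge0. Qed.

Lemma kap_le x y : 0 < x -> x <= y -> kap y <= kap x.
Proof.
move=> x0 xy; have y0 := lt_le_trans x0 xy.
rewrite /kap !powRN lef_pV2 ?posrE ?powR_gt0 ?exprn_gt0//.
by rewrite ge0_ler_powR ?(ltW p_gt0)// ?nnegrE ?exprn_ge0 ?(ltW x0) ?(ltW y0)//
  lerXn2r// ?nnegrE ltW.
Qed.

Lemma kap2_inv_gt0 : 0 < (kap 2)^-1.
Proof. by rewrite invr_gt0 kap_gt0. Qed.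

Lemma kap_le2 x y : 0 < y -> y <= 2 * x -> kap x <= (kap 2)^-1 * kap y.
Proof.
move=> y0 yx; have x0 : 0 < x by lra.
rewrite mulrC ler_pdivlMr ?kap_gt0// mulrC -kapM ?(ltW x0)//.
exact: kap_le.
Qed.

Lemma measurable_kap : measurable_fun [set: R] kap.
Proof.
apply: (measurableT_comp (measurable_powR _)); apply: measurable_funX.
exact: measurable_id.
Qed.

Lemma normc_1B_ge (b : R[i]) : 1 - normc b <= normc (1 - b).
Proof.
by have := ler_normcB 1 b; rewrite Normc.normc1 ler_norml => /andP[_].
Qed.

Lemma normc_1B_gt0 (b : R[i]) : normc b < 1 -> 0 < normc (1 - b).
Proof. by move=> b1; have := normc_1B_ge b; lra. Qed.

(** Radial perturbations change [1 - b] by a factor at most two. *)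
Lemma normc_1B_scale (s : R) (b : R[i]) : 0 <= s <= 1 -> normc b <= 1 ->
  normc (1 - b) <= 2 * normc (1 - s%:C%C * b).
Proof.
move=> /andP[s0 s1] b1.
have -> : 1 - b = (1 - s%:C%C * b) + - ((1 - s)%:C%C * b).
  by rewrite rmorphB rmorph1 mulrBl mul1r opprB addrA subrK.
apply: le_trans (le_normcD _ _) _.
rewrite normcN Normc.normcM normc_real ger0_norm ?subr_ge0//.
have := normc_1B_ge (s%:C%C * b); rewrite Normc.normcM normc_real ger0_norm//.
have b0 := normc_ge0 b.
have : s * normc b <= s by rewrite ler_piMr.
have : (1 - s) * normc b <= 1 - s by rewrite ler_piMr// subr_ge0.
lra.
Qed.

Lemma normc_1B_shrink (s : R) (b : R[i]) : 0 <= s <= 1 -> normc b <= s ->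
  normc (1 - s%:C%C * b) <= 2 * normc (1 - b).
Proof.
move=> /andP[s0 s1] bs.
have -> : 1 - s%:C%C * b = (1 - b) + (1 - s)%:C%C * b.
  by rewrite rmorphB rmorph1 mulrBl mul1r addrA subrK.
apply: le_trans (le_normcD _ _) _.
rewrite Normc.normcM normc_real ger0_norm ?subr_ge0//.
have := normc_1B_ge b; have b0 := normc_ge0 b.
have : (1 - s) * normc b <= 1 - s by rewrite ler_piMr ?subr_ge0// (le_trans bs).
lra.
Qed.

Section FixedPole.
Variable w : Cvec R d.
Hypothesis w1 : unit_ball w.

Lemma inner_lt1 z : closed_unit_ball z -> normc (inner z w) < 1.
Proof.
move=> z1; apply: le_lt_trans (cauchy_schwarz z w) _.
apply: le_lt_trans (_ : 1 * enorm w < 1); last by rewrite mul1r.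
by apply: ler_wpM2r => //; exact: enorm_ge0.
Qed.

Lemma differentiable_inner z : differentiable (fun z : Cvec R d => inner z w) z.
Proof.
rewrite (_ : (fun z => _) = \sum_(j < d) (fun z : Cvec R d => z ord0 j * (w ord0 j)^*%C)).
  apply: differentiable_sum => j.
  apply: (@differentiableM _ _ (fun z : Cvec R d => z ord0 j) (fun=> (w ord0 j)^*%C)).
    exact: differentiable_coord.
  exact: differentiable_cst.
by apply/funext => x; rewrite fct_sumE.
Qed.

Lemma differentiable_kernel z : closed_unit_ball z ->
  differentiable (cauchy_kernel w) z.
Proof.
move=> z1; have n0 : 1 - inner z w != 0.
  apply/eqP => h; have := normc_1B_gt0 (inner_lt1 z1).
  by rewrite h Normc.normc0 ltxx.
have d1 : differentiable (fun z : Cvec R d => 1 - inner z w) z.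
  apply: (@differentiableB _ _ _ (fun=> 1 : R[i]) (fun z : Cvec R d => inner z w)).
    exact: differentiable_cst.
  exact: differentiable_inner.
apply: (@differentiableV _ _ (fun z : Cvec R d => (1 - inner z w) ^+ d)); last first.
  by rewrite expf_neq0.
suff H n : differentiable (fun z : Cvec R d => (1 - inner z w) ^+ n) z by exact: H.
case: n => [|n].
  rewrite (_ : (fun z => _) = fun=> 1); first exact: differentiable_cst.
  by apply/funext => x; rewrite expr0.
rewrite (_ : (fun z => _) = (fun z : Cvec R d => 1 - inner z w) ^+ n.+1).
  exact: differentiableX.
by rewrite exprfctE.
Qed.

Lemma kernel_continuous : {within closed_unit_ball, continuous (cauchy_kernel w)}.
Proof.
apply: continuous_in_subspaceT => z; rewrite inE => z1.
exact: differentiable_continuous (differentiable_kernel z1).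
Qed.

Lemma kernel_holomorphic : holomorphic_on_ball (cauchy_kernel w).
Proof. by move=> z z1; apply: differentiable_kernel; exact: ltW. Qed.

End FixedPole.
End CauchyKernel.

Section KernelNorm.
Variables (R : realType) (d : nat) (p : R).
Hypothesis p_gt1 : 1 < p.
Hypothesis d_gt0 : (0 < d)%N.
Implicit Types (z w : Cvec R d).
Local Notation sphere := (unit_sphere : set (borelC R d)).
Local Notation K := (kap d p).

Let p_gt0 : 0 < p. Proof. exact: lt_trans ltr01 p_gt1. Qed.
Let mS : measurable sphere. Proof. exact: measurable_unit_sphere. Qed.

Lemma measurable_kap_inner (d' : measure_display) (T : measurableType d')
    (F G : T -> Cvec R d) (r : R) :
  measurable_fun [set: T] (F : T -> borelC R d) ->
  measurable_fun [set: T] (G : T -> borelC R d) ->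
  measurable_fun [set: T] (fun t => K (normc (1 - r%:C%C * inner (F t) (G t)))).
Proof.
move=> mF mG; apply: (measurableT_comp (measurable_kap d p)).
exact: measurable_normc_1Binner.
Qed.

Lemma inner_scaled_sphere (r : R) z w : inner z (r%:C%C *: w) = r%:C%C * inner z w.
Proof. by rewrite innerZr conjc_real. Qed.

Lemma measurable_kap_pole (a b : R) w : measurable_fun [set: borelC R d]
  (fun z : borelC R d => K (normc (1 - inner (a%:C%C *: (z : Cvec R d)) w))).
Proof.
rewrite (_ : (fun z => _) = fun z : borelC R d =>
  K (normc (1 - a%:C%C * inner (z : Cvec R d) w))).
  by apply: (@measurable_kap_inner _ (borelC R d) id (fun=> w)).
by apply/funext => z; rewrite innerZl.
Qed.

Lemma hardy_mean_kernel w r : hardy_mean p (cauchy_kernel w) r =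
  (\int[@sigma R d]_(z in unit_sphere)
     (K (normc (1 - inner (r%:C%C *: (z : Cvec R d)) w)))%:E)%E.
Proof. by apply: eq_integral => z _; rewrite kap_kernel. Qed.

Lemma sigma_sphere_fin : sigma sphere \is a fin_num.
Proof. by rewrite ge0_fin_numE// sigma_fin. Qed.

Lemma sigma_sphere_gt0 : (0 < sigma sphere)%E.
Proof.
have [z z1] := exists_sphere_point R d_gt0.
apply: lt_le_trans (sigma_nonisotropic_ball_gt0 d_gt0 z1 ltr01) _.
apply: le_measure; rewrite ?inE; [exact: measurable_nonisotropic_ball|exact: mS|].
by move=> w [].
Qed.

Lemma scaled_sphere_norm (r : R) z : 0 <= r -> unit_sphere z -> enorm (r%:C%C *: z) = r.
Proof. by move=> r0 z1; rewrite enormZ normc_real ger0_norm// z1 mulr1. Qed.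

Lemma kernel_norm_powR_fin w : unit_ball w -> (hardy_norm p (cauchy_kernel w) `^ p < +oo)%E.
Proof.
move=> w1; have w0 : 0 < 1 - enorm w by rewrite subr_gt0.
apply: (@le_lt_trans _ _ ((K (1 - enorm w))%:E * sigma sphere)%E); last first.
  by rewrite -(fineK sigma_sphere_fin) -EFinM ltry.
apply: hardy_norm_le => // r /andP[r0 r1]; rewrite hardy_mean_kernel.
rewrite -(@integral_cst _ _ R (@sigma R d) _ mS (K (1 - enorm w))%:E).
apply: ge0_le_integral => //.
- by move=> z _; rewrite lee_fin kap_ge0.
- by apply/measurable_EFinP; apply: measurable_funTS; exact: measurable_kap_pole.
- move=> z z1; rewrite lee_fin; apply: kap_le => //.
  apply: le_trans (normc_1B_ge _); rewrite lerD2l lerN2.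
  apply: le_trans (cauchy_schwarz _ _) _.
  by rewrite (scaled_sphere_norm (ltW r0) z1) ler_piMl ?enorm_ge0// ltW.
Qed.

Lemma kernel_norm_powR_gt0 w : unit_ball w -> (0 < hardy_norm p (cauchy_kernel w) `^ p)%E.
Proof.
move=> w1; have h2 : 0 < (2^-1 : R) < 1 by rewrite invr_gt0 ltr0n invf_lt1 ?ltr1n.
apply: lt_le_trans (hardy_mean_le_norm p_gt0 (cauchy_kernel w) h2).
apply: (@lt_le_trans _ _ ((K 2)%:E * sigma sphere)%E).
  by rewrite mule_gt0 ?lte_fin ?kap_gt0// sigma_sphere_gt0.
have /andP[h0 h1] := h2.
rewrite hardy_mean_kernel.
rewrite -(@integral_cst _ _ R (@sigma R d) _ mS (K 2)%:E).
apply: ge0_le_integral => //.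
- by move=> z _; rewrite lee_fin kap_ge0.
- by apply/measurable_EFinP; apply: measurable_funTS; exact: measurable_kap_pole.
- move=> z z1; rewrite lee_fin.
  have b1 : normc (inner ((2^-1)%:C%C *: (z : Cvec R d)) w) < 1.
    apply: inner_lt1 => //; rewrite /closed_unit_ball /=.
    by rewrite (scaled_sphere_norm (ltW h0) z1) ltW.
  apply: kap_le => //; first exact: normc_1B_gt0.
  by apply: le_trans (le_normcD _ _) _; rewrite normcN Normc.normc1; lra.
Qed.

Lemma kernel_norm_real w : unit_ball w -> exists2 n : R, 0 < n &
  hardy_norm p (cauchy_kernel w) = n%:E.
Proof.
move=> w1; have N0 : (0 <= hardy_norm p (cauchy_kernel w))%E by exact: poweR_ge0.
have Nf := kernel_norm_powR_fin w1; have Np := kernel_norm_powR_gt0 w1.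
have Nfin : (hardy_norm p (cauchy_kernel w) < +oo)%E.
  by apply: lty_poweRy Nf; rewrite gt_eqF.
exists (fine (hardy_norm p (cauchy_kernel w))).
  by rewrite fine_gt0// Nfin andbT; exact: gt0_poweR Np.
by rewrite fineK// ge0_fin_numE.
Qed.

Lemma kernel_in_hardy_space w : unit_ball w -> hardy_space p (cauchy_kernel w).
Proof.
move=> w1; split; first exact: kernel_holomorphic.
by have [n _ ->] := kernel_norm_real w1; rewrite ltry.
Qed.

Lemma integral_normalized_kernel (mu : {measure set (borelC R d) -> \bar R}) w (n : R) :
  unit_ball w -> 0 < n -> hardy_norm p (cauchy_kernel w) = n%:E ->
  (\int[mu]_(z in closed_unit_ball) (normc (normalized_kernel p w z) `^ p)%:E =
   ((n `^ p)^-1)%:E *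
     \int[mu]_(z in closed_unit_ball) (normc (cauchy_kernel w z) `^ p)%:E)%E.
Proof.
move=> w1 n0 Nn; rewrite -ge0_integralZl_EFin; last 4 first.
- exact: measurable_closed_unit_ball.
- by move=> z _; rewrite lee_fin powR_ge0.
- apply/measurable_EFinP; apply: measurable_funTS.
  rewrite (_ : (fun z => _) = fun z : borelC R d =>
    K (normc (1 - 1%:C%C * inner (z : Cvec R d) w))).
    by apply: (@measurable_kap_inner _ (borelC R d) id (fun=> w)).
  by apply/funext => z; rewrite kap_kernel mul1r.
- by rewrite invr_ge0 powR_ge0.
apply: eq_integral => z _; rewrite -EFinM; congr EFin.
rewrite /normalized_kernel Nn Normc.normcM (Normc.normcV (fine n%:E)%:C%C) normc_real.
rewrite [fine _]/= (gtr0_norm n0) powRM ?normc_ge0//.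
  rewrite mulrC; congr (_ * _).
  by rewrite -(powR_inv1 (ltW n0)) -powRrM mulN1r powRN.
by rewrite invr_ge0 ltW.
Qed.

Lemma kernel_norm_unitary U w : unitary U ->
  hardy_norm p (cauchy_kernel (U w)) = hardy_norm p (cauchy_kernel w).
Proof.
move=> uU; have [_ ip _] := uU.
apply: eq_hardy_norm => r.
rewrite !hardy_mean_kernel.
rewrite -(integral_sigma_unitary d_gt0 (g := fun z : borelC R d =>
  (K (normc (1 - inner (r%:C%C *: (z : Cvec R d)) (U w))))%:E) uU).
- by apply: eq_integral => z _; rewrite -(unitaryZ _ _ uU) ip.
- by apply/measurable_EFinP; exact: measurable_kap_pole.
- by move=> z; rewrite lee_fin kap_ge0.
Qed.

Lemma kernel_norm_sphere (r : R) z w : unit_sphere z -> unit_sphere w ->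
  hardy_norm p (cauchy_kernel (r%:C%C *: z)) = hardy_norm p (cauchy_kernel (r%:C%C *: w)).
Proof.
move=> z1 w1; have [U uU <-] := sphere_transitive z1 w1.
by rewrite -(unitaryZ (r%:C%C) z uU) (kernel_norm_unitary (r%:C%C *: z) uU).
Qed.

(** Integrating the kernel in its pole: by the symmetry of [|1 - <z, w>|] and
    unitary invariance this is again a mean of a kernel, up to the radial
    perturbations of [normc_1B_scale] and [normc_1B_shrink]. *)
Lemma kernel_pole_mean_le (r : R) z w : 0 < r < 1 -> closed_unit_ball z -> unit_sphere w ->
  (\int[@sigma R d]_(x in unit_sphere) (K (normc (1 - inner z (r%:C%C *: (x : Cvec R d)))))%:E
   <= ((K 2)^-1 ^+ 2)%:E * hardy_norm p (cauchy_kernel (r%:C%C *: w)) `^ p)%E.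
Proof.
move=> r01 z1 w1; have /andP[r0 r1] := r01.
(* polar coordinates; the direction of the origin is arbitrary *)
have [v [v1 zv]] : exists v : Cvec R d, unit_sphere v /\ z = (enorm z)%:C%C *: v.
  have [z0|z0] := eqVneq (enorm z) 0.
    by exists w; split=> //; rewrite z0 scale0r; exact: enorm_eq0.
  exists ((enorm z)^-1%:C%C *: z); split.
    by rewrite /unit_sphere /= enormZ normc_real ger0_norm ?invr_ge0 ?enorm_ge0// mulVf.
  by rewrite scalerA -rmorphM /= mulfV// scale1r.
have s01 : 0 <= enorm z <= 1 by rewrite enorm_ge0.
rewrite (kernel_norm_sphere r w1 v1).
have c0 := @kap2_inv_gt0 R d p.
have mK (a : R) (u : Cvec R d) : measurable_fun sphere
    (fun x => (K (normc (1 - a%:C%C * inner u (x : Cvec R d))))%:E).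
  apply/measurable_EFinP; apply: measurable_funTS.
  by apply: (@measurable_kap_inner _ (borelC R d) (fun=> u) id).
have mean := hardy_mean_le_norm p_gt0 (cauchy_kernel (r%:C%C *: v)) r01.
apply: (@le_trans _ _ (((K 2)^-1 ^+ 2)%:E * hardy_mean p (cauchy_kernel (r%:C%C *: v)) r)%E).
  rewrite hardy_mean_kernel -ge0_integralZl_EFin; last 4 first.
  - exact: mS.
  - by move=> x _; rewrite lee_fin kap_ge0.
  - by apply/measurable_EFinP; apply: measurable_funTS; exact: measurable_kap_pole.
  - by rewrite exprn_ge0// ltW.
  apply: ge0_le_integral.
  - exact: mS.
  - by move=> x _; rewrite lee_fin kap_ge0.
  - by under eq_fun do rewrite inner_scaled_sphere; exact: mK.
  - apply: measurable_funeM; apply/measurable_EFinP; apply: measurable_funTS.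
    exact: measurable_kap_pole.
  move=> x x1; rewrite -EFinM lee_fin inner_scaled_sphere [in leLHS]zv innerZl.
  rewrite innerZl inner_scaled_sphere.
  have b1 : normc (inner v x) <= 1.
    by apply: le_trans (cauchy_schwarz _ _) _; rewrite v1 x1 mulr1.
  set c := r%:C%C * inner v x.
  have c1 : normc c <= r.
    by rewrite Normc.normcM normc_real ger0_norm ?(ltW r0)// ler_piMr// ltW.
  have c1' : normc c <= 1 by rewrite (le_trans c1)// ltW.
  have r01' : 0 <= r <= 1 by rewrite !ltW.
  have -> : normc (1 - r%:C%C * (r%:C%C * inner x v)) = normc (1 - r%:C%C * c).
    rewrite -normc_conj; congr normc.
    by rewrite rmorphB rmorph1 !rmorphM /= !oppr0 -innerC.
  have -> : r%:C%C * ((enorm z)%:C%C * inner v x) = (enorm z)%:C%C * c.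
    by rewrite mulrCA.
  have p1 : 0 < normc (1 - c) by apply: normc_1B_gt0; exact: le_lt_trans c1 r1.
  have p2 : 0 < normc (1 - r%:C%C * c).
    apply: normc_1B_gt0; rewrite Normc.normcM normc_real ger0_norm ?(ltW r0)//.
    by apply: le_lt_trans r1; rewrite ler_piMr// ltW.
  apply: le_trans (kap_le2 d p_gt1 p1 (normc_1B_scale s01 c1')) _.
  rewrite expr2 -mulrA; apply: ler_wpM2l; first exact: ltW.
  exact: (kap_le2 d p_gt1 p2 (normc_1B_shrink r01' c1)).
by apply: lee_wpmul2l => //; rewrite lee_fin exprn_ge0// ltW.
Qed.

(** The kernels blow up at the boundary: near the pole the integrand is at least
    of order [delta ^- (d * p)] on a ball of measure at least of order
    [delta ^+ d]. *)
Lemma kernel_norm_lower : exists2 c : R, 0 < c & forall delta z, 0 < delta < 1 ->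
  unit_sphere z -> ((c * (delta^-1) `^ (p - 1))%:E <=
    hardy_norm p (cauchy_kernel ((1 - delta)%:C%C *: z)) `^ p)%E.
Proof.
have [c c0 cP] := sigma_nonisotropic_ball_lower R d_gt0.
(* on the ball, [|1 - r ^+ 2 * <x, z>| <= delta + (1 - r ^+ 2) <= 3 * delta] *)
exists (K 3 * c); first by rewrite mulr_gt0// kap_gt0.
move=> delta z /andP[d0 d1] z1; pose r := 1 - delta.
have r01 : 0 < r < 1 by rewrite /r; apply/andP; split; lra.
have /andP[r0 r1] := r01.
apply: le_trans (hardy_mean_le_norm p_gt0 _ r01).
have mQ := measurable_nonisotropic_ball z delta.
rewrite hardy_mean_kernel.
apply: (@le_trans _ _ (\int[@sigma R d]_(x in nonisotropic_ball z delta)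
   (K (normc (1 - inner (r%:C%C *: (x : Cvec R d)) (r%:C%C *: z))))%:E))%E; last first.
  apply: ge0_subset_integral => //.
  - by apply/measurable_EFinP; apply: measurable_funTS; exact: measurable_kap_pole.
  - by move=> x _; rewrite lee_fin kap_ge0.
  - by move=> x [].
apply: (@le_trans _ _ (\int[@sigma R d]_(x in nonisotropic_ball z delta)
   (cst (K (3 * delta))%:E x)))%E; last first.
  apply: ge0_le_integral => //.
  - by move=> x _; rewrite lee_fin kap_ge0.
  - by apply/measurable_EFinP; apply: measurable_funTS; exact: measurable_kap_pole.
  move=> x [x1 xz]; rewrite lee_fin innerZl inner_scaled_sphere.
  have b1 : normc (inner x z) <= 1.
    by apply: le_trans (cauchy_schwarz _ _) _; rewrite x1 z1 mulr1.
  rewrite mulrA -rmorphM /=.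
  have rr : 0 <= r * r <= 1.
    by rewrite mulr_ge0 ?(ltW r0)//= -[leRHS]mulr1; apply: ler_pM; rewrite ?(ltW r0) ?(ltW r1).
  have rr1 : r * r < 1.
    by rewrite -[ltRHS]mulr1; apply: ltr_pM; rewrite ?(ltW r0).
  apply: kap_le => //.
    apply: normc_1B_gt0; rewrite Normc.normcM normc_real ger0_norm; last by case/andP: rr.
    by apply: le_lt_trans rr1; rewrite ler_piMr//; case/andP: rr.
  have -> : 1 - (r * r)%:C%C * inner x z = (1 - inner x z) + (1 - r * r)%:C%C * inner x z.
    by move: (r * r) (inner x z) => a b; rewrite rmorphB rmorph1; ring.
  apply: le_trans (le_normcD _ _) _.
  rewrite Normc.normcM normc_real ger0_norm; last by rewrite subr_ge0; case/andP: rr.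
  have h1 : (1 - r * r) * normc (inner x z) <= 1 - r * r.
    by rewrite ler_piMr// subr_ge0; case/andP: rr.
  have h2 : 1 - r * r <= 2 * delta.
    have -> : 1 - r * r = delta * (2 - delta) by rewrite /r; ring.
    by rewrite mulrC ler_pM2r//; lra.
  by rewrite normc_1Binner in xz; lra.
rewrite integral_cst//.
apply: (@le_trans _ _ ((K (3 * delta))%:E * (c * delta ^+ d)%:E)%E); last first.
  apply: lee_wpmul2l; first by rewrite lee_fin kap_ge0.
  by apply: cP => //; rewrite d0 ltW.
rewrite -EFinM lee_fin kapM ?(ltW d0)//.
rewrite -!mulrA; apply: ler_wpM2l; first exact: kap_ge0.
rewrite [leRHS]mulrCA; apply: ler_wpM2l; first exact: ltW.
have D0 : 0 < delta ^+ d by rewrite exprn_gt0.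
have -> : K delta * delta ^+ d = ((delta ^+ d)^-1) `^ (p - 1).
  rewrite /kap -{2}(@powRr1 _ (delta ^+ d)) ?(ltW D0)// -powRD; last first.
    by rewrite (gt_eqF D0) implybT.
  by rewrite -powR_inv1 ?(ltW D0)// -powRrM; congr (_ `^ _); ring.
have dd : delta^-1 <= (delta ^+ d)^-1.
  rewrite lef_pV2 ?posrE// -[leRHS]expr1; apply: ler_wiXn2l => //; exact: ltW.
apply: ge0_ler_powR => //; rewrite ?nnegrE ?invr_ge0 ?(ltW d0) ?(ltW D0)//.
by rewrite subr_ge0 ltW.
Qed.

End KernelNorm.

(** * From the kernel test to domination *)

Section KernelTest.
Variables (R : realType) (d : nat) (p : R).
Hypothesis p_gt1 : 1 < p.
Hypothesis d_gt0 : (0 < d)%N.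
Implicit Types (z w : Cvec R d).
Local Notation K := (kap d p).

Let p_gt0 : 0 < p. Proof. exact: lt_trans ltr01 p_gt1. Qed.

(** Keeps the kernels with poles [r *: w] bounded at [z], uniformly in [r]. Inside
    the ball this is clear. On the sphere, [1 - <z0, z>] being Lipschitz in [z],
    the point [z] lies at a positive Euclidean distance from the ball, which
    [sphere_dist_le] turns into a bound for the quasi-distance; the factor [r]
    costs a constant. *)
Lemma nonisotropic_ball_separated z0 delta z : unit_sphere z0 ->
  closed_unit_ball z -> ~ nonisotropic_ball z0 delta z ->
  exists2 eta : R, 0 < eta & forall w r, nonisotropic_ball z0 delta w -> 0 <= r <= 1 ->
    eta <= normc (1 - r%:C%C * inner z w).
Proof.
move=> z01 z1 zQ.
have b w : unit_sphere w -> normc (inner z w) <= enorm z.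
  by move=> w1; apply: le_trans (cauchy_schwarz _ _) _; rewrite w1 mulr1.
have [zlt|zge] := ltP (enorm z) 1.
  exists (1 - enorm z); first by rewrite subr_gt0.
  move=> w r [w1 _] /andP[r0 r1]; apply: le_trans (normc_1B_ge _).
  rewrite lerD2l lerN2 Normc.normcM normc_real ger0_norm//.
  apply: le_trans (b w w1); rewrite ler_piMl ?normc_ge0//.
have zS : unit_sphere z by apply/eqP; rewrite eq_le zge andbT.
pose g := normc (1 - inner z0 z) - delta.
have g0 : 0 < g by rewrite subr_gt0 ltNge; apply/negP => h; apply: zQ.
exists (g ^+ 2 / 4); first by rewrite divr_gt0 ?exprn_gt0.
move=> w r [w1 wd] r01.
have gw : g <= enorm (z - w).
  rewrite /g lerBlDl; apply: (@le_trans _ _ (normc (1 - inner z0 w) + enorm (z - w))); last first.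
    by rewrite lerD2r.
  have -> : 1 - inner z0 z = (1 - inner z0 w) + inner z0 (w - z).
    by rewrite innerBr addrA subrK.
  apply: le_trans (le_normcD _ _) _; rewrite lerD2l.
  by apply: le_trans (cauchy_schwarz _ _) _; rewrite z01 mul1r enormB.
have g2 : g ^+ 2 <= enorm (z - w) ^+ 2.
  by rewrite lerXn2r// nnegrE ?enorm_ge0 ?(ltW g0).
have bz : normc (inner z w) <= 1 by rewrite (le_trans (b w w1)).
have := normc_1B_scale r01 bz; have := sphere_dist_le zS w1; lra.
Qed.

Variable mu : {finite_measure set (borelC R d) -> \bar R}.

Section FixedBall.
Variables (z0 : Cvec R d) (delta : R).
Hypothesis z01 : unit_sphere z0.
Local Notation Q := (nonisotropic_ball z0 delta : set (borelC R d)).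
Local Notation B := (closed_unit_ball : set (borelC R d)).

Let mQ : measurable Q. Proof. exact: measurable_nonisotropic_ball. Qed.
Let mB : measurable B. Proof. exact: measurable_closed_unit_ball. Qed.
Let mS : measurable (unit_sphere : set (borelC R d)).
Proof. exact: measurable_unit_sphere. Qed.

Let QB : Q `<=` B. Proof. by move=> z [z1 _]; rewrite /closed_unit_ball /= z1. Qed.

Definition radius (n : nat) : R := 1 - n.+2%:R^-1.

Lemma radius01 n : 0 < radius n < 1.
Proof.
rewrite /radius subr_gt0 invf_lt1 ?ltr1n//= ltrBlDr ltrDl invr_gt0.
Qed.

Definition pole_norm n : R :=
  fine (hardy_norm p (cauchy_kernel ((radius n)%:C%C *: z0))).

Lemma pole_in_ball n z : unit_sphere z -> unit_ball ((radius n)%:C%C *: z).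
Proof.
have /andP[r0 r1] := radius01 n.
by move=> z1; rewrite /unit_ball /= (scaled_sphere_norm (ltW r0) z1).
Qed.

Lemma pole_normP n : 0 < pole_norm n /\ forall z, unit_sphere z ->
  hardy_norm p (cauchy_kernel ((radius n)%:C%C *: z)) = (pole_norm n)%:E.
Proof.
have [m m0 mE] := kernel_norm_real p_gt1 d_gt0 (pole_in_ball n z01).
have E : pole_norm n = m by rewrite /pole_norm mE.
rewrite E; split; first exact: m0.
move=> z z1; exact: (etrans (kernel_norm_sphere p d_gt0 (radius n) z1 z01) mE).
Qed.

Let T n := pole_norm n `^ p.

Let T_gt0 n : 0 < T n. Proof. by rewrite powR_gt0//; case: (pole_normP n). Qed.

Let TE n z : unit_sphere z ->
  (hardy_norm p (cauchy_kernel ((radius n)%:C%C *: z)) `^ p = (T n)%:E)%E.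
Proof. by move=> z1; have [_ ->//] := pole_normP n; rewrite poweR_EFin. Qed.

(** The exponent [p - 1] in [kernel_norm_lower] is positive. *)
Lemma pole_norm_diverges : T n @[n --> \oo] --> +oo.
Proof.
have [c c0 cP] := kernel_norm_lower p_gt1 d_gt0.
apply/cvgryPge => M; pose M' := Num.max 0 (M / c).
have q0 : 0 < p - 1 by rewrite subr_gt0.
pose A := M' `^ (p - 1)^-1.
have A0 : 0 <= A by exact: powR_ge0.
exists (Num.truncn A) => // n /= An.
have nA : A <= n.+2%:R.
  have /andP[_ h] := truncn_itv A0.
  by apply: le_trans (ltW h) _; rewrite ler_nat ltnS (leq_trans An).
have d01 : 0 < (n.+2%:R^-1 : R) < 1 by rewrite invr_gt0 ltr0n invf_lt1 ?ltr1n.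
have := cP _ _ d01 z01; rewrite TE// lee_fin; apply: le_trans.
have MM : M' <= n.+2%:R `^ (p - 1).
  have -> : M' = A `^ (p - 1).
    by rewrite /A -powRrM mulVf ?gt_eqF// powRr1// le_max lexx.
  by apply: ge0_ler_powR; rewrite ?nnegrE ?(ltW q0).
rewrite invrK mulrC -ler_pdivrMr//; apply: le_trans MM.
by rewrite le_max lexx orbT.
Qed.

(* the [p]-th power of the modulus of the normalized kernel with pole
   [radius n *: q.1], at [q.2] *)
Let k n (q : borelC R d * borelC R d) : R :=
  (T n)^-1 * K (normc (1 - (radius n)%:C%C * inner (q.2 : Cvec R d) (q.1 : Cvec R d))).

Let mk n : measurable_fun setT (k n).
Proof.
apply: measurable_funM; first exact: measurable_cst.
exact: (@measurable_kap_inner R d p _ (borelC R d * borelC R d)%type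
  snd fst (radius n) (@measurable_snd _ _ (borelC R d) (borelC R d))
  (@measurable_fst _ _ (borelC R d) (borelC R d))).
Qed.

Let k0 n q : 0 <= k n q.
Proof. by rewrite mulr_ge0 ?kap_ge0// invr_ge0 ltW. Qed.

Let F n (z : borelC R d) : \bar R := (\int[@sigma R d]_(w in Q) (k n (w, z))%:E)%E.

Let F_ge0 n z : (0 <= F n z)%E.
Proof. by apply: integral_ge0 => w _; rewrite lee_fin. Qed.

Let mF n (D : set (borelC R d)) : measurable D -> measurable_fun D (F n).
Proof.
move=> mD; have mk' : measurable_fun setT (fun q : borelC R d * borelC R d => k n (q.2, q.1)).
  by apply: (measurableT_comp (mk n)); exact: measurable_swap.
exact: (@measurable_tonelli_in _ _ _ _ R (@sigma R d) _ _ _ mD mQ mk' (fun=> k0 n _)).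
Qed.

Let mkl n z : measurable_fun [set: borelC R d] (fun w => k n (w, z)).
Proof. by apply: (measurableT_comp (mk n)); exact: measurable_pair2. Qed.

Local Notation Kc := ((K 2)^-1 ^+ 2).

Let F_le n z : closed_unit_ball z -> (F n z <= Kc%:E)%E.
Proof.
move=> z1; apply: (@le_trans _ _ (\int[@sigma R d]_(w in unit_sphere) (k n (w, z))%:E))%E.
  apply: ge0_subset_integral => //.
  - by apply/measurable_EFinP; apply: measurable_funTS; exact: mkl.
  - by move=> w _; rewrite lee_fin.
  - by move=> w [].
have := kernel_pole_mean_le p_gt1 d_gt0 (radius01 n) z1 z01.
rewrite TE// -EFinM => H.
have mg : measurable_fun (unit_sphere : set (borelC R d)) (fun w : borelC R d =>
    (K (normc (1 - inner z ((radius n)%:C%C *: (w : Cvec R d)))))%:E).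
  under eq_fun do rewrite inner_scaled_sphere.
  apply/measurable_EFinP; apply: measurable_funTS.
  by apply: (@measurable_kap_inner _ _ _ _ (borelC R d) (fun=> z) id).
rewrite (eq_integral (fun w : borelC R d => ((T n)^-1)%:E *
    (K (normc (1 - inner z ((radius n)%:C%C *: (w : Cvec R d)))))%:E)%E) => [|w _].
  rewrite ge0_integralZl_EFin//; last 2 first.
  - by move=> w _; rewrite lee_fin kap_ge0.
  - by rewrite invr_ge0 ltW.
  apply: (@le_trans _ _ (((T n)^-1)%:E * (Kc * T n)%:E)%E).
    by apply: lee_wpmul2l => //; rewrite lee_fin invr_ge0 ltW.
  by rewrite -EFinM mulrCA mulVf ?mulr1// gt_eqF.
by rewrite -EFinM inner_scaled_sphere.
Qed.

Let F_cvg0 z : closed_unit_ball z -> ~ Q z -> (F n z @[n --> \oo] --> 0)%E.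
Proof.
move=> z1 zQ; have [eta eta0 etaP] := nonisotropic_ball_separated z01 z1 zQ.
have Qfin : sigma Q \is a fin_num by rewrite ge0_fin_numE// sigma_fin.
pose A := K eta * fine (sigma Q).
apply: (@squeeze_cvge _ _ _ _ (fun=> 0%E) _ (fun n => ((T n)^-1 * A)%:E)).
- apply: nearW => n; rewrite F_ge0/=.
  apply: (@le_trans _ _ (\int[@sigma R d]_(w in Q) (cst ((T n)^-1 * K eta)%:E w))%E).
    apply: ge0_le_integral => //.
    + by move=> w _; rewrite lee_fin.
    + by apply/measurable_EFinP; apply: measurable_funTS; exact: mkl.
    + move=> w wQ; rewrite lee_fin /k /=; apply: ler_wpM2l; first by rewrite invr_ge0 ltW.
      apply: kap_le => //; apply: etaP => //.
      by have /andP[r0 r1] := radius01 n; rewrite !ltW.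
  by rewrite integral_cst// /A mulrA (EFinM _ (fine _)) (fineK Qfin).
- exact: cvg_cst.
- apply/fine_cvgP; split; first exact: nearW.
  rewrite [X in _ --> X](_ : _ = 0 * A); last by rewrite mul0r.
  apply: cvgMl; apply/gtr0_cvgV0; first by apply: nearW => n; exact: T_gt0.
  exact: pole_norm_diverges.
Qed.

(** Integrating the kernel test over the poles in [Q], with Tonelli, gives
    [C * sigma Q <= \int[mu] F n] for all [n]. The functions [F n] are bounded by
    a constant on the closed ball and tend to zero off [Q], so that in the limit
    only the integral over [Q] counts. *)
Lemma kernel_test_ball (C : R) : 0 < C ->
  (forall w, unit_ball w -> (C%:E <= \int[mu]_(z in closed_unit_ball)
     (normc (normalized_kernel p w z) `^ p)%:E)%E) ->
  (C%:E * sigma Q <= Kc%:E * mu Q)%E.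
Proof.
move=> C0 test; pose D : set (borelC R d) := B `\` Q.
have mD : measurable D by exact: measurableD.
have Kc0 : 0 <= Kc by rewrite exprn_ge0// ltW// kap2_inv_gt0.
have low n : (C%:E * sigma Q <= \int[mu]_(z in B) F n z)%E.
  rewrite -(@tonelli_in _ _ _ _ R (@sigma R d) mu _ _ (k n) mQ mB (mk n) (k0 n)).
  rewrite -(@integral_cst _ _ R (@sigma R d) _ mQ C%:E).
  apply: ge0_le_integral.
  - exact: mQ.
  - by move=> w _; rewrite lee_fin ltW.
  - exact: measurable_cst.
  - exact: (@measurable_tonelli_in _ _ _ _ R mu _ _ _ mQ mB (mk n) (k0 n)).
  move=> w [w1 _]; apply: le_trans (test _ (pole_in_ball n w1)) _.
  have [N0 NE] := pole_normP n.
  rewrite (integral_normalized_kernel mu (pole_in_ball n w1) N0 (NE w w1)).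
  rewrite -ge0_integralZl_EFin; last 4 first.
  - exact: mB.
  - by move=> z _; rewrite lee_fin powR_ge0.
  - apply/measurable_EFinP; apply: measurable_funTS.
    under eq_fun do rewrite kap_kernel inner_scaled_sphere.
    by apply: (@measurable_kap_inner _ _ _ _ (borelC R d) id (fun=> w)).
  - by rewrite invr_ge0 powR_ge0.
  rewrite le_eqVlt; apply/orP; left; apply/eqP; apply: eq_integral => z _.
  by rewrite -EFinM kap_kernel inner_scaled_sphere.
(* [F n] is replaced by its bound on [Q] *)
have split_le n : (C%:E * sigma Q <= Kc%:E * mu Q + \int[mu]_(z in D) F n z)%E.
  apply: le_trans (low n) _; rewrite -(setDUK QB) ge0_integral_setU//.
  - apply: leeD => //; rewrite -(@integral_cst _ _ R mu _ mQ Kc%:E).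
    apply: ge0_le_integral => //; first exact: mF.
    by move=> z zQ; apply: F_le; exact: QB.
  - by apply: mF; rewrite setDUK.
  - by apply/disj_set2P; rewrite setDIK.
have lim0 : (\int[mu]_(z in D) F n z @[n --> \oo] --> 0)%E.
  have := @dominated_cvg _ _ R mu D mD F (fun=> 0%E) (fun=> Kc%:E).
  rewrite integral0; apply => //.
  - by move=> n; exact: mF.
  - by move=> z [zB zQ]; exact: F_cvg0.
  - exact: finite_measure_integrable_cst.
  - by move=> n z [zB _]; rewrite gee0_abs// F_le.
have lim : (Kc%:E * mu Q + \int[mu]_(z in D) F n z @[n --> \oo] --> Kc%:E * mu Q + 0)%E.
  apply: cvgeD => //; last exact: cvg_cst.
  by rewrite fin_num_adde_defl.
rewrite -[leRHS]adde0 -(cvg_lim _ lim)//; apply: lime_ge.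
  by apply/cvg_ex; eexists; exact: lim.
by apply: nearW => n; exact: split_le.
Qed.

End FixedBall.
End KernelTest.

(** * The equivalence *)

Section Equivalence.
Variables (R : realType) (d : nat) (p : R).
Variable mu : {finite_measure set (borelC R d) -> \bar R}.
Hypothesis d_gt0 : (0 < d)%N.
Hypothesis p_gt1 : 1 < p.
Local Notation B := (closed_unit_ball : set (borelC R d)).

(** The kernels are among the functions tested. *)
Lemma kernel_test_of_reverse_Carleson (C : R) w :
  (forall f : Cvec R d -> R[i],
    {within closed_unit_ball, continuous f} -> hardy_space p f ->
    (C%:E * hardy_norm p f `^ p <=
      \int[mu]_(z in closed_unit_ball) (normc (f z) `^ p)%:E)%E) ->
  unit_ball w ->
  (C%:E <= \int[mu]_(z in closed_unit_ball)
             (normc (normalized_kernel p w z) `^ p)%:E)%E.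
Proof.
move=> rev w1; have [n n0 nE] := kernel_norm_real p_gt1 d_gt0 w1.
have := rev _ (kernel_continuous w1) (kernel_in_hardy_space p_gt1 d_gt0 w1).
rewrite (integral_normalized_kernel mu w1 n0 nE) nE poweR_EFin.
have np0 : 0 < n `^ p by exact: powR_gt0.
have np' : (0 <= ((n `^ p)^-1)%:E :> \bar R)%E by rewrite lee_fin invr_ge0 ltW.
move=> /(lee_wpmul2l np'); apply: le_trans.
by rewrite -(EFinM C) -EFinM mulrCA mulVf ?mulr1// gt_eqF.
Qed.

Lemma dominates_of_kernel_test (C : R) z0 delta : 0 < C ->
  (forall w, unit_ball w -> (C%:E <= \int[mu]_(z in closed_unit_ball)
     (normc (normalized_kernel p w z) `^ p)%:E)%E) ->
  unit_sphere z0 ->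
  ((C / (kap d p 2)^-1 ^+ 2)%:E * sigma (nonisotropic_ball z0 delta) <=
    mu (nonisotropic_ball z0 delta))%E.
Proof.
move=> C0 test z01; have := kernel_test_ball p_gt1 d_gt0 (mu := mu) delta z01 C0 test.
have Kc0 : 0 < (kap d p 2)^-1 ^+ 2 by rewrite exprn_gt0// kap2_inv_gt0.
move: ((kap d p 2)^-1 ^+ 2) Kc0 => Kc Kc0 H.
have Kc' : (0 <= (Kc^-1)%:E :> \bar R)%E by rewrite lee_fin invr_ge0 ltW.
have := lee_wpmul2l Kc' H.
by rewrite !muleA -(EFinM _ C) -(EFinM _ Kc) mulVf ?(gt_eqF Kc0)// mul1e mulrC.
Qed.

(** The Hardy norm is at most the mean over the sphere of the boundary values,
    which is compared with the integral over the sphere against [mu]; the mass of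
    [mu] in the open ball only helps. *)
Lemma reverse_Carleson_of_dominates (C : R) (f : Cvec R d -> R[i]) : 0 < C ->
  (forall (z : Cvec R d) (delta : R), unit_sphere z -> 0 < delta ->
    (C%:E * sigma (nonisotropic_ball z delta) <= mu (nonisotropic_ball z delta))%E) ->
  {within closed_unit_ball, continuous f} -> hardy_space p f ->
  (C%:E * hardy_norm p f `^ p <=
    \int[mu]_(z in closed_unit_ball) (normc (f z) `^ p)%:E)%E.
Proof.
move=> C0 dom f_cont [f_hol _]; have p_gt0 : 0 < p := lt_trans ltr01 p_gt1.
have mh := measurable_ext_power f_cont p_gt1.
have SB : unit_sphere `<=` B by move=> z z1; rewrite /closed_unit_ball /= z1.
have mB : measurable B by exact: measurable_closed_unit_ball.
have mS : measurable (unit_sphere : set (borelC R d)) by exact: measurable_unit_sphere.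
have up : (hardy_norm p f `^ p <= \int[@sigma R d]_(z in unit_sphere) (ext_power f p z)%:E)%E.
  apply: (hardy_norm_le p_gt0) => r /andP[r0 r1].
  have r01 : 0 <= r < 1 by rewrite (ltW r0).
  apply: le_trans (sphere_mean_le f_cont p_gt1 d_gt0 r01 f_hol).
  rewrite le_eqVlt; apply/orP; left; apply/eqP; apply: eq_integral => z.
  rewrite inE => z1; rewrite ext_powerE//.
  by rewrite /closed_unit_ball /= (scaled_sphere_norm (ltW r0) z1) ltW.
apply: (@le_trans _ _ (C%:E * \int[@sigma R d]_(z in unit_sphere) (ext_power f p z)%:E)%E).
  by apply: lee_wpmul2l up; rewrite lee_fin ltW.
apply: le_trans (domination_integral d_gt0 mh (ext_power_ge0 f p)
  (ext_power_unif f_cont p_gt1) C0 dom) _.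
apply: (@le_trans _ _ (\int[mu]_(z in B) (ext_power f p z)%:E)%E).
  apply: ge0_subset_integral => //.
    by apply/measurable_EFinP; exact: measurable_funTS.
  by move=> z _; rewrite lee_fin ext_power_ge0.
rewrite le_eqVlt; apply/orP; left; apply/eqP; apply: eq_integral => z.
by rewrite inE => z1; rewrite ext_powerE.
Qed.

End Equivalence.

Theorem theorem1 (R : realType) (d : nat) (p : R)
    (mu : {finite_measure set (borelC R d) -> \bar R}) :
  (1 <= d)%N -> 1 < p ->
  mu (~` closed_unit_ball) = 0%E ->
  let reverse_Carleson := exists2 C : R, 0 < C &
    forall f : Cvec R d -> R[i],
      {within closed_unit_ball, continuous f} -> hardy_space p f ->
      (C%:E * hardy_norm p f `^ p <=
        \int[mu]_(z in closed_unit_ball) (Normc.normc (f z) `^ p)%:E)%E in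
  let kernel_test := exists2 C : R, 0 < C &
    forall w : Cvec R d, unit_ball w ->
      (C%:E <= \int[mu]_(z in closed_unit_ball)
                 (Normc.normc (normalized_kernel p w z) `^ p)%:E)%E in
  let dominates_sigma := exists2 C : R, 0 < C &
    forall (zeta : Cvec R d) (delta : R), unit_sphere zeta -> 0 < delta ->
      (C%:E * sigma (nonisotropic_ball zeta delta) <=
        mu (nonisotropic_ball zeta delta))%E in
  (reverse_Carleson <-> kernel_test) /\ (kernel_test <-> dominates_sigma).
Proof.
move=> d_gt0 p_gt1 _ reverse_Carleson kernel_test dominates_sigma.
have i_ii : reverse_Carleson -> kernel_test.
  move=> [C C0 rev]; exists C; first exact: C0.
  by move=> w w1; exact: kernel_test_of_reverse_Carleson rev w1.
have ii_iii : kernel_test -> dominates_sigma.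
  move=> [C C0 test]; exists (C / (kap d p 2)^-1 ^+ 2).
    by rewrite divr_gt0// exprn_gt0// kap2_inv_gt0.
  by move=> z delta z1 _; exact: (dominates_of_kernel_test d_gt0 p_gt1 delta C0 test z1).
have iii_i : dominates_sigma -> reverse_Carleson.
  move=> [C C0 dom]; exists C; first exact: C0.
  by move=> f f_cont f_hardy; exact: (reverse_Carleson_of_dominates d_gt0 p_gt1 C0 dom).
split; split.
- exact: i_ii.
- by move=> kt; exact: iii_i (ii_iii kt).
- exact: ii_iii.
- by move=> ds; exact: i_ii (iii_i ds).
Qed.
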